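(* Assume that $H$ has the (FPRS) property. Let $w\in W$ be straight and standard, and let $J=\operatorname{supp}(w)$. Let $\alpha\in\Phi$ be such that $\{w^z\mid z\in\mathbb Z\}\subseteq\alpha$. If $\operatorname{supp}(\alpha)\not\subseteq J^\perp\cup J^w_{\mathrm{sph}}\cup J^{\mathrm{Cox}}_{\mathrm{aff}}$, then $$U_\alpha\le\operatorname{con}(\widetilde w)\cap\operatorname{con}(\widetilde w^{-1})\le\operatorname{nub}(\widetilde w).$$
   Context: Nub. For a totally disconnected locally compact (tdlc) group $H$ and $g\in H$, $\operatorname{con}(g)=\{h\in H: g^nhg^{-n}\to 1\text{ as }n\to\infty\}$ and $\operatorname{nub}(g)=\overline{\operatorname{con}(g)}\cap\overline{\operatorname{con}(g^{-1})}$. Coxeter notions. $(W,S)$ is a Coxeter system with $S$ finite and word length $\ell$. For $J\subseteq S$, $W_J=\langle J\rangle$; the components of $J$ are the vertex sets of the connected components of the Coxeter diagram of $(W_J,J)$. $J$ is spherical if $W_J$ is finite, and essential if it is nonempty and has no spherical component. An irreducible $J$ is affine if $W_J$ is infinite and virtually abelian, indefinite if neither spherical nor affine. $J^{\mathrm{Cox}}_{\mathrm{aff}}$ is the union of the affine components of $J$; $J^\perp=\{s\in S\setminus J:sj=js\ \forall j\in J\}$. Parabolic subgroups are the conjugates of the $W_J$ (the standard ones), spherical if finite; $\mathrm{Pc}(w)$ is the smallest parabolic subgroup containing $w$; $\operatorname{supp}(w)$ is the smallest $J\subseteq S$ with $w\in W_J$. $w\ne1$ is straight if $\ell(w^n)=n\ell(w)$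 for all $n\in\mathbb N$; $w$ is cyclically reduced if $\ell(w)$ is minimal in its conjugacy class. If $(W,S)$ is irreducible indefinite and $\mathrm{Pc}(w)=W$, there is a largest spherical parabolic subgroup $P_w^{\max}$ normalized by $w$; $w$ is standard if it is cyclically reduced and $P_w^{\max}$ is standard. In general let $\mathrm{Pc}(w)=W_J$ with $J$ essential (for $w$ straight, $\mathrm{Pc}(w)=W_{\operatorname{supp}(w)}$ and $\operatorname{supp}(w)$ is essential), $J_1,\dots,J_k$ the indefinite components of $J$, $J_0=J^{\mathrm{Cox}}_{\mathrm{aff}}$, $w=w_0\cdots w_k$ with $w_i\in W_{J_i}$; $w$ is standard if each $w_i$, $i\ge1$, is standard in $(W_{J_i},J_i)$. Then $P_{w_i}^{\max}=W_{I_i}$, $I_i\subseteq J_i$, and $J^w_{\mathrm{sph}}:=I_1\cup\dots\cup I_k$. Roots. The simple roots are $\alpha_s=\{w\in W:\ell(sw)>\ell(w)\}$, and roots are the sets $v\alpha_s\subseteq W$ ($v\in W,s\in S$), forming $\Phi$; $-\alpha=W\setminus\alpha$; $\Phi_+$ (resp. $\Phi_-$) is the set of roots containing (resp. not containing) $1$. For $\alpha=v\alpha_s$, $r_\alpha=vsv^{-1}$ and $\operatorname{supp}(\alpha)=\operatorname{supp}(r_\alpha)$. $d_{\mathrm{Ch}}(x,y)=\ell(x^{-1}y)$ on $W$, and $d_{\mathrm{Ch}}(1_W,\alpha)=\min_{y\in\alpha}d_{\mathrm{Ch}}(1_W,y)$. RGD systems. An RGD system $\mathcal D=(G,(U_\alpha)_{\alpha\in\Phi})$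 of type $(W,S)$ is a group $G$ with subgroups $U_\alpha\neq\{1\}$ such that, with $T=\bigcap_\alpha N_G(U_\alpha)$ and $U_\pm=\langle U_\alpha:\alpha\in\Phi_\pm\rangle$: (i) for $\alpha\ne\beta$ with $\alpha\cap\beta\ne\varnothing\ne(-\alpha)\cap(-\beta)$, $[U_\alpha,U_\beta]\le\langle U_\gamma:\gamma\ne\alpha,\beta,\ \alpha\cap\beta\subseteq\gamma,\ (-\alpha)\cap(-\beta)\subseteq-\gamma\rangle$; (ii) for $s\in S$, $1\ne u\in U_{\alpha_s}$ there are $u',u''\in U_{-\alpha_s}$ such that $m(u)=u'uu''$ satisfies $m(u)U_\beta m(u)^{-1}=U_{s\beta}$ for all $\beta\in\Phi$; (iii) $U_{-\alpha_s}\not\le U_+$; (iv) $G=T\langle U_\alpha:\alpha\in\Phi\rangle$. Put $B=TU_+$ and $N=\langle T,m(u)\rangle$ (all such $u$); $(B,N)$ is a BN-pair with $N/T\cong W$. $\mathcal B$ is the associated building of type $(W,S)$: its chambers are the elements of $G/B$, with Weyl distance $\delta(gB,hB)=w\iff g^{-1}h\in BwB$. $\mathrm{Aut}_0(\mathcal B)$ is the group of type-preserving ($\delta$-preserving) automorphisms, with the permutation topology (pointwise stabilizers of finite sets of chambers form a basis of identity neighbourhoods). Completions. Assume the root groups $U_\alpha$ are finite. A completion $H$ of $\mathcal D$ is a first-countable tdlc group with a continuous action $H\to\mathrm{Aut}_0(\mathcal B)$ and an injective homomorphism $G\to H$ compatible with the actions on $\mathcal B$ (so $G\le H$). Here $H$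 is a completion of $\mathcal D$ in which the stabilizers of chambers are compact open, and $W\to N$, $w\mapsto\widetilde w$, is a fixed section of $N\to W$. $H$ has the (FPRS) property if for every sequence $(\alpha_n)_{n\ge0}$ of roots with $\lim_{n\to\infty}d_{\mathrm{Ch}}(1_W,\alpha_n)=+\infty$ and every open neighbourhood $U$ of $1_H$ there is $N_U\in\mathbb N$ such that $U_{-\alpha_n}\subseteq U$ for all $n\ge N_U$. Contraction groups and nubs are taken in $H$. *)

(* Defs.v *)
From HB Require Import structures.
From mathcomp Require Import all_boot.
From mathcomp Require Import all_classical topology.

Set Implicit Arguments.
Unset Strict Implicit.
Unset Printing Implicit Defensive.

Local Open Scope classical_set_scope.
Local Open Scope group_scope.

(* [{set S}] denotes finite sets, delimited by %SET; all other sets are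
   classical. Subgroups and roots are classical sets. *)

(* 0 if A is empty *)
Definition min_nat (A : set nat) : nat :=
  xget 0%N [set n | A n /\ forall m, A m -> (n <= m)%N].

Definition largest {T : Type} (C : set (set T)) (P : set T) : Prop :=
  C P /\ forall Q, C Q -> Q `<=` P.

Section Groups.
Context {G : groupType}.
Implicit Types (A B P : set G) (g : G).

Definition subgroup A : Prop :=
  A 1 /\ forall x y, A x -> A y -> A (x * y^-1).

Definition gen_sub A : set G := smallest subgroup A.

Definition lcoset g A : set G := [set g * x | x in A].

Definition conj_set g A : set G := [set g * x * g^-1 | x in A].

Definition normalizer A : set G := [set g | conj_set g A = A].

Definition comm_sub A B : set G :=
  gen_sub [set c | exists x y, [/\ A x, B y & c = [~ x, y]]].

Definition abelian_sub A : Prop := forall x y, A x -> A y -> x * y = y * x.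

Definition virtually_abelian A : Prop :=
  exists B, [/\ subgroup B, B `<=` A, abelian_sub B &
    finite_set [set lcoset g B | g in A]].

End Groups.

Section Coxeter.
Context {S : finType} {W : groupType}.
Variable gen : S -> W.
Implicit Types (I J K : {set S}) (s : S) (v w : W) (a : set W) (P : set W).

(* The last field is the universal property of the presentation
   < S | (s t)^m(s,t) = 1 >, where m(s,t) is the order of s t; s = t and n = 1
   give the relations s^2 = 1. *)
Record coxeter_system : Prop := {
  cox_inj : injective gen;
  cox_neq1 : forall s, gen s <> 1;
  cox_sqr : forall s, gen s * gen s = 1;
  cox_gen : gen_sub (range gen) = [set: W];
  cox_presentation : forall (K : groupType) (f : S -> K),
    (forall s t n, (gen s * gen t) ^+ n = 1 -> (f s * f t) ^+ n = 1) ->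
    exists2 phi : W -> K, {morph phi : x y / x * y} & forall s, phi (gen s) = f s
}.

Definition std_sub J : set W := gen_sub [set gen s | s in [set` J]].

(* The notions below that take a first argument K are those of the Coxeter
   system (W_K, K); those of (W, S) are obtained for K = [set: S]. *)
Definition len K w : nat :=
  min_nat [set n | exists r : seq S,
    [/\ size r = n, {subset r <= K} & w = \prod_(s <- r) gen s]].

Definition length w : nat := len [set: S]%SET w.

(* (s t)^2 <> 1 means m(s,t) >= 3, and excludes s = t. *)
Definition diagram J : rel S :=
  [rel s t | [&& s \in J, t \in J & (gen s * gen t) ^+ 2 != 1]].

Definition components J : {set {set S}} :=
  [set [set t in J | connect (diagram J) s t] | s in J]%SET.

Definition irreducible J : Prop := J \in components J.

Definition spherical J : Prop := finite_set (std_sub J).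

Definition essential J : Prop :=
  J != finset.set0 /\ forall K, K \in components J -> ~ spherical K.

Definition affine J : Prop :=
  [/\ irreducible J, ~ spherical J & virtually_abelian (std_sub J)].

Definition indefinite J : Prop :=
  [/\ irreducible J, ~ spherical J & ~ affine J].

Definition aff_part J : {set S} :=
  (\bigcup_(K in components J | `[< affine K >]) K)%SET.

Definition perp J : {set S} :=
  [set s in ~: J | [forall j in J, gen s * gen j == gen j * gen s]]%SET.

Definition parabolic K P : Prop :=
  exists I v, [/\ I \subset K, std_sub K v & P = conj_set v (std_sub I)].

Definition Pc K w : set W := smallest (parabolic K) [set w].

Definition supp w : {set S} := (\bigcap_(J : {set S} | `[< std_sub J w >]) J)%SET.

Definition straight w : Prop :=
  w <> 1 /\ forall n, length (w ^+ n) = (n * length w)%N.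

Definition cyc_reduced K w : Prop :=
  forall v, std_sub K v -> (len K w <= len K (v * w * v^-1))%N.

Definition Pmax K w : set W :=
  xget set0 (largest
    [set P | [/\ parabolic K P, finite_set P & conj_set w P = P]]).

Definition standard_indefinite K w : Prop :=
  [/\ Pc K w = std_sub K, cyc_reduced K w &
    exists2 I : {set S}, I \subset K & Pmax K w = std_sub I].

Definition indef_components J : {set {set S}} :=
  [set K in components J | `[< indefinite K >]]%SET.

(* w = w_0 w_1 ... w_k, with v K = w_i for K = J_i; the factors commute. *)
Definition decomposition J w (w0 : W) (v : {set S} -> W) : Prop :=
  [/\ std_sub (aff_part J) w0,
      forall K, K \in indef_components J -> std_sub K (v K) &
      w = w0 * \prod_(K in indef_components J) v K].

Definition indef_factor J w : {set S} -> W :=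
  xget (fun=> 1) [set v | exists w0, decomposition J w w0 v].

Definition standard w : Prop :=
  exists J, [/\ Pc [set: S]%SET w = std_sub J, essential J &
    forall K, K \in indef_components J ->
      standard_indefinite K (indef_factor J w K)].

Definition sph_part J w : {set S} :=
  (\bigcup_(K in indef_components J)
     xget finset.set0 [set I : {set S} |
       I \subset K /\ Pmax K (indef_factor J w K) = std_sub I]%classic)%SET.

Definition simple_root s : set W :=
  [set w | (length w < length (gen s * w))%N].

Definition is_root a : Prop := exists v s, a = lcoset v (simple_root s).

Definition reflection a : W :=
  xget 1 [set r | exists v s,
    a = lcoset v (simple_root s) /\ r = v * gen s * v^-1].

Definition root_supp a : {set S} := supp (reflection a).

Definition dist1 a : nat := min_nat [set length (1^-1 * y) | y in a].

End Coxeter.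

Section RGD.
Context {S : finType} {W : groupType}.
Variable gen : S -> W.
Context {G : groupType}.
Variable U : set W -> set G.
Implicit Types (s : S) (w : W) (a b c : set W).

Notation is_root := (is_root gen).
Notation simple_root := (simple_root gen).

Definition torus : set G := \bigcap_(a in is_root) normalizer (U a).

Definition root_gen (A : set (set W)) : set G := gen_sub (\bigcup_(a in A) U a).

Definition Uplus : set G := root_gen [set a | is_root a /\ a 1].

Definition is_m s (u m : G) : Prop :=
  exists u' u'', [/\ U (~` simple_root s) u', U (~` simple_root s) u'',
    m = u' * u * u'' &
    forall b, is_root b -> conj_set m (U b) = U (lcoset (gen s) b)].

Record rgd_system : Prop := {
  rgd_sub : forall a, is_root a -> subgroup (U a);
  rgd_neq1 : forall a, is_root a -> U a <> [set 1];
  rgd_comm : forall a b, is_root a -> is_root b -> a <> b ->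
    a `&` b !=set0 -> ~` a `&` ~` b !=set0 ->
    comm_sub (U a) (U b) `<=`
      root_gen [set c | [/\ is_root c, c <> a, c <> b,
                            a `&` b `<=` c & ~` a `&` ~` b `<=` ~` c]];
  rgd_m : forall s u, U (simple_root s) u -> u <> 1 -> exists m, is_m s u m;
  rgd_neg : forall s, ~ (U (~` simple_root s) `<=` Uplus);
  rgd_gen : forall g, exists t x, [/\ torus t, root_gen is_root x & g = t * x]
}.

Definition borel : set G := [set g | exists t u, [/\ torus t, Uplus u & g = t * u]].

(* The graph of the canonical epimorphism N -> W with kernel T, which maps m(u)
   to s for u in U_(alpha_s); its first projection is N. *)
Definition weyl_graph : set (G * W) :=
  gen_sub ([set (t, 1) | t in torus] `|`
    [set p | exists s u, [/\ U (simple_root s) u, u <> 1,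
                             is_m s u p.1 & p.2 = gen s]]).

Definition bruhat_cell w : set G :=
  [set g | exists x n y, [/\ borel x, weyl_graph (n, w), borel y & g = x * n * y]].

Definition chamber : Type := {C : set G | exists g, C = lcoset g borel}.

Definition to_chamber (g : G) : chamber :=
  exist _ (lcoset g borel) (ex_intro _ g erefl).

(* weyl_dist x y w is the relation delta(x, y) = w *)
Definition weyl_dist (x y : chamber) w : Prop :=
  exists g h, [/\ x = to_chamber g, y = to_chamber h & bruhat_cell w (g^-1 * h)].

End RGD.

HB.structure Definition PreTopologicalGroup := {H of Topological H & Group H}.

HB.mixin Record PreTopologicalGroup_isTopologicalGroup H
    & PreTopologicalGroup H := {
  mulg_continuous : continuous (fun x : H * H => x.1 * x.2);
  invg_continuous : continuous (fun x : H => x^-1)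
}.

#[short(type="topologicalGroupType")]
HB.structure Definition TopologicalGroup :=
  {H of PreTopologicalGroup H & PreTopologicalGroup_isTopologicalGroup H}.

Definition first_countable (T : topologicalType) : Prop :=
  forall x : T, exists B : nat -> set T,
    (forall n, nbhs x (B n)) /\ forall A, nbhs x A -> exists n, B n `<=` A.

Section Contraction.
Context {H : topologicalGroupType}.

Definition con (g : H) : set H :=
  [set h | g ^+ n * h * g ^- n @[n --> \oo] --> (1 : H)].

Definition nub (g : H) : set H := closure (con g) `&` closure (con g^-1).

End Contraction.

Section Completion.
Context {S : finType} {W : groupType}.
Variable gen : S -> W.
Context {G : groupType}.
Variable U : set W -> set G.
Context {H : topologicalGroupType}.
Variables (iota : G -> H) (act : H -> chamber gen U -> chamber gen U).

(* compl_cont is continuity for the permutation topology on Aut_0: the sets of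
   f that agree with f0 on a finite set F form a neighbourhood basis at f0. *)
Record completion : Prop := {
  compl_first_countable : first_countable H;
  compl_totally_disconnected : totally_disconnected [set: H];
  compl_locally_compact : locally_compact [set: H];
  compl_act1 : forall x, act 1 x = x;
  compl_actM : forall g h x, act (g * h) x = act g (act h x);
  compl_type_preserving : forall h x y w,
    weyl_dist (act h x) (act h y) w <-> weyl_dist x y w;
  compl_cont : forall (h0 : H) (F : set (chamber gen U)), finite_set F ->
    \forall h \near h0, forall x, F x -> act h x = act h0 x;
  compl_inj : injective iota;
  compl_morph : {morph iota : x y / x * y};
  compl_compat : forall g x,
    act (iota g) (to_chamber gen U x) = to_chamber gen U (g * x)
}.

Definition FPRS : Prop :=
  forall a : nat -> set W, (forall n, is_root gen (a n)) ->
    dist1 gen (a n) @[n --> \oo] --> \oo ->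
    forall V : set H, open V -> V 1 ->
      exists N, forall n, (N <= n)%N -> iota @` U (~` a n) `<=` V.

End Completion.

(* Main.v *)
Require Import Defs.
From HB Require Import structures.
From mathcomp Require Import all_boot all_order all_algebra.
From mathcomp Require Import all_classical topology reals trigo.
From mathcomp Require Import ring lra.
From mathcomp Require Rstruct.

(** Conjugation by the n-th power of the lift of w maps U_alpha onto U_(w^n alpha),
    so by the (FPRS) property it suffices that the distance from 1 to the
    complement of w^n alpha tends to infinity as n tends to plus or minus
    infinity. All these roots contain 1 and only finitely many walls lie within
    a given distance of 1. Hence, if the distance does not diverge, then
    w^k alpha = alpha for some k > 0, and the reflection r of alpha commutes
    with w^k. The theorem thus follows from a statement about W alone
    (commuting_support): if r commutes with w^k, the support of r lies in one of
    the three excluded sets.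

    Everything about W is deduced from the geometric representation on the
    space V with basis the simple roots a_s. A root becomes a vector b = g a_s,
    all of whose coordinates have the same sign (pos_act), and the half-space
    attached to b is the set of the y such that y^-1 b is positive.

    First, every parabolic subgroup that contains w^k contains w
    (straight_parabolic), hence W_J. Applied to r W_J r, this shows that r
    normalises W_J, so that b lies in the span V_J of J or is orthogonal to it.
    In the second case a Perron-Frobenius argument (dominant_spherical) and the
    absence of spherical components of J show that the support of b is contained
    in the orthogonal of J (orthogonal_root_perp).

    If b lies in V_J, it lies in V_K for a component K of J. Suppose that K is
    indefinite, let x be the factor of w in W_K, and call a root of W_K periodic
    if a power of x fixes it. If two periodic roots were parallel, with product
    at most -1, their sum would be a nonzero vector fixed by some x^n, which W_K
    moves into the negative of the fundamental chamber, up to sign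
    (antidominant_sum). Its stabiliser is a parabolic subgroup containing x^n,
    hence it is W_K; the vector is then in the radical of the form and W_K
    would be virtually abelian (radical_virtually_abelian). So any two periodic
    roots that are neither equal nor opposite have product strictly between -1
    and 1 (fixed_roots_angle). Such products take finitely many values, because
    finite reflection groups lie in finite parabolic subgroups (finite_angles);
    therefore the periodic roots form a finite root system, normalised by x. Some
    finite parabolic subgroup that contains its reflections is normalised by x
    (periodic_parabolic), so it is contained in the largest such subgroup W_I,
    and the support of r is contained in I. *)

Set Implicit Arguments.
Unset Strict Implicit.
Unset Printing Implicit Defensive.
Import Order.TTheory GRing.Theory Num.Theory.
Local Open Scope classical_set_scope.
Local Open Scope ring_scope.

(** * Subgroups, words and length *)

Section GroupFacts.
Context {G : groupType}.
Implicit Types (A B : set G) (x y g : G).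

Lemma subgroup1 A : subgroup A -> A 1%g. Proof. by case. Qed.

Lemma subgroupV A x : subgroup A -> A x -> A x^-1%g.
Proof. by case=> A1 AF Ax; rewrite -[x^-1%g]mul1g; apply: AF. Qed.

Lemma subgroupM A x y : subgroup A -> A x -> A y -> A (x * y)%g.
Proof.
by move=> sA Ax Ay; rewrite -[y]invgK; apply: sA.2 => //; apply: subgroupV.
Qed.

Lemma subgroupX A x n : subgroup A -> A x -> A (x ^+ n)%g.
Proof.
move=> sA Ax; elim: n => [|n IH]; first exact: subgroup1.
by rewrite expgS; apply: subgroupM.
Qed.

Lemma gen_sub_subgroup A : subgroup (gen_sub A).
Proof.
split=> [B [[]] //|x y Ax Ay B [sB AB]].
by apply: sB.2; [apply: Ax|apply: Ay].
Qed.

Lemma gen_sub_incl A : A `<=` gen_sub A.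
Proof. by move=> x Ax B [_]; apply. Qed.

Lemma gen_sub_min A B : subgroup B -> A `<=` B -> gen_sub A `<=` B.
Proof. by move=> sB AB x; apply. Qed.

Lemma conj_setP g A x : conj_set g A x <-> A (g^-1 * x * g)%g.
Proof.
split=> [[y Ay <-]|Ax]; first by rewrite !mulgA mulVg mul1g mulgVK.
by exists (g^-1 * x * g)%g => //; rewrite !mulgA mulgV mul1g mulgK.
Qed.

Lemma conj_subgroup g A : subgroup A -> subgroup (conj_set g A).
Proof.
move=> sA; split=> [|x y /conj_setP Ax /conj_setP Ay]; apply/conj_setP.
  by rewrite mulg1 mulVg; apply: subgroup1.
have -> : (g^-1 * (x * y^-1) * g = (g^-1 * x * g) * (g^-1 * y * g)^-1)%g.
  by rewrite !invgM invgK !mulgA mulgK.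
exact: sA.2.
Qed.

Lemma lcosetP g A x : lcoset g A x <-> A (g^-1 * x)%g.
Proof.
split=> [[y Ay <-]|Ax]; first by rewrite mulKg.
by exists (g^-1 * x)%g => //; rewrite mulVKg.
Qed.

End GroupFacts.

Lemma conj_setM (G : groupType) (g h : G) (A : set G) :
  conj_set (g * h)%g A = conj_set g (conj_set h A).
Proof.
apply/seteqP; split=> x; rewrite !conj_setP invgM !mulgA //.
Qed.

Lemma conj_set1 (G : groupType) (A : set G) : conj_set 1%g A = A.
Proof. by apply/seteqP; split=> x; rewrite conj_setP invg1 mul1g mulg1. Qed.

Lemma min_natP (A : set nat) : (exists n, A n) ->
  A (min_nat A) /\ forall m, A m -> (min_nat A <= m)%N.
Proof.
move=> [n An]; rewrite /min_nat.
case: xgetP => [m -> //|].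
have ex : exists n, `[< A n >] by exists n; apply/asboolP.
case: (ex_minnP ex) => m /asboolP Am le_m /(_ m); case; split=> // k Ak.
by apply: le_m; apply/asboolP.
Qed.

(** The relations of the presentation have to be tested in some group; all those
    needed here are groups of bijections of a set, with composition. *)
Record selfbij (T : Type) := SelfBij {
  sbfun :> T -> T; sbinv : T -> T; sbK : cancel sbfun sbinv; sbVK : cancel sbinv sbfun }.

HB.instance Definition _ (T : Type) := gen_eqMixin (selfbij T).
HB.instance Definition _ (T : Type) := gen_choiceMixin (selfbij T).

Section SelfBij.
Context {T : Type}.
Implicit Types f g h : selfbij T.

Lemma selfbijP f g : (forall x, f x = g x) -> f = g.
Proof.
case: f g => [f f' fK fVK] [g g' gK gVK] /= efg.
have {}efg : f = g by apply: funext.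
subst g; have e' : f' = g' by apply: funext => x; rewrite -[x in LHS]gVK fK.
by subst g'; congr SelfBij; apply: Prop_irrelevance.
Qed.

Definition sb_one : selfbij T := @SelfBij T id id (frefl _) (frefl _).
Definition sb_inv f : selfbij T := SelfBij (@sbVK _ f) (@sbK _ f).
Definition sb_mul f g : selfbij T :=
  SelfBij (can_comp (@sbK _ f) (@sbK _ g)) (can_comp (@sbVK _ g) (@sbVK _ f)).

Lemma sb_mulA : associative sb_mul. Proof. by move=> f g h; apply: selfbijP. Qed.
Lemma sb_mul1 : left_id sb_one sb_mul. Proof. by move=> f; apply: selfbijP. Qed.
Lemma sb_mulr1 : right_id sb_one sb_mul. Proof. by move=> f; apply: selfbijP. Qed.
Lemma sb_mulV : left_inverse sb_one sb_inv sb_mul.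
Proof. by move=> f; apply: selfbijP => x /=; rewrite sbK. Qed.
Lemma sb_mulrV : right_inverse sb_one sb_inv sb_mul.
Proof. by move=> f; apply: selfbijP => x /=; rewrite sbVK. Qed.

HB.instance Definition _ :=
  isGroup.Build (selfbij T) sb_mulA sb_mul1 sb_mulr1 sb_mulV sb_mulrV.

Lemma sbXE f n x : (f ^+ n)%g x = iter n f x.
Proof. by elim: n => // n IH; rewrite expgS /= IH. Qed.

End SelfBij.

(** As a class, the hypothesis that (W, S) is a Coxeter system is passed
    implicitly to all lemmas about W. *)
Existing Class coxeter_system.

Section Words.
Context {S : finType} {W : groupType} {gen : S -> W}.
Context {coxW : coxeter_system gen}.
Implicit Types (s t : S) (w x y : W) (r : seq S) (I J K : {set S}).

Definition word r : W := (\prod_(s <- r) gen s)%g.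

Lemma word_nil : word [::] = 1%g. Proof. exact: big_nil. Qed.

Lemma word_cons s r : word (s :: r) = (gen s * word r)%g.
Proof. exact: big_cons. Qed.

Lemma word_cat r1 r2 : word (r1 ++ r2) = (word r1 * word r2)%g.
Proof. exact: big_cat. Qed.

Lemma word_rcons r s : word (rcons r s) = (word r * gen s)%g.
Proof. by rewrite -cats1 word_cat /word big_seq1. Qed.

Lemma genV s : (gen s)^-1%g = gen s.
Proof. by apply: mulg1_eq; apply: cox_sqr. Qed.

Lemma genK s w : (gen s * (gen s * w))%g = w.
Proof. by rewrite -{1}genV mulKg. Qed.

Lemma genKr s w : (w * gen s * gen s)%g = w.
Proof. by rewrite -{2}genV mulgK. Qed.

Lemma wordV r : (word r)^-1%g = word (rev r).
Proof.
elim: r => [|s r IH]; first by rewrite word_nil invg1.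
by rewrite word_cons invgM genV rev_cons word_rcons IH.
Qed.

Lemma std_subgroup J : subgroup (std_sub gen J).
Proof. exact: gen_sub_subgroup. Qed.

Lemma std_gen J s : s \in J -> std_sub gen J (gen s).
Proof. by move=> sJ; apply: gen_sub_incl; exists s. Qed.

Lemma std_word J r : {subset r <= J} -> std_sub gen J (word r).
Proof.
elim: r => [|s r IH] rJ; first by rewrite word_nil; apply: subgroup1 (std_subgroup _).
rewrite word_cons; apply: subgroupM (std_subgroup _) _ _.
  by apply: std_gen; apply: rJ; rewrite mem_head.
by apply: IH => t tr; apply: rJ; rewrite in_cons tr orbT.
Qed.

Lemma std_subP J w :
  std_sub gen J w -> exists r, {subset r <= J} /\ w = word r.
Proof.
move: w; apply: gen_sub_min.
  split=> [|x y [r1 [r1J ->]] [r2 [r2J ->]]]; first by exists [::]; rewrite word_nil.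
  exists (r1 ++ rev r2); rewrite word_cat wordV; split=> // s.
  by rewrite mem_cat mem_rev => /orP[/r1J|/r2J].
move=> _ [s /= sJ <-]; exists [:: s]; split; last by rewrite /word big_seq1.
by move=> t; rewrite inE => /eqP ->.
Qed.

Lemma std_setT w : std_sub gen [set: S]%SET w.
Proof.
have : [set: W] w by [].
rewrite -(cox_gen coxW); apply: gen_sub_min; first exact: std_subgroup.
by move=> _ [s _ <-]; apply: std_gen; rewrite inE.
Qed.

Lemma wordP w : exists r, w = word r.
Proof. by have [r [_ ->]] := std_subP (std_setT w); exists r. Qed.

Lemma std_mono I J : I \subset J -> std_sub gen I `<=` std_sub gen J.
Proof.
move=> /fintype.subsetP IJ w /std_subP [r [rI ->]].
by apply: std_word => s /rI /IJ.
Qed.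

Lemma std_ind J (P : W -> Prop) : P 1%g ->
  (forall s w, s \in J -> std_sub gen J w -> P w -> P (gen s * w)%g) ->
  forall w, std_sub gen J w -> P w.
Proof.
move=> P1 PS w /std_subP [r [rJ ->]]; elim: r rJ => [|s r IH] rJ.
  by rewrite word_nil.
have rJ' : {subset r <= J} by move=> t tr; apply: rJ; rewrite in_cons tr orbT.
rewrite word_cons; apply: PS; [by apply: rJ; rewrite mem_head|exact: std_word|].
exact: IH.
Qed.

Lemma cox_ind (P : W -> Prop) : P 1%g ->
  (forall s w, P w -> P (gen s * w)%g) -> forall w, P w.
Proof.
move=> P1 PS w; apply: (@std_ind [set: S]%SET) => //; last exact: std_setT.
by move=> s x _ _; apply: PS.
Qed.

Local Notation l := (length gen).

Lemma length_spec w :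
  (exists r, w = word r /\ size r = l w) /\
  (forall r, w = word r -> (l w <= size r)%N).
Proof.
have [|[r [rs _ wr]] min] := @min_natP [set n | exists r : seq S,
    [/\ size r = n, {subset r <= [set: S]%SET} & w = word r]].
  by have [r ->] := wordP w; exists (size r), r; split=> // s; rewrite inE.
split; first by exists r; split.
by move=> r' w'; apply: (min (size r')); exists r'; split=> // s; rewrite inE.
Qed.

Lemma reduced_word w : exists2 r, w = word r & size r = l w.
Proof. by have [[r [-> rs]] _] := length_spec w; exists r. Qed.

Lemma length_word r : (l (word r) <= size r)%N.
Proof. by have [_] := length_spec (word r); apply. Qed.

Lemma length1 : l 1%g = 0%N.
Proof. by apply/eqP; rewrite -leqn0 -word_nil; apply: (length_word [::]). Qed.

Lemma length_eq0 w : l w = 0%N -> w = 1%g.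
Proof. by have [r -> <-] := reduced_word w => /size0nil ->; rewrite word_nil. Qed.

Lemma lengthM x y : (l (x * y) <= l x + l y)%N.
Proof.
have [r1 -> <-] := reduced_word x; have [r2 -> <-] := reduced_word y.
by rewrite -word_cat -size_cat length_word.
Qed.

Lemma length_gen s : (l (gen s) <= 1)%N.
Proof. by have := length_word [:: s]; rewrite /word big_seq1. Qed.

Lemma lengthV w : l w^-1%g = l w.
Proof.
have le x : (l x^-1%g <= l x)%N.
  by have [r -> <-] := reduced_word x; rewrite wordV -size_rev length_word.
by apply/eqP; rewrite eqn_leq le /= -{1}[w]invgK le.
Qed.

Lemma lengthMgen_le w s : (l (w * gen s) <= (l w).+1)%N.
Proof. by rewrite -addn1 (leq_trans (lengthM _ _)) // leq_add2l length_gen. Qed.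

(** Sending every generator to the nontrivial element of a group of order two
    respects the relations, so the parity of the length is a homomorphism. *)
Lemma odd_length_gen w s : odd (l (w * gen s)) = ~~ odd (l w).
Proof.
pose neg : selfbij bool := SelfBij negbK negbK.
have neg2 : (neg * neg = 1)%g by apply: selfbijP; case.
have rel (a b : S) n : ((gen a * gen b) ^+ n = 1)%g -> ((neg * neg) ^+ n = 1)%g.
  by rewrite neg2 expg1n.
have [phi phiM phig] := @cox_presentation _ _ _ coxW _ (fun=> neg) rel.
have phi1 : phi 1%g = 1%g by apply: (mulgI (phi 1%g)); rewrite -phiM !mulg1.
have phiw r : phi (word r) true = ~~ odd (size r).
  elim: r => [|t r IH]; first by rewrite word_nil phi1.
  by rewrite word_cons phiM phig /= IH.
have [r wr rs] := reduced_word w.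
have [r' wr' rs'] := reduced_word (w * gen s)%g.
have : phi (word r') true = phi (word (rcons r s)) true.
  by rewrite word_rcons -wr -wr'.
by rewrite !phiw size_rcons rs rs' => /negb_inj.
Qed.

Lemma length_gen_neq w s : l (w * gen s)%g != l w.
Proof.
by apply/eqP => e; have := odd_length_gen w s; rewrite e; case: (odd _).
Qed.

Lemma length_gen_lt w s : (l w < l (w * gen s)%g)%N = ~~ (l (w * gen s)%g < l w)%N.
Proof. by rewrite -leqNgt ltn_neqAle eq_sym length_gen_neq. Qed.

Lemma length_gen_ltS w s :
  (l (w * gen s)%g < l w)%N -> l w = (l (w * gen s)%g).+1.
Proof.
move=> lt; apply/eqP; rewrite eqn_leq lt andbT.
by rewrite -{1}[w](genKr s) lengthMgen_le.
Qed.

Lemma length_last w : w <> 1%g -> exists s, (l (w * gen s)%g < l w)%N.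
Proof.
have [r -> <-] := reduced_word w; case/lastP: r => [|r s]; first by rewrite word_nil.
by exists s; rewrite word_rcons genKr size_rcons ltnS length_word.
Qed.

Lemma length_ind (P : W -> Prop) : P 1%g ->
  (forall w s, (l w < l (w * gen s)%g)%N -> P w -> P (w * gen s)%g) ->
  forall w, P w.
Proof.
move=> P1 PS w; have [n] := ubnP (l w); elim: n w => // n IH w; rewrite ltnS => ln.
have [->//|/eqP/length_last [s lt]] := eqVneq w 1%g.
rewrite -(genKr s w); apply: PS; first by rewrite genKr.
by apply: IH; apply: leq_trans ln.
Qed.

End Words.

Arguments word {S W} gen r.

(** * The geometric representation *)

Section Vectors.
Context {R : realType} {S : finType}.
Definition vec : Type := {ffun S -> R^o}.
HB.instance Definition _ := Vector.on vec.
Implicit Types (u v : vec) (s t : S) (a : R).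

Definition entry v s : R := v s.

Lemma vec_ext u v : (forall s, entry u s = entry v s) -> u = v.
Proof. by move=> e; apply/ffunP => s; apply: e. Qed.

Lemma entry0 s : entry 0 s = 0. Proof. by rewrite /entry ffunE. Qed.
Lemma entryD u v s : entry (u + v) s = entry u s + entry v s.
Proof. by rewrite /entry ffunE. Qed.
Lemma entryN u s : entry (- u) s = - entry u s. Proof. by rewrite /entry ffunE. Qed.
Lemma entryZ a u s : entry (a *: u) s = a * entry u s.
Proof. by rewrite /entry ffunE. Qed.
Lemma entry_sum (I : Type) (r : seq I) (P : pred I) (F : I -> vec) s :
  entry (\sum_(i <- r | P i) F i) s = \sum_(i <- r | P i) entry (F i) s.
Proof. by apply: (big_morph (fun v => entry v s)) => [u v|]; rewrite ?entryD ?entry0. Qed.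

Definition entryE := (entry0, entryD, entryN, entryZ).

Definition svec s : vec := [ffun t => (t == s)%:R].

Lemma entry_svec s t : entry (svec s) t =
  (t == s)%:R. Proof. by rewrite /entry ffunE. Qed.

Lemma vec_expansion v : v = \sum_s entry v s *: svec s.
Proof.
apply: vec_ext => t;
  rewrite entry_sum (bigD1 t) //= entryZ entry_svec eqxx mulr1 big1 ?addr0//.
by move=> s /negPf st; rewrite entryZ entry_svec eq_sym st mulr0.
Qed.

Definition height v : R := \sum_s entry v s.

Lemma heightD u v : height (u + v) = height u + height v.
Proof. by rewrite /height -big_split; apply: eq_bigr => s _; rewrite entryD. Qed.
Lemma heightZ a v : height (a *: v) = a * height v.
Proof. by rewrite /height mulr_sumr; apply: eq_bigr => s _; rewrite entryZ. Qed.
Lemma heightN v : height (- v) = - height v.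
Proof. by rewrite -scaleN1r heightZ mulN1r. Qed.

End Vectors.
Arguments vec R S : clear implicits.
Arguments svec {R S} s.

(** A recurrence solved by the sines: it computes the powers of the product of
    two reflections whose mirrors meet at the angle th. *)
Lemma sin_rec (R : realType) (th p q : R) (k : nat) : sin th != 0 ->
  let a k := (sin (k%:R * th) * p - sin (k%:R * th - th) * q) / sin th in
  a k.+2 = 2 * cos th * a k.+1 - a k.
Proof.
move=> th0 a; rewrite /a.
have e x : sin (x + th) = 2 * cos th * sin x - sin (x - th).
  by rewrite sinB sinD; ring.
have S j : j.+1%:R * th = j%:R * th + th by rewrite -addn1 natrD mulrDl mul1r.
rewrite (S k.+1) (S k) !addrK !e addrK.
by field.
Qed.

Section Form.
Context {R : realType} {S : finType} {W : groupType}.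
Context (gen : S -> W).
Local Notation V := (vec R S).
Implicit Types (u v b : V) (s t : S) (a : R).

(** The value is 0 if the product has infinite order, since [min_nat] of the
    empty set is 0. *)
Definition prod_order s t : nat :=
  min_nat [set n | (0 < n)%N /\ ((gen s * gen t) ^+ n = 1)%g].

(** The entries of the canonical form of Tits; the convention for an infinite
    order makes the two simple vectors span a degenerate plane. *)
Definition gram_mx s t : R :=
  if prod_order s t == 0%N then -1 else - cos (pi / (prod_order s t)%:R).

Local Notation gram := gram_mx.

Definition form u v : R := \sum_s \sum_t entry u s * entry v t * gram s t.

Local Notation dot := form.

Lemma dotDl u1 u2 v : dot (u1 + u2) v = dot u1 v + dot u2 v.
Proof.
rewrite /form -big_split; apply: eq_bigr => s _; rewrite -big_split.
by apply: eq_bigr => t _; rewrite entryD !mulrDl.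
Qed.

Lemma dotZl a u v : dot (a *: u) v = a * dot u v.
Proof.
rewrite /form mulr_sumr; apply: eq_bigr => s _; rewrite mulr_sumr.
by apply: eq_bigr => t _; rewrite entryZ !mulrA.
Qed.

Lemma prod_order_spec s t n : (0 < n)%N -> ((gen s * gen t) ^+ n = 1)%g ->
  [/\ (0 < prod_order s t)%N, ((gen s * gen t) ^+ prod_order s t = 1)%g &
    (prod_order s t %| n)%N].
Proof.
move=> n0 e.
have [|[m0 em] min] := @min_natP [set n | (0 < n)%N /\ ((gen s * gen t) ^+ n = 1)%g].
  by exists n.
rewrite -/(prod_order s t) in m0 em min *; split=> //.
rewrite /dvdn -leqn0 leqNgt; apply/negP => lt.
have : (prod_order s t <= n %% prod_order s t)%N.
  apply: min; split=> //.
  move: e; rewrite {1}(divn_eq n (prod_order s t)) expgnDr mulnC expgnA em expg1n.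
  by rewrite mul1g.
by rewrite leqNgt ltn_mod m0.
Qed.

Lemma prod_order_expg s t : ((gen s * gen t) ^+ prod_order s t = 1)%g.
Proof.
have [->//|m0] := eqVneq (prod_order s t) 0%N.
move: m0; rewrite /prod_order /min_nat.
by case: xgetP => [n -> [[]]|].
Qed.

Lemma dot_svecl s v : dot (svec s) v = \sum_t entry v t * gram s t.
Proof.
rewrite /form (bigD1 s) //= [X in _ + X]big1 ?addr0.
  by apply: eq_bigr => t _; rewrite entry_svec eqxx mul1r.
by move=> t /negPf ts; rewrite big1 // => u _; rewrite entry_svec ts !mul0r.
Qed.

Lemma dot_svec s t : dot (svec s) (svec t) = gram s t.
Proof.
rewrite dot_svecl (bigD1 t) //= big1 ?addr0; first by rewrite entry_svec eqxx mul1r.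
by move=> u /negPf ut; rewrite entry_svec ut mul0r.
Qed.

Definition reflect_along b v : V := v - (2 * dot v b) *: b.

Local Notation reflv := reflect_along.

Lemma reflvD b u v : reflv b (u + v) = reflv b u + reflv b v.
Proof. by rewrite /reflect_along dotDl mulrDr scalerDl; apply: vec_ext => s;
  rewrite !entryE; ring. Qed.

Lemma reflvZ b a v : reflv b (a *: v) = a *: reflv b v.
Proof. by rewrite /reflect_along dotZl; apply: vec_ext => s; rewrite !entryE; ring. Qed.

Lemma reflvN b v : reflv b (- v) = - reflv b v.
Proof. by rewrite -scaleN1r reflvZ scaleN1r. Qed.

End Form.

Section FormCox.
Context {R : realType} {S : finType} {W : groupType} {gen : S -> W}.
Context {coxW : coxeter_system gen}.
Local Notation V := (vec R S).
Local Notation gram := (@gram_mx R S W gen).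
Local Notation dot := (@form R S W gen).
Local Notation reflv := (@reflect_along R S W gen).
Local Notation prod_order := (prod_order gen).
Implicit Types (u v b : V) (s t : S) (a : R).

Lemma prod_orderC s t : prod_order s t = prod_order t s.
Proof.
congr min_nat; apply/seteqP; split=> n /= [n0 e]; split=> //; apply: invg_inj;
  by rewrite invg1 -expVgn invgM !genV.
Qed.

Lemma prod_order_ss s : prod_order s s = 1%N.
Proof.
have [] // := @prod_order_spec S W gen s s 1; first by rewrite expg1 cox_sqr.
by rewrite dvdn1 => _ _ /eqP.
Qed.

Lemma prod_order_gt1 s t : s != t -> prod_order s t != 0%N -> (1 < prod_order s t)%N.
Proof.
move=> st; case e: (prod_order s t) => [|[|m]] // _.
have := prod_order_expg gen s t; rewrite e expg1 => h.
case/eqP: st; apply: (cox_inj coxW).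
by rewrite -[gen t](genK s) h mulg1.
Qed.

Lemma gram_ss s : gram s s = 1.
Proof. by rewrite /gram_mx prod_order_ss /= divr1 cospi opprK. Qed.

Lemma gramC s t : gram s t = gram t s.
Proof. by rewrite /gram_mx prod_orderC. Qed.

Lemma angle_bounds n : (1 < n)%N -> 0 < pi / n%:R :> R /\ pi / n%:R <= pi / 2 :> R.
Proof.
move=> n1; have n0 : 0 < n%:R :> R by rewrite ltr0n (ltn_trans _ n1).
split; first by rewrite divr_gt0 // pi_gt0.
by rewrite ler_pM2l ?pi_gt0 // lef_pV2 ?posrE // ler_nat.
Qed.

Lemma gram_le0 s t : s != t -> gram s t <= 0.
Proof.
move=> st; rewrite /gram_mx; case: eqP => [_|/eqP m0]; first by rewrite oppr_le0.
rewrite oppr_le0; have [gt0 le] := angle_bounds (prod_order_gt1 st m0).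
apply: cos_ge0_pihalf; rewrite le andbT.
by apply: le_trans (ltW gt0); rewrite oppr_le0 divr_ge0 ?pi_ge0.
Qed.

Lemma gram_eq0 s t : s != t ->
  (gram s t == 0) = ((gen s * gen t) ^+ 2 == 1)%g.
Proof.
move=> st; apply/eqP/eqP => [|e2].
  rewrite /gram_mx; case: eqP => [_ /eqP|/eqP m0 /eqP];
    first by rewrite oppr_eq0 oner_eq0.
  rewrite oppr_eq0; have m1 := prod_order_gt1 st m0.
  have [<- _|m2] := eqVneq (prod_order s t) 2%N; first exact: prod_order_expg.
  have {}m2 : (2 < prod_order s t)%N by rewrite ltn_neqAle eq_sym m2.
  have [gt0 _] := angle_bounds m1.
  have mR : 0 < (prod_order s t)%:R :> R by rewrite ltr0n (ltn_trans _ m1).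
  suff /gt_eqF -> : 0 < cos (pi / (prod_order s t)%:R) :> R by [].
  apply: cos_gt0_pihalf; apply/andP; split.
    by apply: lt_trans gt0; rewrite oppr_lt0 divr_gt0 ?pi_gt0.
  by rewrite ltr_pM2l ?pi_gt0 // ltf_pV2 ?posrE // ltr_nat.
have [//|m0 em dv] := @prod_order_spec S W gen s t 2 _ e2.
have m1 := prod_order_gt1 st (lt0n_neq0 m0).
have -> : gram s t = - cos (pi / 2).
  rewrite /gram_mx (gtn_eqF m0).
  by have /eqP -> : prod_order s t == 2%N by rewrite eqn_leq m1 dvdn_leq.
by rewrite cos_pihalf oppr0.
Qed.

Lemma dotC u v : dot u v = dot v u.
Proof.
rewrite /form exchange_big; apply: eq_bigr => s _; apply: eq_bigr => t _.
by rewrite gramC (mulrC (entry u _)).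
Qed.

Lemma dotDr u v1 v2 : dot u (v1 + v2) = dot u v1 + dot u v2.
Proof. by rewrite dotC dotDl !(dotC u). Qed.
Lemma dotZr a u v : dot u (a *: v) = a * dot u v.
Proof. by rewrite dotC dotZl dotC. Qed.
Lemma dotNl u v : dot (- u) v = - dot u v.
Proof. by rewrite -scaleN1r dotZl mulN1r. Qed.
Lemma dotNr u v : dot u (- v) = - dot u v.
Proof. by rewrite dotC dotNl dotC. Qed.
Lemma dot0r u : dot u 0 = 0. Proof. by rewrite -(scale0r 0) dotZr mul0r. Qed.
Lemma dot0l u : dot 0 u = 0. Proof. by rewrite dotC dot0r. Qed.

Definition dotE := (@dotDl R S W gen, dotDr, dotNl, dotNr,
  @dotZl R S W gen, dotZr, dot0l, dot0r).

Lemma reflv_dot b u v : dot b b = 1 -> dot (reflv b u) (reflv b v) = dot u v.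
Proof. by move=> b1; rewrite /reflect_along !dotE b1 (dotC b v); ring. Qed.

Lemma reflvK b : dot b b = 1 -> involutive (reflv b).
Proof.
move=> b1 v; rewrite /reflect_along !dotE b1; apply: vec_ext => s; rewrite !entryE; ring.
Qed.

Lemma reflv_self b : dot b b = 1 -> reflv b b = - b.
Proof. by move=> b1; rewrite /reflect_along b1; apply: vec_ext => s; rewrite !entryE;
  ring. Qed.

End FormCox.

Section Relations.
Context {R : realType} {S : finType} {W : groupType} {gen : S -> W}.
Context {coxW : coxeter_system gen}.
Local Notation V := (vec R S).
Local Notation gram := (@gram_mx R S W gen).
Local Notation dot := (@form R S W gen).
Local Notation reflv := (@reflect_along R S W gen).
Local Notation dotE := (@dotE R S W gen coxW).
Local Notation prod_order := (prod_order gen).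
Implicit Types (u v b : V) (s t : S) (a p q : R).

Lemma dot_svec1 s : dot (svec s) (svec s) = 1.
Proof. by rewrite dot_svec gram_ss. Qed.

Definition refl s v : V := reflv (svec s) v.

Lemma reflK s : involutive (refl s).
Proof. exact: reflvK (dot_svec1 s). Qed.

Lemma reflD s u v : refl s (u + v) = refl s u + refl s v.
Proof. exact: reflvD. Qed.

Lemma refl_fix s v : dot v (svec s) = 0 -> refl s v = v.
Proof. by rewrite /refl /reflect_along => ->; rewrite mulr0 scale0r subr0. Qed.

Lemma plane_refl s t p q :
  refl s (p *: svec s + q *: svec t) = (- p - 2 * gram s t * q) *: svec s + q *: svec t.
Proof.
rewrite /refl /reflect_along !dotE !dot_svec gram_ss (gramC t s).
by apply: vec_ext => x; rewrite !entryE; ring.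
Qed.

Lemma sum_angle n : (0 < n)%N -> (2 * n)%:R * (pi / n%:R) = pi *+ 2 :> R.
Proof.
move=> n0; have nR : n%:R != 0 :> R by rewrite pnatr_eq0 -lt0n.
by rewrite natrM -[pi *+ 2]mulr_natl; field.
Qed.

(** On the span of two simple vectors the product of their reflections is the
    rotation by twice the angle pi / m, whose m-th power is trivial. *)
Lemma plane_rotation s t p q : s != t -> prod_order s t != 0%N ->
  iter (prod_order s t) (fun v => refl s (refl t v)) (p *: svec s + q *: svec t) =
  p *: svec s + q *: svec t.
Proof.
move=> st m0; have m1 : (1 < prod_order s t)%N by apply: prod_order_gt1.
set m := prod_order s t in m0 m1 *; pose th : R := pi / m%:R.
have [th0 thle] := angle_bounds (R := R) m1.
have sth : sin th != 0.
  apply: lt0r_neq0; apply: sin_gt0_pi; rewrite th0 /= (le_lt_trans thle) //.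
  by rewrite gtr_pMr ?pi_gt0 // invf_lt1 ?ltr1n // ltr0n.
have g : gram s t = - cos th by rewrite /gram_mx -/m (negPf m0).
pose a k : R := (sin (k%:R * th) * p - sin (k%:R * th - th) * q) / sin th.
have rec k : a k.+2 = 2 * cos th * a k.+1 - a k by apply: sin_rec.
have step k : iter k (fun v => refl s (refl t v)) (p *: svec s + q *: svec t) =
   a (2 * k).+1 *: svec s + a (2 * k)%N *: svec t.
  elim: k => [|k IH].
    rewrite muln0 /a mulr0n mulr1n mul0r mul1r sub0r sinN subrr sin0 /=.
    by congr (_ *: _ + _ *: _); field.
  rewrite iterS IH [X in refl t X]addrC plane_refl.
  rewrite [X in refl s X]addrC plane_refl.
  rewrite (gramC t s) g mulnS !addSn add0n !rec.
  by apply: vec_ext => x; rewrite !entryE; ring.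
have e : (2 * m).+1%:R * th = (2 * m)%:R * th + th.
  by rewrite -natr1 mulrDl mul1r.
rewrite step /a e addrK sum_angle ?lt0n //.
have cos2pi : cos (pi *+ 2) = 1 :> R by rewrite mulr2n cosDpi cospi opprK.
rewrite sinD sinB sin2pi cos2pi; congr (_ *: _ + _ *: _); by field.
Qed.

Lemma gram_lt1 s t : s != t -> prod_order s t != 0%N -> gram s t ^+ 2 != 1.
Proof.
move=> st m0; have m1 : (1 < prod_order s t)%N by apply: prod_order_gt1.
have [th0 thle] := angle_bounds (R := R) m1.
rewrite /gram_mx (negPf m0) sqrrN cos2sin2 -subr_eq0 addrC addKr oppr_eq0.
apply: expf_neq0; apply: lt0r_neq0; apply: sin_gt0_pi.
rewrite th0 /= (le_lt_trans thle) //.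
by rewrite gtr_pMr ?pi_gt0 // invf_lt1 ?ltr1n // ltr0n.
Qed.

(** Orthogonally to the plane of the two simple vectors both reflections are
    trivial, so the relation holds on the whole space. *)
Lemma refl_relation s t n v : ((gen s * gen t) ^+ n = 1)%g ->
  iter n (fun u => refl s (refl t u)) v = v.
Proof.
move=> e; have [->//|n0] := posnP n.
have [<-|st] := eqVneq s t.
  by elim: n {e n0} => //= n IH; rewrite reflK IH.
have [m0 _ /dvdnP[k ->]] := prod_order_spec n0 e.
suff rot : iter (prod_order s t) (fun u => refl s (refl t u)) v = v.
  by elim: k => // k IH; rewrite mulSn iterD IH.
have {}m0 : prod_order s t != 0%N by rewrite -lt0n.
have g1 : 1 - gram s t ^+ 2 != 0 by rewrite subr_eq0 eq_sym gram_lt1.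
pose p := (dot v (svec s) - gram s t * dot v (svec t)) / (1 - gram s t ^+ 2).
pose q := (dot v (svec t) - gram s t * dot v (svec s)) / (1 - gram s t ^+ 2).
pose u := v - (p *: svec s + q *: svec t).
have us : dot u (svec s) = 0.
  by rewrite /u !dotE !dot_svec gram_ss (gramC t s) /p /q; field.
have ut : dot u (svec t) = 0.
  by rewrite /u !dotE !dot_svec gram_ss /p /q; field.
have -> : v = (p *: svec s + q *: svec t) + u by rewrite /u addrC subrK.
have iterE j x : iter j (fun y => refl s (refl t y)) (x + u) =
                 iter j (fun y => refl s (refl t y)) x + u.
  by elim: j => //= j ->;
    rewrite [refl t (_ + u)]reflD (refl_fix ut) [refl s (_ + u)]reflD (refl_fix us).
by rewrite iterE plane_rotation.
Qed.

Definition affrefl s v : V := refl s v + svec s.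

Lemma refl_svec s : refl s (svec s) = - svec s.
Proof. by rewrite /refl reflv_self ?dot_svec1. Qed.

Lemma affreflK s : involutive (affrefl s).
Proof.
by move=> v; rewrite /affrefl [refl s (_ + svec s)]reflD refl_svec reflK subrK.
Qed.

(** The affine reflections s v + a_s satisfy the relations as well: in the plane
    of a finite dihedral group their mirrors meet in a point v0, and the
    translation by v0 makes them linear. *)
Lemma affrefl_relation s t n v : ((gen s * gen t) ^+ n = 1)%g ->
  iter n (fun u => affrefl s (affrefl t u)) v = v.
Proof.
move=> e; have [->//|n0] := posnP n.
have [<-|st] := eqVneq s t.
  by elim: n {e n0} => //= n IH; rewrite affreflK IH.
have [m0 _ _] := prod_order_spec n0 e.
have {}m0 : prod_order s t != 0%N by rewrite -lt0n.
have g1 : 1 + gram s t != 0.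
  apply: contra (gram_lt1 st m0); rewrite addrC addr_eq0 => /eqP ->.
  by rewrite sqrrN expr1n.
pose x : R := (2 * (1 + gram s t))^-1.
pose v0 := x *: svec s + x *: svec t.
have affE c y : dot c (svec y) = 2^-1 -> forall u, affrefl y u = c + refl y (u - c).
  move=> d u; rewrite /affrefl /refl /reflect_along !dotE d.
  by apply: vec_ext => z; rewrite !entryE; field.
have sE : forall u, affrefl s u = v0 + refl s (u - v0).
  by apply: affE; rewrite /v0 !dotE !dot_svec gram_ss (gramC t s) /x; field.
have tE : forall u, affrefl t u = v0 + refl t (u - v0).
  by apply: affE; rewrite /v0 !dotE !dot_svec gram_ss /x; field.
have K (c y : V) : c + y - c = y by rewrite addrC addKr.
have iterE k : iter k (fun u => affrefl s (affrefl t u)) v =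
    v0 + iter k (fun u => refl s (refl t u)) (v - v0).
  elim: k => [|k IH] /=; first by rewrite addrC subrK.
  by rewrite IH tE sE !K.
by rewrite iterE refl_relation // addrC subrK.
Qed.

End Relations.

(** * Action, roots and the sign of a root *)

Section Action.
Context {R : realType} {S : finType} {W : groupType} {gen : S -> W}.
Context {coxW : coxeter_system gen}.
Local Notation V := (vec R S).
Local Notation gram := (@gram_mx R S W gen).
Local Notation dot := (@form R S W gen).
Implicit Types (u v b : V) (s t : S) (a : R) (w x y : W).

Definition refl_bij s : selfbij V := SelfBij (@reflK R S W gen coxW s) (reflK s).
Definition affrefl_bij s : selfbij V :=
  SelfBij (@affreflK R S W gen coxW s) (affreflK s).

Lemma rep_exists : exists2 phi : W -> selfbij V,
  {morph phi : x y / (x * y)%g} & forall s, phi (gen s) = refl_bij s.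
Proof.
apply: (cox_presentation coxW) => s t n e; apply: selfbijP => v.
by rewrite sbXE /= -[RHS](refl_relation v e).
Qed.

Lemma affrep_exists : exists2 phi : W -> selfbij V,
  {morph phi : x y / (x * y)%g} & forall s, phi (gen s) = affrefl_bij s.
Proof.
apply: (cox_presentation coxW) => s t n e; apply: selfbijP => v.
by rewrite sbXE /= -[RHS](affrefl_relation v e).
Qed.

Definition actv w v : V := s2val (cid2 rep_exists) w v.
Definition affact w v : V := s2val (cid2 affrep_exists) w v.

Local Notation act := actv.
Local Notation refl := (@refl R S W gen).
Local Notation affrefl := (@affrefl R S W gen).

Lemma actM x y v : act (x * y)%g v = act x (act y v).
Proof. by rewrite /actv (s2valP (cid2 rep_exists)). Qed.

Lemma act_gen s v : act (gen s) v = refl s v.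
Proof. by rewrite /actv (s2valP' (cid2 rep_exists)). Qed.

Lemma act1 v : act 1%g v = v.
Proof.
apply: (can_inj (@sbK _ (s2val (cid2 rep_exists) 1%g))).
by rewrite -[LHS]/(act 1%g (act 1%g v)) -actM mulg1.
Qed.

Lemma actK w v : act w^-1%g (act w v) = v.
Proof. by rewrite -actM mulVg act1. Qed.
Lemma actVK w v : act w (act w^-1%g v) = v.
Proof. by rewrite -actM mulgV act1. Qed.
Lemma act_inj w : injective (act w).
Proof. exact: can_inj (actK w). Qed.

Lemma actD w u v : act w (u + v) = act w u + act w v.
Proof.
move: w; apply: cox_ind => [|s w IH]; first by rewrite !act1.
by rewrite !actM IH !act_gen [refl s (_ + _)]reflD.
Qed.

Lemma actZ w a v : act w (a *: v) = a *: act w v.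
Proof.
move: w; apply: cox_ind => [|s w IH]; first by rewrite !act1.
by rewrite !actM IH !act_gen /refl reflvZ.
Qed.

Lemma actN w v : act w (- v) = - act w v.
Proof. by rewrite -scaleN1r actZ scaleN1r. Qed.
Lemma actB w u v : act w (u - v) = act w u - act w v.
Proof. by rewrite actD actN. Qed.
Lemma act0 w : act w 0 = 0.
Proof. by rewrite -[X in act w X](subrr (0 : V)) actB subrr. Qed.
Lemma act_sum (I : Type) (r : seq I) (P : pred I) (F : I -> V) w :
  act w (\sum_(i <- r | P i) F i) = \sum_(i <- r | P i) act w (F i).
Proof. by apply: big_morph => [u v|]; rewrite ?actD ?act0. Qed.

Lemma dot_act w u v : dot (act w u) (act w v) = dot u v.
Proof.
move: w; apply: cox_ind => [|s w IH]; first by rewrite !act1.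
by rewrite !actM !act_gen reflv_dot ?IH // dot_svec1.
Qed.

(** The translation part of the affine action. On w it is the sum of the positive
    roots that w^-1 makes negative, so its height bounds the length of w. *)
Definition cocycle w : V := affact w 0.

Lemma affactE w v : affact w v = act w v + cocycle w.
Proof.
have M x y u : affact (x * y)%g u = affact x (affact y u).
  by rewrite /affact (s2valP (cid2 affrep_exists)).
have G s u : affact (gen s) u = affrefl s u.
  by rewrite /affact (s2valP' (cid2 affrep_exists)).
have E u : affact 1%g u = u.
  apply: (can_inj (@sbK _ (s2val (cid2 affrep_exists) 1%g))).
  by rewrite -[LHS]/(affact 1%g (affact 1%g u)) -M mulg1.
rewrite /cocycle; move: w v; apply: cox_ind => [|s w IH] v.
  by rewrite !E act1 addr0.
by rewrite !M (IH v) !G /affrefl actM act_gen addrA -reflD.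
Qed.

Lemma cocycleM x y : cocycle (x * y)%g = act x (cocycle y) + cocycle x.
Proof.
rewrite -affactE /cocycle /affact (s2valP (cid2 affrep_exists)) //.
Qed.

Lemma cocycle_gen s : cocycle (gen s) = svec s.
Proof.
rewrite /cocycle /affact (s2valP' (cid2 affrep_exists)) /= /affrefl.
by rewrite refl_fix ?add0r // dot0l.
Qed.

Lemma cocycle1 : cocycle 1%g = 0.
Proof.
have := cocycleM 1%g 1%g; rewrite mulg1 act1 => /eqP.
by rewrite -subr_eq subrr eq_sym => /eqP.
Qed.

Definition pos v := forall s, 0 <= entry v s.

Lemma posD u v : pos u -> pos v -> pos (u + v).
Proof. by move=> pu pv s; rewrite entryD addr_ge0. Qed.
Lemma posZ a v : 0 <= a -> pos v -> pos (a *: v).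
Proof. by move=> a0 pv s; rewrite entryZ mulr_ge0. Qed.
Lemma pos_svec s : pos (svec s).
Proof. by move=> t; rewrite entry_svec ler0n. Qed.
Lemma pos_anti v : pos v -> pos (- v) -> v = 0.
Proof.
move=> p n; apply: vec_ext => s; rewrite entry0; apply/le_anti; rewrite (p s).
by have := n s; rewrite entryN oppr_ge0 => ->.
Qed.

(** Built from right to left: the last letter is always t. *)
Fixpoint alternating s t k : seq S :=
  if k is k'.+1 then (if odd k' then s else t) :: alternating s t k' else [::].

Lemma size_alternating s t k : size (alternating s t k) = k.
Proof. by elim: k => //= k ->. Qed.

Lemma alternating_cat s t j k : exists2 r, size r = j & alternating s t (j + k) =
  r ++ alternating s t k.
Proof.
elim: j => [|j [r rs e]]; first by exists [::].
by exists ((if odd (j + k) then s else t) :: r); rewrite /= ?rs ?e.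
Qed.

Lemma word_alternating s t k : word gen (alternating s t k) =
  (if odd k then gen t * (gen s * gen t) ^+ k./2 else (gen s * gen t) ^+ k./2)%g.
Proof.
elim: k => [|k IH]; first by rewrite word_nil.
rewrite /= word_cons IH uphalf_half; case: (odd k) => //=.
by rewrite mulgA -expgS add1n.
Qed.

(** Up to inversion, the quotient of the two words is the m-th power of s t. *)
Lemma braid_relation s t : word gen (alternating s t (prod_order gen s t)) =
  word gen (alternating t s (prod_order gen s t)).
Proof.
have := prod_order_expg gen s t; set m := prod_order _ _ _ => e;
  rewrite !word_alternating.
have ts : (gen t * gen s = (gen s * gen t)^-1)%g by rewrite invgM !genV.
have E : m = (m./2 + (odd m + m./2))%N by rewrite addnCA addnn odd_double_half.
rewrite ts expVgn; move: e; rewrite {1}E expgnDr => /mulg1_eq ->.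
case: (odd m) => //; rewrite add1n expgS.
by rewrite !mulgA cox_sqr // mul1g.
Qed.

Lemma alternating_coef s t : s != t -> exists U : nat -> R,
  [/\ U 0%N = 0, U 1%N = 1,
      forall k, U k.+2 = - (2 * gram s t) * U k.+1 - U k &
      forall k, (prod_order gen s t = 0%N \/ (k <= prod_order gen s t)%N) -> 0 <= U k].
Proof.
move=> st; have [m0|m0] := eqVneq (prod_order gen s t) 0%N.
  exists (fun k => k%:R); split=> // k.
  by rewrite /gram_mx m0 eqxx -!natr1; ring.
have m1 : (1 < prod_order gen s t)%N by apply: prod_order_gt1.
have [th0 thle] := angle_bounds (R := R) m1.
set m := prod_order _ _ _ in m0 m1 th0 thle *; pose th : R := pi / m%:R.
have sth : 0 < sin th.
  apply: sin_gt0_pi; rewrite th0 /= (le_lt_trans thle) //.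
  by rewrite gtr_pMr ?pi_gt0 // invf_lt1 ?ltr1n // ltr0n.
exists (fun k => sin (k%:R * th) / sin th); split.
- by rewrite mul0r sin0 mul0r.
- by rewrite mul1r divff // gt_eqF.
- move=> k; have /= := @sin_rec R th 1 0 k (lt0r_neq0 sth).
  by rewrite !mulr0 !subr0 !mulr1 => ->; rewrite /gram_mx -/m (negPf m0) mulrN opprK.
- move=> k [/eqP|km]; first by rewrite (negPf m0).
  apply: divr_ge0 (ltW sth); apply: sin_ge0_pi.
  rewrite mulr_ge0 ?ler0n ?(ltW th0) //= /th mulrCA ger_pMr ?pi_gt0 //.
  by rewrite ler_pdivrMr ?mul1r ?ler_nat // ltr0n lt0n.
Qed.

Lemma act_alternating s t U : U 0%N = 0 -> U 1%N = 1 ->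
  (forall k, U k.+2 = - (2 * gram s t) * U k.+1 - U k) -> forall k,
  act (word gen (alternating s t k)) (svec s) =
  U k.+1 *: svec (if odd k then t else s) + U k *: svec (if odd k then s else t).
Proof.
move=> U0 U1 rec; elim=> [|k IH].
  by rewrite word_nil act1 U0 U1 scale1r scale0r addr0.
rewrite /= word_cons actM IH act_gen rec; case: (odd k) => /=; rewrite addrC.
  rewrite plane_refl.
  by congr (_ *: _ + _); ring.
rewrite plane_refl.
by rewrite (gramC t s); congr (_ *: _ + _); ring.
Qed.

Local Notation l := (length gen).

(** If l(w s) > l(w), split off from the right of w the longest possible
    alternating word in s and the last letter t of w. Induction applies to the
    remaining factor and both simple vectors, and the alternating word,
    being shorter than the order of s t, maps the simple vector of s to a
    nonnegative combination of these two. *)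
Lemma pos_act w s : (l w < l (w * gen s)%g)%N -> pos (act w (svec s)).
Proof.
have [n] := ubnP (l w); elim: n w s => // n IH w s; rewrite ltnS => lwn lws.
have [->|/eqP/length_last [t lwt]] := eqVneq w 1%g.
  by rewrite act1; apply: pos_svec.
have st : s != t by apply/eqP => st; move: lwt; rewrite -st ltnNge (ltnW lws).
pose Q k := `[< exists2 v, w = (v * word gen (alternating s t k))%g & l w =
  (l v + k)%N >].
have Q1 : exists k, Q k.
  exists 1%N; apply/asboolP; exists (w * gen t)%g.
    by rewrite /alternating /= /word big_seq1 genKr.
  by rewrite addn1 -length_gen_ltS.
have Qle k : Q k -> (k <= l w)%N by move=> /asboolP [v _ ->]; apply: leq_addl.
case: (ex_maxnP Q1 Qle) => k /asboolP [v wE lE] kmax.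
have k1 : (0 < k)%N.
  apply: kmax; apply/asboolP; exists (w * gen t)%g.
    by rewrite /alternating /= /word big_seq1 genKr.
  by rewrite addn1 -length_gen_ltS.
have lvy : (l v < l (v * gen (if odd k then s else t)))%N.
  rewrite length_gen_lt; apply/negP => lt.
  have : (k.+1 <= k)%N; last by rewrite ltnn.
  apply: kmax; apply/asboolP; exists (v * gen (if odd k then s else t))%g.
    by rewrite /= word_cons mulgA genKr.
  by rewrite lE addnS -addSn -length_gen_ltS.
have lvx : (l v < l (v * gen (if odd k then t else s)))%N.
  rewrite length_gen_lt; apply/negP => lt.
  have : (l w < l w)%N; last by rewrite ltnn.
  rewrite {1}wE lE; case: k k1 {lE wE kmax lvy} lt => // k _ lt.
  rewrite /= if_neg in lt; rewrite /= word_cons mulgA.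
  apply: leq_ltn_trans (lengthM (gen:=gen) _ _) _.
  have lek : (l (word gen (alternating s t k)) <= k)%N.
    by rewrite -[X in (_ <= X)%N](size_alternating s t k) length_word.
  apply: leq_ltn_trans (leq_add (leqnn _) lek) _.
  by rewrite (length_gen_ltS lt) addSn addnS ltnS leqnSn.
have lvw : (l v < l w)%N by rewrite lE -addn1 leq_add2l.
have km : prod_order gen s t = 0%N \/ (k < prod_order gen s t)%N.
  have [m0|m0] := eqVneq (prod_order gen s t) 0%N; [by left|right].
  rewrite ltnNge; apply/negP => mk.
  have [r1 sr1 e1] := alternating_cat s t (k - prod_order gen s t) (prod_order gen s t).
  have [r2 sr2 e2] := alternating_cat t s (prod_order gen s t).-1 1.
  rewrite subnK // in e1; rewrite addn1 prednK ?lt0n // in e2.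
  have : (l w < l w)%N; last by rewrite ltnn.
  apply: ltn_trans lws _.
  have -> : (w * gen s = v * word gen (r1 ++ r2))%g.
    rewrite wE e1 word_cat braid_relation e2 !word_cat /= /word big_seq1 !mulgA.
    by rewrite genKr.
  apply: leq_ltn_trans (lengthM (gen:=gen) _ _) _.
  apply: leq_ltn_trans (leq_add (leqnn _) (length_word (gen:=gen) _)) _.
  rewrite size_cat sr1 sr2 lE ltn_add2l -[X in (_ < X)%N](subnK mk) ltn_add2l.
  by rewrite prednK ?lt0n.
have [U [U0 U1 rec Upos]] := alternating_coef st.
rewrite wE actM (act_alternating U0 U1 rec) actD !actZ.
apply: posD; apply: posZ; try by apply: IH => //; apply: leq_trans lwn.
  by apply: Upos.
by apply: Upos; case: km; [left|right; apply: ltnW].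
Qed.

End Action.

Section Roots.
Context {R : realType} {S : finType} {W : groupType} {gen : S -> W}.
Context {coxW : coxeter_system gen}.
Local Notation V := (vec R S).
Local Notation dot := (@form R S W gen).
Local Notation reflv := (@reflect_along R S W gen).
Local Notation act := (@actv R S W gen coxW).
Local Notation cocycle := (@cocycle R S W gen coxW).
Local Notation refl := (@refl R S W gen).
Local Notation l := (length gen).
Implicit Types (u v b c : V) (s t : S) (w x y g : W) (I J K : {set S}).

Definition root_vector b := exists w s, b = act w (svec s).
Local Notation root := root_vector.

Lemma root_svec s : root (svec s).
Proof. by exists 1%g, s; rewrite act1. Qed.

Lemma root_act w b : root b -> root (act w b).
Proof. by move=> [x [s ->]]; exists (w * x)%g, s; rewrite actM. Qed.

Lemma rootN b : root b -> root (- b).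
Proof.
move=> [x [s ->]]; exists (x * gen s)%g, s.
by rewrite actM act_gen refl_svec actN.
Qed.

Lemma root_dot b : root b -> dot b b = 1.
Proof. by move=> [x [s ->]]; rewrite dot_act dot_svec1. Qed.

Lemma root_neq0 b : root b -> b != 0.
Proof. by move=> /root_dot b1; apply/eqP => b0; move: b1; rewrite b0 dot0l => /eqP;
  rewrite eq_sym oner_eq0. Qed.

Lemma neg_act w s : (l (w * gen s)%g < l w)%N -> pos (- act w (svec s)).
Proof.
move=> lt; rewrite -actN -refl_svec -act_gen -actM.
by apply: pos_act; rewrite genKr.
Qed.

Lemma root_sign b : root b -> pos b \/ pos (- b).
Proof.
move=> [w [s ->]]; case: (boolP (l w < l (w * gen s)%g)%N) => [/pos_act|]; first by left.
by rewrite length_gen_lt negbK => /neg_act; right.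
Qed.

Lemma root_asym b : root b -> pos b -> ~ pos (- b).
Proof. by move=> /root_neq0/eqP b0 p n; apply: b0; apply: pos_anti. Qed.

Lemma root_npos b : root b -> ~ pos b <-> pos (- b).
Proof.
move=> rb; split=> [np|n p]; last exact: root_asym n.
by case: (root_sign rb).
Qed.

Lemma pos_actE w s : pos (act w (svec s)) <-> (l w < l (w * gen s)%g)%N.
Proof.
split=> [p|]; last exact: pos_act.
rewrite length_gen_lt; apply/negP => /neg_act; apply: root_asym => //.
exact/root_act/root_svec.
Qed.

Lemma height_ge0 b : pos b -> 0 <= height b.
Proof. by move=> p; apply: sumr_ge0 => s _; apply: p. Qed.

(** The diagonal entries of the form are 1 and the others are nonpositive, so for
    nonnegative coordinates (b, b) is at most the square of the height. *)
Lemma height_ge1 b : root b -> pos b -> 1 <= height b.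
Proof.
move=> rb p; have h : dot b b <= height b * height b.
  rewrite /form {1}/height mulr_suml; apply: ler_sum => s _; rewrite mulr_sumr.
  apply: ler_sum => t _; have [<-|st] := eqVneq s t; first by rewrite gram_ss mulr1.
  apply: (@le_trans _ _ 0); last by rewrite mulr_ge0.
  by rewrite mulr_ge0_le0 ?mulr_ge0 ?gram_le0.
rewrite root_dot // in h; rewrite leNgt; apply/negP => lt.
have : height b * height b < 1 by rewrite mulr_ilt1 ?height_ge0.
by rewrite ltNge h.
Qed.

Lemma pos_single b s : root b -> pos b -> (forall t, t != s -> entry b t = 0) ->
  b = svec s.
Proof.
move=> rb p z; have E : b = entry b s *: svec s.
  apply: vec_ext => t; rewrite entryZ entry_svec; have [->|ts] := eqVneq t s.
    by rewrite mulr1.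
  by rewrite mulr0 z.
have := root_dot rb; rewrite E dotZl dotZr dot_svec1 mulr1 => /eqP.
rewrite -expr2 sqrf_eq1 => /orP[/eqP ->|/eqP e]; first by rewrite scale1r.
by have := p s; rewrite e oppr_ge0 ler10.
Qed.

Lemma entry_refl s v t : t != s -> entry (refl s v) t = entry v t.
Proof. by move=> /negPf ts;
  rewrite /refl /reflect_along !entryE entry_svec ts mulr0 oppr0 addr0. Qed.

Lemma refl_pos b s : root b -> pos b -> b <> svec s -> pos (refl s b).
Proof.
move=> rb p bs; have rs : root (refl s b) by rewrite -act_gen; apply: root_act.
case: (root_sign rs) => // n; case: bs; apply: pos_single => // t ts.
apply/le_anti; rewrite p andbT -(entry_refl b ts).
by have := n t; rewrite entryN oppr_ge0.
Qed.

(** Every letter of a word changes the sign of exactly one positive root. *)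
Lemma inversions_finite w : exists L : seq V,
  forall b, root b -> pos b -> pos (- act w^-1%g b) -> b \in L.
Proof.
move: w; apply: cox_ind => [|s w [L IH]].
  by exists [::] => b rb p; rewrite invg1 act1 => n; case: (root_asym rb p n).
exists (svec s :: map (refl s) L) => b rb p; rewrite invgM genV actM act_gen => n.
rewrite inE; case: eqP => //= bs; rewrite -(reflK s b); apply: map_f.
by apply: IH => //; [rewrite -act_gen; apply: root_act|apply: refl_pos].
Qed.

Lemma length_le_height w : (l w)%:R <= height (cocycle w).
Proof.
move: w; apply: length_ind => [|w s lt IH].
  by rewrite cocycle1 length1 /height big1 // => s _; rewrite entry0.
have -> : l (w * gen s)%g = (l w).+1 by rewrite (@length_gen_ltS _ _ _ _ _ s) genKr.
rewrite cocycleM heightD cocycle_gen -natr1 addrC lerD // height_ge1 //.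
  exact/root_act/root_svec.
exact: pos_act.
Qed.

Lemma act_faithful1 w : (forall s, pos (act w (svec s))) -> w = 1%g.
Proof.
move=> p; have [//|/eqP/length_last [s]] := eqVneq w 1%g.
by rewrite ltnNge => /negP; case; apply: ltnW; apply/pos_actE.
Qed.

Lemma act_faithful x y : (forall v, act x v = act y v) -> x = y.
Proof.
move=> e; apply: (mulgI y^-1%g); rewrite mulVg; apply: act_faithful1 => s.
by rewrite actM e actK; apply: pos_svec.
Qed.

Definition root_refl b : W := xget 1%g [set x | forall v, act x v = reflv b v].

Lemma reflv_act w b v : reflv (act w b) v = act w (reflv b (act w^-1%g v)).
Proof.
by rewrite {2}/reflect_along actB actZ actVK -(dot_act w _ b) actVK.
Qed.

Lemma act_root_refl b v : root b -> act (root_refl b) v = reflv b v.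
Proof.
move=> [w [s e]]; rewrite /root_refl; case: xgetP => [x _|]; first exact.
move=> /(_ (w * gen s * w^-1)%g); case=> u /=.
by rewrite e !actM act_gen reflv_act.
Qed.

Lemma root_refl_act w b : root b -> root_refl (act w b) = (w * root_refl b * w^-1)%g.
Proof.
move=> rb; apply: act_faithful => v; rewrite act_root_refl; last exact: root_act.
by rewrite !actM act_root_refl // reflv_act.
Qed.

Lemma root_refl_svec s : root_refl (svec s) = gen s.
Proof.
by apply: act_faithful => v; rewrite act_root_refl ?act_gen //; apply: root_svec.
Qed.

Definition supported J v := forall t, t \notin J -> entry v t = 0.

Lemma supportedD J u v : supported J u -> supported J v -> supported J (u + v).
Proof. by move=> hu hv t tJ; rewrite entryD hu ?hv ?addr0. Qed.
Lemma supportedZ J a v : supported J v -> supported J (a *: v).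
Proof. by move=> hv t tJ; rewrite entryZ hv ?mulr0. Qed.
Lemma supportedN J v : supported J v -> supported J (- v).
Proof. by move=> hv t tJ; rewrite entryN hv ?oppr0. Qed.
Lemma supported_svec J s : s \in J -> supported J (svec s).
Proof.
by move=> sJ t tJ; rewrite entry_svec; case: eqP => // ts; rewrite ts sJ in tJ.
Qed.

(** In this form it is evident that an intersection of standard subgroups is the
    standard subgroup of the intersection. *)
Lemma stdP J x : std_sub gen J x <-> forall v, supported J (act x v - v).
Proof.
split.
  move: x; apply: std_ind => [|s x sJ _ IH] v t tJ; first by rewrite act1 subrr entry0.
  have ts : t != s by apply: contra tJ => /eqP ->.
  rewrite actM act_gen entryD entryN entry_refl //.
  by have := IH v t tJ; rewrite entryD entryN.
have [n] := ubnP (l x); elim: n x => // n IH x; rewrite ltnS => lx h.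
have [->|x1] := eqVneq x 1%g; first exact: subgroup1 (std_subgroup _).
have [s ls] : exists s, (l (x^-1 * gen s)%g < l x^-1%g)%N.
  by apply: length_last => /(congr1 (fun z => z^-1)%g); rewrite invgK invg1; apply/eqP.
have sJ : s \in J.
  apply/negPn/negP => sJ; have ng := neg_act ls.
  have := h (act x^-1%g (svec s)) s sJ; rewrite actVK entryD entryN entry_svec eqxx.
  by move=> /eqP; rewrite subr_eq0 eq_sym => /eqP e; have := ng s;
    rewrite entryN e oppr_ge0 ler10.
rewrite -(genK (gen := gen) s x); apply: (subgroupM (std_subgroup _)) (std_gen sJ) _.
apply: IH.
  rewrite -lengthV invgM genV; apply: leq_trans lx.
  by rewrite -[X in (_ < X)%N]lengthV.
move=> v t tJ; have ts : t != s by apply: contra tJ => /eqP ->.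
rewrite actM act_gen entryD entryN entry_refl //.
by have := h v t tJ; rewrite entryD entryN.
Qed.

Lemma std_entry J x v t : std_sub gen J x -> t \notin J -> entry (act x v) t = entry v t.
Proof.
by move=> /stdP h tJ; rewrite -[act x v](subrK v) entryD h // add0r.
Qed.

Lemma root_refl_std J b : root b -> std_sub gen J (root_refl b) <-> supported J b.
Proof.
move=> rb; split=> [/stdP h t tJ|h].
  have := h b t tJ; rewrite act_root_refl // reflv_self ?root_dot // entryD !entryN.
  by move=> /eqP; rewrite -opprD oppr_eq0 -mulr2n mulrn_eq0 => /eqP.
apply/stdP => v t tJ; rewrite act_root_refl // /reflect_along !entryE (h t tJ); ring.
Qed.

Lemma std_act J x v : std_sub gen J x -> supported J v -> supported J (act x v).
Proof.
move=> /stdP h hv; rewrite -[act x v](subrK v); apply: supportedD => //.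
Qed.

Lemma std_genE J s : std_sub gen J (gen s) -> s \in J.
Proof.
rewrite -root_refl_svec => /(root_refl_std _ (root_svec s)) h; apply/negPn/negP => /h.
by rewrite entry_svec eqxx => /eqP; rewrite oner_eq0.
Qed.

End Roots.

(** * Finite parabolic subgroups as stabilisers of functionals *)

Lemma finite_by_code (T : choiceType) (F : finType) (A : set T) (code : T -> F -> Prop) :
  (forall y, A y -> exists c, code y c) ->
  (forall y z c, A y -> A z -> code y c -> code z c -> y = z) -> finite_set A.
Proof.
move=> ex inj; have [[y0 _]|nA] := pselect (exists y, A y); last first.
  have -> : A = set0 by apply/seteqP; split=> // y Ay; case: nA; exists y.
  exact: finite_set0.
pose dec c := xget y0 [set y | A y /\ code y c].
apply: (@sub_finite_set _ _ (dec @` [set: F])); last exact/finite_image/finite_finset.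
move=> y Ay; have [c yc] := ex _ Ay; exists c => //; rewrite /dec.
case: xgetP => [z -> [Az zc]|/(_ y)]; first exact: inj zc yc.
by case.
Qed.

Lemma finite_setE (T : choiceType) (A : set T) :
  finite_set A <-> exists s : seq T, forall x, A x -> x \in s.
Proof.
split=> [/finite_seqP [s ->]|[s As]]; first by exists s.
by apply: (@sub_finite_set _ _ [set` s]) => [x /As|]; last exact: finite_seq.
Qed.

Section Tits.
Context {R : realType} {S : finType} {W : groupType} {gen : S -> W}.
Context {coxW : coxeter_system gen}.
Local Notation V := (vec R S).
Local Notation dot := (@form R S W gen).
Local Notation act := (@actv R S W gen coxW).
Local Notation refl := (@refl R S W gen).
Local Notation l := (length gen).
Implicit Types (u v b c : V) (s t : S) (w x y g : W) (I J K : {set S}).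
Local Notation root := (@root_vector R S W gen coxW).
Local Notation root_refl := (@root_refl R S W gen coxW).
Implicit Types (f : V -> R).

Definition linear_form f :=
  (forall u v, f (u + v) = f u + f v) /\ (forall a v, f (a *: v) = a * f v).

Lemma linear_formN f v : linear_form f -> f (- v) = - f v.
Proof. by move=> [_ fZ]; rewrite -scaleN1r fZ mulN1r. Qed.

Lemma linear_form_act f g : linear_form f -> linear_form (fun v => f (act g v)).
Proof. by move=> [fD fZ]; split=> *; rewrite ?actD ?actZ ?fD ?fZ. Qed.

Lemma linear_form_sum f v : linear_form f -> f v = \sum_s entry v s * f (svec s).
Proof.
move=> [fD fZ]; rewrite {1}(vec_expansion v) (big_morph f fD (id1 := 0)).
  by apply: eq_bigr => s _; rewrite fZ.
by rewrite -(scale0r 0) fZ mul0r.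
Qed.

Lemma linear_form_ge0 K f v : linear_form f -> (forall s, s \in K -> 0 <= f (svec s)) ->
  supported K v -> pos v -> 0 <= f v.
Proof.
move=> lf fK vK p; rewrite linear_form_sum //; apply: sumr_ge0 => s _.
case: (boolP (s \in K)) => sK; first by rewrite mulr_ge0 ?fK.
by rewrite vK // mul0r.
Qed.

Lemma linear_form_refl f s v : linear_form f ->
  f (refl s v) = f v - 2 * dot v (svec s) * f (svec s).
Proof. by move=> lf; rewrite /refl /reflect_along lf.1 linear_formN // lf.2. Qed.

Lemma linear_form_root_refl f b v : linear_form f -> root b -> f b = 0 ->
  f (act (root_refl b) v) = f v.
Proof.
move=> lf rb fb;
  rewrite act_root_refl // /reflect_along lf.1 linear_formN // lf.2 fb mulr0.
by rewrite oppr0 addr0.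
Qed.

(** The roots of a parabolic subsystem are the roots in the span of its simple
    roots: after moving by an element of minimal length in a coset of W_K, such
    a root is a nonnegative combination of vectors that a single element maps to
    positive roots, while it is itself mapped to a simple one. *)
Lemma root_conj_simple K b : root b -> supported K b ->
  exists g s, [/\ std_sub gen K g, s \in K & b = act g (svec s)].
Proof.
move=> [z [t ->]] zK.
have [g gK gmin] : exists2 g, std_sub gen K g &
    forall h, std_sub gen K h -> (l (g * z)%g <= l (h * z)%g)%N.
  pose Q n := `[< exists2 g, std_sub gen K g & l (g * z)%g = n >].
  have Q1 : exists n, Q n.
    by exists (l z); apply/asboolP; exists 1%g; rewrite ?mul1g //;
      apply: subgroup1 (std_subgroup _).
  case: (ex_minnP Q1) => n /asboolP [g gK gn] nmin; exists g => // h hK.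
  by rewrite gn; apply: nmin; apply/asboolP; exists h.
set y := (g * z)%g in gmin.
have ypos s : s \in K -> pos (act y^-1%g (svec s)).
  move=> sK; apply: pos_act; rewrite length_gen_lt -leqNgt.
  rewrite lengthV -[X in (_ <= X)%N]lengthV invgM invgK genV /y mulgA.
  by apply: gmin; apply: (subgroupM (std_subgroup _)) (std_gen sK) gK.
have ry : root (act y (svec t)) by apply/root_act/root_svec.
have yK : supported K (act y (svec t)) by rewrite actM; apply: std_act.
have yE : svec t = \sum_s entry (act y (svec t)) s *: act y^-1%g (svec s).
  rewrite -{1}(actK y (svec t)) {1}(vec_expansion (act y (svec t))) act_sum.
  by apply: eq_bigr => s _; rewrite actZ.
have zE : act z (svec t) = act g^-1%g (act y (svec t)) by rewrite actM actK.
have gVK : std_sub gen K g^-1%g by apply: (subgroupV (std_subgroup _)).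
case: (root_sign ry) => [p|n]; last first.
  have : pos (- (svec t : V)).
    rewrite yE -sumrN => u; rewrite entry_sum; apply: sumr_ge0 => s _.
    case: (boolP (s \in K)) => sK; last by rewrite yK // scale0r oppr0 entry0.
    by rewrite -scaleNr entryZ mulr_ge0 ?ypos //; have := n s; rewrite entryN.
  by move=> /(root_asym (root_svec t) (@pos_svec _ _ t)).
have [s s0] : exists s, entry (act y (svec t)) s != 0.
  apply: contrapT => /forallNP h; have /eqP := root_neq0 ry; apply.
  by apply: vec_ext => s; rewrite entry0; apply/eqP/negPn/negP => /h.
have sK : s \in K by apply/negPn/negP => /yK e; rewrite e eqxx in s0.
have rs : root (act y^-1%g (svec s)) by apply/root_act/root_svec.
have e : act y^-1%g (svec s) = svec t.
  apply: pos_single => // [|u ut]; first exact: ypos.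
  have h : \sum_s entry (act y (svec t)) s * entry (act y^-1%g (svec s)) u = 0.
    transitivity (entry (svec t : V) u); last by rewrite entry_svec (negPf ut).
    by rewrite [in RHS]yE entry_sum; apply: eq_bigr => i _; rewrite entryZ.
  have /eqP := h; rewrite psumr_eq0 => [/allP/(_ s (mem_index_enum s))|i _].
    by rewrite mulf_eq0 (negPf s0) => /eqP.
  case: (boolP (i \in K)) => iK; last by rewrite yK // mul0r.
  by rewrite mulr_ge0 // ypos.
by exists g^-1%g, s; split=> //; rewrite zE -{1}e actVK.
Qed.

(** If y fixes f and y a_s is negative, then f (a_s) = f (y a_s) is both
    nonnegative and nonpositive: the last letter of y fixes f as well. *)
Lemma stab_dominant K f y : linear_form f -> (forall s, s \in K -> 0 <= f (svec s)) ->
  std_sub gen K y -> (forall v, f (act y v) = f v) ->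
  std_sub gen [set s in K | f (svec s) == 0]%SET y.
Proof.
move=> lf fK; have [n] := ubnP (l y); elim: n y => // n IH y; rewrite ltnS => ly yK fy.
have [->|/eqP/length_last [s ls]] := eqVneq y 1%g;
  first exact: subgroup1 (std_subgroup _).
have ng : pos (- act y (svec s)) := neg_act ls.
have sK : s \in K.
  apply/negPn/negP => sK; have := ng s.
  by rewrite entryN (std_entry _ yK sK) entry_svec eqxx oppr_ge0 ler10.
have fs : f (svec s) = 0.
  apply/le_anti; rewrite fK // andbT -fy -oppr_ge0 -linear_formN //.
  by apply: (linear_form_ge0 (K := K)) => //; apply/supportedN/std_act => //;
    apply: supported_svec.
rewrite -(genKr (gen := gen) s y); apply: (subgroupM (std_subgroup _)); last first.
  by apply: std_gen; rewrite inE sK fs eqxx.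
apply: IH; first exact: leq_trans ly.
  by apply: (subgroupM (std_subgroup _)) yK (std_gen sK).
by move=> v; rewrite actM fy act_gen linear_form_refl // fs mulr0 subr0.
Qed.

(** The reflection in a simple root of negative value removes this root from the
    finite set of positive roots of negative value and permutes the others. *)
Lemma make_dominant K f (L : seq V) : linear_form f ->
  (forall b, root b -> pos b -> supported K b -> f b < 0 -> b \in L) ->
  exists2 g, std_sub gen K g & forall s, s \in K -> 0 <= f (act g (svec s)).
Proof.
have [n] := ubnP (size L); elim: n f L => // n IH f L; rewrite ltnS => sL lf fL.
have [h|] := pselect (forall s, s \in K -> 0 <= f (svec s)).
  by exists 1%g; [apply: subgroup1 (std_subgroup _)|move=> s /h; rewrite act1].
move=> /existsNP [s /not_implyP [sK /negP]]; rewrite -ltNge => fs.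
have sLs : svec s \in L.
  by apply: fL => //; [apply: root_svec|apply: pos_svec|apply: supported_svec].
have [|||g gK gf] := IH (fun v => f (act (gen s) v))
    (map (refl s) [seq b <- L | b != svec s]).
- rewrite size_map size_filter; apply: leq_trans sL.
  rewrite ltn_neqAle count_size andbT -all_count; apply/negP => /allP/(_ _ sLs) /=.
  by rewrite eqxx.
- exact: linear_form_act.
- move=> b rb p bK; rewrite act_gen => fb; rewrite -(reflK s b); apply: map_f.
  have bs : b <> svec s.
    by move=> e; move: fb; rewrite e refl_svec linear_formN // oppr_lt0 ltNge (ltW fs).
  rewrite mem_filter /=; apply/andP; split.
    apply/eqP => e; have : refl s (refl s b) = b by apply: reflK.
    rewrite e refl_svec => e'.
    by apply: (root_asym rb p); rewrite -e' opprK; apply: pos_svec.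
  apply: fL => //; [by rewrite -act_gen; apply: root_act|exact: refl_pos|].
  by rewrite -act_gen; apply: std_act => //; apply: std_gen.
exists (gen s * g)%g; first by apply: (subgroupM (std_subgroup _)) (std_gen sK) gK.
by move=> t tK; rewrite actM; apply: gf.
Qed.

Lemma std_faithful I y z : std_sub gen I y -> std_sub gen I z ->
  (forall s, s \in I -> act y (svec s) = act z (svec s)) -> y = z.
Proof.
move=> yI zI e; apply: (mulgI z^-1%g); rewrite mulVg.
have xI : std_sub gen I (z^-1 * y)%g.
  by apply: (subgroupM (std_subgroup _)) _ yI; apply: (subgroupV (std_subgroup _)).
apply: (act_faithful1 (R := R)) => s.
case: (boolP (s \in I)) => sI; first by rewrite actM e // actK; apply: pos_svec.
have rx : root (act (z^-1 * y)%g (svec s)) by apply/root_act/root_svec.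
case: (root_sign rx) => // /(_ s).
by rewrite entryN (std_entry _ xI sI) entry_svec eqxx oppr_ge0 ler10.
Qed.

Lemma finite_std I : (exists L : seq V, forall b, root b -> supported I b -> b \in L) ->
  finite_set (std_sub gen I).
Proof.
move=> [L IL]; pose code (y : W) (c : {ffun S -> 'I_(size L).+1}) :=
  forall s, s \in I -> act y (svec s) = nth 0 L (c s).
refine (@finite_by_code W _ (std_sub gen I) code _ _); rewrite /code.
  move=> y yI; exists [ffun s => inord (index (act y (svec s)) L)] => s sI.
  have sL : act y (svec s) \in L.
    apply: IL; first exact/root_act/root_svec.
    by apply: std_act => //; apply: supported_svec.
  by rewrite ffunE inordK ?nth_index // ltnS index_size.
move=> y z c yI zI cy cz; apply: std_faithful yI zI _ => s sI.
by rewrite cy // cz.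
Qed.

Lemma finite_std_roots I : finite_set (std_sub gen I) ->
  exists L : seq V, forall b, root b -> supported I b -> b \in L.
Proof.
move=> /finite_setE [E IE]; exists [seq act g (svec s) | g <- E, s <- enum S].
move=> b rb /(root_conj_simple rb) [g [s [gI sI ->]]].
by apply: allpairs_f; rewrite ?IE // mem_enum.
Qed.

(** Functionals in the interior of the dual of the cone: only finitely many
    positive roots of W_K are not positive on them. *)
Definition dual_interior K f := linear_form f /\ exists L : seq V,
  forall b, root b -> pos b -> supported K b -> f b <= 0 -> b \in L.

Lemma zero_conj_inv f g I y v : linear_form f -> (forall s, s \in I ->
  f (act g (svec s)) = 0) ->
  conj_set g (std_sub gen I) y -> f (act y v) = f v.
Proof.
move=> lf fI; have lfg := linear_form_act g lf; rewrite conj_setP.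
set x := (_ * g)%g => xI.
have : forall x, std_sub gen I x -> forall u, f (act g (act x u)) = f (act g u).
  apply: std_ind => [u|s x' sI _ IH u]; first by rewrite act1.
  by rewrite actM act_gen (linear_form_refl _ _ lfg) fI // mulr0 subr0.
move=> /(_ x xI (act g^-1%g v)); rewrite actVK => <-.
by rewrite -!actM /x !mulgA mulgV mul1g mulgK.
Qed.

(** Once f is dominant, its stabiliser is the standard subgroup of the simple
    roots on which it vanishes, and it vanishes on finitely many roots. *)
Lemma dual_interior_stab K f : dual_interior K f -> exists g I,
  [/\ std_sub gen K g, I \subset K, finite_set (std_sub gen I),
    forall s, s \in I -> f (act g (svec s)) = 0 &
    forall y, std_sub gen K y ->
      (forall v, f (act y v) = f v) <-> conj_set g (std_sub gen I) y].
Proof.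
move=> [lf [L fL]]; have [|g gK gf] := @make_dominant K f L lf.
  by move=> b rb p bK fb; apply: fL => //; apply: ltW.
pose I := [set s in K | f (act g (svec s)) == 0]%SET.
have IK : I \subset K by apply/fintype.subsetP => s; rewrite inE => /andP[].
have fI s : s \in I -> f (act g (svec s)) = 0 by rewrite inE => /andP[_ /eqP].
have lfg := linear_form_act g lf.
exists g, I; split=> //.
  apply: finite_std; pose M := L ++ map -%R L.
  exists (map (act g^-1%g) M) => b rb bI.
  have fb : f (act g b) = 0.
    rewrite (linear_form_sum b lfg) big1 // => s _; case: (boolP (s \in I)) => sI.
      by rewrite fI // mulr0.
    by rewrite bI // mul0r.
  have bK : supported K (act g b).
    by apply: std_act => // t tK; apply: bI; apply: contra tK => /(fintype.subsetP IK).
  rewrite -(actK g b); apply: map_f; rewrite mem_cat.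
  have rg : root (act g b) by apply: root_act.
  case: (root_sign rg) => p; first by rewrite fL // fb.
  rewrite -[act g b]opprK map_f ?orbT // fL //; first exact: rootN.
    exact: supportedN.
  by rewrite linear_formN // fb oppr0.
move=> y yK; split=> [fy|yI v]; last exact: zero_conj_inv lf fI yI.
apply/conj_setP; apply: (@stab_dominant K (fun v => f (act g v))) => //.
  have sK : subgroup (std_sub gen K) by apply: std_subgroup.
  exact: (subgroupM sK (subgroupM sK (subgroupV sK gK) yK) gK).
by move=> v; rewrite -actM !mulgA mulgV mul1g !actM fy.
Qed.

End Tits.

(** * Angles between roots, and roots of bounded height *)

Section Angles.
Context {R : realType} {S : finType} {W : groupType} {gen : S -> W}.
Context {coxW : coxeter_system gen}.
Local Notation V := (vec R S).
Local Notation dot := (@form R S W gen).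
Local Notation reflv := (@reflect_along R S W gen).
Local Notation dotE := (@dotE R S W gen coxW).
Local Notation act := (@actv R S W gen coxW).
Local Notation cocycle := (@cocycle R S W gen coxW).
Local Notation refl := (@refl R S W gen).
Local Notation l := (length gen).
Implicit Types (u v b c : V) (s t : S) (w x y g : W) (I J K : {set S}).
Local Notation root := (@root_vector R S W gen coxW).
Local Notation root_refl := (@root_refl R S W gen coxW).

Lemma finite_ball n : finite_set [set w | (l w <= n)%N].
Proof.
pose code (w : W) (r : n.-bseq S) := w = word gen r.
refine (@finite_by_code W _ _ code _ _); rewrite /code /=.
  move=> w; have [r -> <-] := reduced_word (gen := gen) w => rn.
  by exists (Bseq rn).
by move=> y z r _ _ -> ->.
Qed.

Lemma nat_upper_bound (x : R) : exists n, x <= n%:R.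
Proof.
by exists (Num.Def.truncn x).+1; apply/ltW/truncnS_gt.
Qed.

Lemma cocycleV w : cocycle w^-1%g = - act w^-1%g (cocycle w).
Proof.
by apply/eqP; rewrite -addr_eq0 addrC -cocycleM mulVg cocycle1.
Qed.

Lemma cocycle_root_refl b : root b -> exists a : R, cocycle (root_refl b) = a *: b.
Proof.
move=> [w [s ->]]; rewrite root_refl_act ?root_refl_svec; last exact: root_svec.
rewrite !cocycleM cocycleV cocycle_gen actN -actM.
have -> : act (w * gen s * w^-1)%g (cocycle w) = reflv (act w (svec s)) (cocycle w).
  by rewrite !actM act_gen reflv_act.
exists (1 + 2 * dot (cocycle w) (act w (svec s))).
by rewrite /reflect_along; apply: vec_ext => t; rewrite !entryE; ring.
Qed.

(** If |(b, c)| < 1, the group generated by the two reflections is finite: it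
    acts on the plane of b and c, which is Euclidean, by isometries fixing the
    point u0 where the two affine mirrors meet. So the cocycle is bounded on
    it, and with it the length. *)
Lemma dihedral_finite b c : root b -> root c -> `|dot b c| < 1 ->
  exists D : set W, [/\ subgroup D, finite_set D, D (root_refl b) & D (root_refl c)].
Proof.
move=> rb rc; set k := dot b c => k1.
have k2 : 0 < 1 - k ^+ 2.
  by rewrite subr_gt0 -real_normK ?num_real // expr_lt1.
have k20 : 1 - k ^+ 2 != 0 by rewrite gt_eqF.
have [p pE] := cocycle_root_refl rb; have [q qE] := cocycle_root_refl rc.
have db := root_dot rb; have dc := root_dot rc.
have kC : dot c b = k by rewrite dotC.
pose x0 : R := (p - k * q) / (2 * (1 - k ^+ 2)).
pose y0 : R := (q - k * p) / (2 * (1 - k ^+ 2)).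
have [u0 u0E] : exists u, u = x0 *: b + y0 *: c by exists (x0 *: b + y0 *: c).
have ub : 2 * dot u0 b = p by rewrite u0E !dotE db kC /x0 /y0; field.
have uc : 2 * dot u0 c = q by rewrite u0E !dotE dc -/k /x0 /y0; field.
pose D : set W := [set g | (forall v, exists x y : R, act g v - v = x *: b + y *: c)
                          /\ cocycle g = u0 - act g u0].
have Db : D (root_refl b).
  split=> [v|].
    exists (- (2 * dot v b)), 0; rewrite act_root_refl // /reflect_along.
    by apply: vec_ext => t; rewrite !entryE; ring.
  by rewrite pE act_root_refl // /reflect_along ub; apply: vec_ext => t;
    rewrite !entryE; ring.
have Dc : D (root_refl c).
  split=> [v|].
    exists 0, (- (2 * dot v c)); rewrite act_root_refl // /reflect_along.
    by apply: vec_ext => t; rewrite !entryE; ring.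
  by rewrite qE act_root_refl // /reflect_along uc; apply: vec_ext => t;
    rewrite !entryE; ring.
have sD : subgroup D.
  split=> [|x y [xv xc] [yv yc]].
    split=> [v|]; last by rewrite act1 cocycle1 subrr.
    by exists 0, 0; rewrite act1 !scale0r subrr addr0.
  split=> [v|].
    have [x1 [x2 e1]] := xv (act y^-1%g v); have [y1 [y2 e2]] := yv (act y^-1%g v).
    exists (x1 - y1), (x2 - y2); rewrite actVK in e2.
    have -> : act (x * y^-1)%g v - v = (act x (act y^-1%g v) - act y^-1%g v)
        - (v - act y^-1%g v) by rewrite actM opprB addrA subrK.
    by rewrite e1 e2; apply: vec_ext => t; rewrite !entryE; ring.
  rewrite cocycleM cocycleV xc yc actB actK actN actB -actM.
  by apply: vec_ext => t; rewrite !entryE; ring.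
exists D; split=> //.
pose Q : R := dot u0 u0 / (1 - k ^+ 2) + 1.
have [N NE] := nat_upper_bound (height u0 + Q * (`|height b| + `|height c|)).
apply: sub_finite_set (finite_ball N) => g [gv gc] /=.
have [x1 [x2 e]] := gv u0.
pose x := x1 + x0; pose y := x2 + y0.
have gE : act g u0 = x *: b + y *: c.
  rewrite -[act g u0](subrK u0) e {1}u0E /x /y.
  by apply: vec_ext => t; rewrite !entryE; ring.
have norm : x ^+ 2 + 2 * x * y * k + y ^+ 2 = dot u0 u0.
  by rewrite -(dot_act g) gE !dotE db dc kC -/k; ring.
have bound z : (1 - k ^+ 2) * z ^+ 2 <= dot u0 u0 -> `|z| <= Q.
  rewrite mulrC -ler_pdivlMr // => h; have /le_trans -> // : `|z| <= z ^+ 2 + 1.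
    rewrite -(real_normK (num_real z)).
    have : 0 <= (`|z| - 1) ^+ 2 + `|z| by rewrite addr_ge0 ?sqr_ge0.
    have -> : (`|z| - 1) ^+ 2 + `|z| = `|z| ^+ 2 + 1 - `|z| by ring.
    by rewrite subr_ge0.
  by rewrite lerD2r.
have xQ : `|x| <= Q.
  by apply: bound; rewrite -norm -subr_ge0; have := sqr_ge0 (y + k * x); lra.
have yQ : `|y| <= Q.
  by apply: bound; rewrite -norm -subr_ge0; have := sqr_ge0 (x + k * y); lra.
rewrite -(ler_nat R); apply: le_trans NE; apply: le_trans (length_le_height g) _.
rewrite gc heightD heightN lerD2l gE heightD !heightZ mulrDr opprD lerD //.
  by apply: le_trans (ler_norm _) _; rewrite normrN normrM ler_wpM2r.
by apply: le_trans (ler_norm _) _; rewrite normrN normrM ler_wpM2r.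
Qed.

Lemma linear_form_height : linear_form (@height R S).
Proof. by split=> *; rewrite ?heightD ?heightZ. Qed.

(** The height is positive on all positive roots, and each of its finitely many
    translates is so up to finitely many exceptions: their sum is invariant and
    lies in the interior. *)
Lemma finite_group_dual_interior K (D : set W) : subgroup D -> finite_set D ->
  exists f, dual_interior K f /\ forall y, D y -> forall v, f (act y v) = f v.
Proof.
move=> sD /finite_seqP [E0 E0D]; pose E := undup E0.
have DE g : D g <-> g \in E by rewrite mem_undup E0D.
pose f v := \sum_(g <- E) height (act g v).
pose Li g := xget [::] [set L : seq V |
  forall b, root b -> pos b -> pos (- act g b) -> b \in L].
have LiP g b : root b -> pos b -> pos (- act g b) -> b \in Li g.
  rewrite /Li; case: xgetP => [L _|]; first exact.
  by have [L] := @inversions_finite R S W gen coxW g^-1%g; rewrite invgK => h /(_ L).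
exists f; split; [split|].
- split=> [u v|a v]; rewrite /f.
    by rewrite -big_split; apply: eq_bigr => g _; rewrite actD heightD.
  by rewrite mulr_sumr; apply: eq_bigr => g _; rewrite actZ heightZ.
- exists (flatten [seq Li g | g <- E]) => b rb p _ fb.
  have [[g gE ng]|h] := pselect (exists2 g, g \in E & pos (- act g b)).
    by apply/flatten_mapP; exists g => //; apply: LiP.
  have h1 g : g \in E -> 1 <= height (act g b).
    move=> gE; have rg : root (act g b) by apply: root_act.
    by case: (root_sign rg) => [/(height_ge1 rg)//|n]; case: h; exists g.
  suff : 0 < f b by rewrite ltNge fb.
  have E1 : 1%g \in E by apply/DE; case: sD.
  rewrite /f (big_rem _ E1) /= ltr_pwDl //; first exact: lt_le_trans ltr01 (h1 _ E1).
  by rewrite big_seq sumr_ge0 // => g /mem_rem/h1; apply: le_trans ler01.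
- move=> y Dy v; rewrite /f.
  have -> : \sum_(g <- E) height (act g (act y v)) = \sum_(g <- map (fun g =>
    g * y)%g E) height (act g v).
    by rewrite big_map; apply: eq_bigr => g _; rewrite actM.
  apply: perm_big; apply: uniq_perm.
  - by rewrite map_inj_uniq ?undup_uniq //; apply: mulIg.
  - exact: undup_uniq.
  move=> g; apply/mapP/idP => [[h /DE Dh ->]|/DE Dg]; first by apply/DE;
    apply: (subgroupM sD).
  by exists (g * y^-1)%g; rewrite ?mulgVK //; apply/DE/sD.2.
Qed.

(** A finite reflection group lies in a finite parabolic subgroup, and there are
    finitely many of these up to conjugacy; so two roots form only finitely many
    angles. *)
Lemma finite_angles : exists F : seq R,
  forall b c, root b -> root c -> `|dot b c| < 1 -> dot b c \in F.
Proof.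
pose LI I := xget [::] [set L : seq V | forall b, root b -> supported I b -> b \in L].
exists (flatten [seq [seq dot b c | b <- LI J, c <- LI J] | J <- enum {: {set S}}]).
move=> b c rb rc k1; have [D [sD fD Db Dc]] := dihedral_finite rb rc k1.
have [f [fi fD']] := @finite_group_dual_interior [set: S]%SET D sD fD.
have [g [I [gK _ WI _ st]]] := dual_interior_stab fi.
have LIP c' : root c' -> supported I c' -> c' \in LI I.
  rewrite /LI; case: xgetP => [L _|]; first exact.
  by have [L h] := @finite_std_roots R S W gen coxW I WI => /(_ L).
have inI c' : root c' -> D (root_refl c') -> act g^-1%g c' \in LI I.
  move=> rc' Dc'; apply: LIP; first exact: root_act.
  apply/root_refl_std; first exact: root_act.
  rewrite root_refl_act // invgK; apply/conj_setP/st; first exact: std_setT.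
  exact: fD'.
apply/flatten_mapP; exists I; first by rewrite mem_enum.
by rewrite -(dot_act g^-1%g); apply: allpairs_f; apply: inI.
Qed.

Lemma seq_gap (F : seq R) : exists2 e : R, 0 < e <= 1 & forall x : R, x \in F ->
  0 < x -> e <= x.
Proof.
elim: F => [|y F [e /andP[e0 e1] eF]]; first by exists 1; rewrite ?ltr01 ?lexx.
have [y0|y0] := ltP 0 y; last first.
  exists e; rewrite ?e0 // => x; rewrite inE => /orP[/eqP ->|]; last exact: eF.
  by rewrite ltNge y0.
exists (Num.min e y); first by rewrite lt_min e0 y0 ge_min e1.
by move=> x; rewrite inE ge_min => /orP[/eqP ->|/eF h /h ->] //; rewrite lexx orbT.
Qed.

(** A simple reflection that lowers the height of a root lowers it by at least
    a fixed amount. *)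
Lemma dot_gap : exists2 e : R, 0 < e &
  forall b s, root b -> 0 < dot b (svec s) -> e <= dot b (svec s).
Proof.
have [F FP] := finite_angles; have [e /andP[e0 e1] eF] := seq_gap F.
exists e => // b s rb d0; have [d1|d1] := ltP (dot b (svec s)) 1.
  by apply: eF => //; apply: FP => //; [apply: root_svec|rewrite gtr0_norm].
exact: le_trans d1.
Qed.

Lemma dot_sum b v : dot b v = \sum_s entry b s * dot (svec s) v.
Proof.
rewrite {1}(vec_expansion b) (big_morph (fun u => dot u v) (fun u1 u2 =>
  dotDl _ u1 u2 v) (dot0l v)).
by apply: eq_bigr => s _; rewrite dotZl.
Qed.

Lemma root_descent K b : root b -> pos b -> supported K b ->
  exists s, [/\ s \in K, 0 < entry b s & 0 < dot b (svec s)].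
Proof.
move=> rb p bK; have := root_dot rb; rewrite dot_sum => e.
apply: contrapT => /forallNP h; have : \sum_s entry b s * dot (svec s) b <= 0.
  apply: sumr_le0 => s _; have [sK|/bK ->] := boolP (s \in K); last by rewrite mul0r.
  rewrite leNgt; apply/negP => lt; apply: (h s).
  have c0 : 0 < entry b s.
    by rewrite lt_neqAle p andbT eq_sym; apply: contraTneq lt => ->; rewrite mul0r ltxx.
  by split=> //; rewrite dotC -(pmulr_rgt0 _ c0).
by rewrite e ler10.
Qed.

Lemma height_svec s : height (svec s : V) = 1.
Proof.
by rewrite /height (bigD1 s) //= big1 ?entry_svec ?eqxx ?addr0 // => t /negPf ts;
  rewrite entry_svec ts.
Qed.

Lemma height_refl s v : height (refl s v) = height v - 2 * dot v (svec s).
Proof. by rewrite (linear_form_refl _ _ linear_form_height) height_svec mulr1. Qed.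

(** A positive root that is not simple has a positive image of smaller height
    under some simple reflection, and dot_gap bounds the number of such steps. *)
Lemma finite_height (M : R) : exists L : seq V,
  forall b, root b -> pos b -> height b <= M -> b \in L.
Proof.
have [e e0 eP] := dot_gap.
suff h n : exists L : seq V, forall b, root b -> pos b ->
  height b <= n%:R * (2 * e) -> b \in L.
  have [n nE] := nat_upper_bound (M / (2 * e)); have [L LP] := h n; exists L => b rb p bM.
  by apply: LP => //; apply: le_trans bM _; rewrite -ler_pdivrMr // mulr_gt0.
elim: n => [|n [L LP]].
  exists [::] => b rb p; rewrite mul0r => h; have := height_ge1 rb p.
  by rewrite leNgt (le_lt_trans h).
exists (map svec (enum S) ++ [seq refl s b | s <- enum S, b <- L]) => b rb p bn.
have bT : supported [set: S]%SET b by move=> t; rewrite inE.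
have [s [_ _ d0]] := root_descent rb p bT.
rewrite mem_cat; have [->|/eqP bs] := eqVneq b (svec s).
  by rewrite map_f ?mem_enum.
apply/orP; right; rewrite -(reflK s b).
apply: (allpairs_f (fun s b => refl s b)); first by rewrite mem_enum.
apply: LP; [by rewrite -act_gen; apply: root_act|exact: refl_pos|].
by rewrite height_refl; have := eP b s rb d0; move: bn; rewrite -natr1 mulrDl mul1r; lra.
Qed.

End Angles.

(** * Components of the diagram and nonnegative vectors *)

Section Components.
Context {R : realType} {S : finType} {W : groupType} {gen : S -> W}.
Context {coxW : coxeter_system gen}.
Local Notation V := (vec R S).
Local Notation gram := (@gram_mx R S W gen).
Local Notation dot := (@form R S W gen).
Implicit Types (u v b c : V) (s t : S) (w x y g : W) (I J K : {set S}).
Local Notation root := (@root_vector R S W gen coxW).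

Lemma gram_diagram J s t : s \in J -> t \in J -> s != t -> gram s t != 0 ->
  diagram gen J s t.
Proof. by move=> sJ tJ st; rewrite gram_eq0 // => h; rewrite /diagram /= sJ tJ. Qed.

Lemma diagram_gram J s t : diagram gen J s t -> s != t /\ gram s t != 0.
Proof.
move=> /and3P[_ _ h]; have st : s != t.
  by apply: contra h => /eqP <-; rewrite cox_sqr expg1n.
by rewrite st gram_eq0.
Qed.

Lemma diagram_sym J : symmetric (diagram gen J).
Proof.
move=> s t; rewrite /diagram /= andbCA; congr [&& _, _ & ~~ _].
by rewrite -[in RHS]eqg_inv invg1 -expVgn invgM !genV.
Qed.

Lemma comp_sub J K : K \in components gen J -> K \subset J.
Proof.
by move=> /imsetP [s sJ ->]; apply/fintype.subsetP => t; rewrite inE => /andP[].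
Qed.

Lemma comp_neq0 J K : K \in components gen J -> exists s, s \in K.
Proof. by move=> /imsetP [s sJ ->]; exists s; rewrite inE sJ connect0. Qed.

Lemma comp_edge J K s t : K \in components gen J -> s \in K -> t \in J ->
  s != t -> gram s t != 0 -> t \in K.
Proof.
move=> /imsetP [s0 s0J ->]; rewrite !inE => /andP[sJ s0s] tJ st g.
by rewrite tJ /=; apply: connect_trans s0s (connect1 _); apply: gram_diagram.
Qed.

Lemma comp_ind J K (X : S -> Prop) : K \in components gen J ->
  (exists2 s, s \in K & X s) ->
  (forall s t, s \in K -> t \in K -> s != t -> gram s t != 0 -> X s -> X t) ->
  forall s, s \in K -> X s.
Proof.
move=> KJ [s sK Xs] step t tK.
have : connect (diagram gen J) s t.
  case/imsetP: (KJ) sK tK => s0 s0J ->; rewrite !inE => /andP[_ h] /andP[_].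
  by apply: connect_trans; rewrite (sym_connect_sym (diagram_sym J)).
move=> /connectP [p pp ->]; elim: p s sK Xs pp {t tK} => //= y p IH s sK Xs /andP[e].
have yJ : y \in J by case/and3P: e.
have [sy g] := diagram_gram e.
have yK := comp_edge KJ sK yJ sy g.
by apply: IH => //; apply: step Xs.
Qed.

Lemma comp_orth J K s t : K \in components gen J -> s \in K -> t \in J ->
  t \notin K -> gram s t = 0.
Proof.
move=> KJ sK tJ tK; apply/eqP; have st : s != t by apply: contraNneq tK => <-.
by apply: contraNT tK => g; apply: (comp_edge KJ sK tJ st g).
Qed.

Lemma comp_cover J s : s \in J -> exists2 K, K \in components gen J & s \in K.
Proof.
move=> sJ; exists [set t in J | connect (diagram gen J) s t]%SET.
  by apply/imsetP; exists s.
by rewrite inE sJ connect0.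
Qed.

Lemma comp_eq J K L s : K \in components gen J -> L \in components gen J ->
  s \in K -> s \in L -> K = L.
Proof.
move=> KJ LJ sK sL; apply/setP => t; apply/idP/idP.
  move: t; apply: (comp_ind KJ); first by exists s.
  move=> t u tK uK tu g tL; apply: (comp_edge LJ tL _ tu g).
  exact: (fintype.subsetP (comp_sub KJ)).
move: t; apply: (comp_ind LJ); first by exists s.
move=> t u tK uK tu g tL; apply: (comp_edge KJ tL _ tu g).
exact: (fintype.subsetP (comp_sub LJ)).
Qed.

Lemma comp_irreducible J K : K \in components gen J -> K \in components gen K.
Proof.
move=> KJ; have [s sK] := comp_neq0 KJ; apply/imsetP; exists s => //.
apply/setP => t; rewrite inE; apply/idP/andP => [tK|[] //]; split=> //.
move: t tK; apply: (comp_ind KJ); first by exists s; rewrite ?connect0.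
move=> t u tK uK tu g; move/connect_trans; apply; apply: connect1.
exact: gram_diagram.
Qed.

(** Write z_s z_t = (z_s^2 + z_t^2 - (z_s - z_t)^2) / 2 and use that the form is
    symmetric. *)
Lemma form_identity d v (z : S -> R) : (forall s, entry v s = entry d s * z s) ->
  dot v v = \sum_s dot d (svec s) * (entry d s * z s ^+ 2)
    + \sum_s \sum_t 2^-1 * (- gram s t * (entry d s * entry d t * (z s - z t) ^+ 2)).
Proof.
move=> vE.
have sw : \sum_s \sum_t gram s t * entry d s * entry d t * z s ^+ 2 =
          \sum_s \sum_t gram s t * entry d s * entry d t * z t ^+ 2.
  rewrite exchange_big; apply: eq_bigr => s _; apply: eq_bigr => t _.
  by rewrite gramC; ring.
have e1 : \sum_s dot d (svec s) * (entry d s * z s ^+ 2) =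
    2^-1 * (\sum_s \sum_t gram s t * entry d s * entry d t * z s ^+ 2) +
    2^-1 * (\sum_s \sum_t gram s t * entry d s * entry d t * z t ^+ 2).
  rewrite -sw -mulrDl -[2^-1 + _]/(2^-1 + 2^-1 : R).
  have -> : 2^-1 + 2^-1 = 1 :> R by field.
  rewrite mul1r; apply: eq_bigr => s _; rewrite dotC dot_svecl mulr_suml.
  by apply: eq_bigr => t _; ring.
rewrite e1 !mulr_sumr -!big_split; apply: eq_bigr => s _ /=.
rewrite !mulr_sumr -!big_split; apply: eq_bigr => t _ /=.
by rewrite !vE; field.
Qed.

Section Positive.
Context {J K : {set S}}.
Context (KJ : K \in components gen J).

(** At a zero coordinate of d all contributions of the other coordinates to the
    product with the simple root are nonpositive; if the product is nonnegative
    they vanish, so the neighbouring coordinates of d are zero too. *)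
Lemma pos_full_support d : supported K d -> pos d -> d <> 0 ->
  (forall s, s \in K -> entry d s = 0 -> 0 <= dot d (svec s)) ->
  forall s, s \in K -> 0 < entry d s.
Proof.
move=> dK p d0 dd s sK; rewrite lt_neqAle p andbT eq_sym; apply/eqP => ds.
apply: d0; apply: vec_ext => t; rewrite entry0.
case: (boolP (t \in K)) => [|/dK //]; move: t.
apply: (comp_ind KJ); first by exists s.
move=> t u tK uK tu g dt; have := dd t tK dt.
rewrite dotC dot_svecl => h.
have n i : entry d i * gram t i <= 0.
  have [<-|ti] := eqVneq t i; first by rewrite dt mul0r.
  by rewrite mulr_ge0_le0 ?gram_le0.
have : \sum_i (- (entry d i * gram t i)) == 0.
  by apply/eqP/le_anti; rewrite sumrN oppr_le0 h oppr_ge0 sumr_le0.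
rewrite psumr_eq0 => [/allP/(_ u (mem_index_enum u))|i _]; last by rewrite oppr_ge0.
by rewrite oppr_eq0 mulf_eq0 (negPf g) orbF => /eqP.
Qed.

Lemma diff_term_ge0 d (z : S -> R) s t : pos d ->
  0 <= 2^-1 * (- gram s t * (entry d s * entry d t * (z s - z t) ^+ 2)).
Proof.
move=> p; apply: mulr_ge0; first by rewrite invr_ge0.
have [<-|st] := eqVneq s t; first by rewrite subrr expr0n !mulr0.
apply: mulr_ge0; first by rewrite oppr_ge0 gram_le0.
by apply: mulr_ge0 (sqr_ge0 _); apply: mulr_ge0.
Qed.

Lemma entry_quotient d v : supported K v -> (forall s, s \in K -> 0 < entry d s) ->
  forall s, entry v s = entry d s * (entry v s / entry d s).
Proof.
move=> vK dp s; case: (boolP (s \in K)) => [/dp d0|/vK ->].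
  by rewrite mulrCA divff ?mulr1 // gt_eqF.
by rewrite mul0r mulr0.
Qed.

Lemma term_le_sum (F : S -> R) s : (forall i, 0 <= F i) -> F s <= \sum_i F i.
Proof. by move=> F0; rewrite (bigD1 s) //= lerDl sumr_ge0. Qed.

(** A nonnegative vector that is dominant and not radical on a component makes
    the form positive definite there, so the component is spherical: all roots
    have bounded coordinates. *)
Lemma dominant_spherical a : supported K a -> pos a ->
  (forall s, s \in K -> 0 <= dot a (svec s)) ->
  (exists2 s, s \in K & 0 < dot a (svec s)) -> finite_set (std_sub gen K).
Proof.
move=> aK p dom [s1 s1K d1].
have a0 : a <> 0 by move=> e; move: d1; rewrite e dot0l ltxx.
have ap := pos_full_support aK p a0 (fun s sK _ => dom s sK).
pose X s := exists M : R, forall b, root b -> supported K b ->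
  `|entry b s / entry a s| <= M.
have sqb (c0 x M : R) : 0 < c0 -> c0 * x ^+ 2 <= M -> `|x| <= M / c0 + 1.
  move=> c0p; rewrite mulrC -ler_pdivlMr // => h; apply: (@le_trans _ _ (x ^+ 2 + 1)).
    rewrite -(real_normK (num_real x)) -subr_ge0.
    have -> : `|x| ^+ 2 + 1 - `|x| = (`|x| - 2^-1) ^+ 2 + 3 / 4 by field.
    by rewrite addr_ge0 ?sqr_ge0 // divr_ge0.
  by rewrite lerD2r.
have diag_ge0 (z : S -> R) i : 0 <= dot a (svec i) * (entry a i * z i ^+ 2).
  case: (boolP (i \in K)) => iK; last by rewrite (aK i iK) mul0r mulr0.
  by apply: mulr_ge0 (dom i iK) (mulr_ge0 (p i) (sqr_ge0 _)).
have diag0 (z : S -> R) i : dot a (svec i) * (entry a i * z i ^+ 2) <=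
    \sum_j dot a (svec j) * (entry a j * z j ^+ 2).
  exact: (term_le_sum i (diag_ge0 z)).
have XK : forall s, s \in K -> X s.
  apply: (comp_ind KJ).
    exists s1 => //; exists (1 / (dot a (svec s1) * entry a s1) + 1) => b rb bK.
    apply: sqb; first by rewrite mulr_gt0 ?ap.
    rewrite -(root_dot rb) (form_identity (entry_quotient bK ap)) -[X in X <= _]mulrA.
    apply: le_trans (diag0 (fun i => entry b i / entry a i) s1) _; rewrite lerDl.
    by apply: sumr_ge0 => s _; apply: sumr_ge0 => t _;
      exact: (diff_term_ge0 (fun i => entry b i / entry a i)).
  move=> s t sK tK st g [M MP]; pose c0 := 2^-1 * (- gram s t * (entry a s * entry a t)).
  have c0p : 0 < c0.
    apply: mulr_gt0; first by rewrite invr_gt0.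
    by rewrite mulr_gt0 ?(mulr_gt0 (ap s sK) (ap t tK)) // oppr_gt0 lt_neqAle g gram_le0.
  exists (M + (1 / c0 + 1)) => b rb bK; set z := fun i => entry b i / entry a i.
  have h : `|z t - z s| <= 1 / c0 + 1.
    apply: sqb => //; rewrite -(root_dot rb) (form_identity (entry_quotient bK ap)) -/z.
    have -> : c0 * (z t - z s) ^+ 2 =
        2^-1 * (- gram s t * (entry a s * entry a t * (z s - z t) ^+ 2)).
      by rewrite /c0; ring.
    pose F i j := 2^-1 * (- gram i j * (entry a i * entry a j * (z i - z j) ^+ 2)).
    have F0 i j : 0 <= F i j by apply: (diff_term_ge0 z).
    apply: le_trans (term_le_sum (F := F s) t (F0 s)) _.
    apply: le_trans (term_le_sum (F := fun i => \sum_j F i j) s _) _.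
      by move=> i; apply: sumr_ge0.
    rewrite lerDr; apply: sumr_ge0 => i _; exact: (diag_ge0 z).
  apply: le_trans (lerD (MP b rb bK) h).
  by rewrite -/(z s) -/(z t) -{1}[z t](subrK (z s)) addrC ler_normD.
have /choice [M MP] : forall s, exists M : R, s \in K ->
    forall b, root b -> supported K b -> `|entry b s / entry a s| <= M.
  by move=> s; case: (boolP (s \in K)) => [/XK [M MP]|_]; [exists M|exists 0].
have [L LP] := finite_height (\sum_s entry a s * M s).
apply: finite_std; exists (L ++ map -%R L).
have inL b : root b -> pos b -> supported K b -> b \in L.
  move=> rb pb bK; apply: LP => //; apply: ler_sum => s _.
  case: (boolP (s \in K)) => sK; last by rewrite bK // aK // mul0r.
  rewrite {1}(entry_quotient bK ap) ler_wpM2l //.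
  exact: le_trans (ler_norm _) (MP s sK b rb bK).
move=> b rb bK; rewrite mem_cat; case: (root_sign rb) => pb; first by rewrite inL.
rewrite -[b]opprK map_f ?orbT // inL //; first exact: rootN.
exact: supportedN.
Qed.

End Positive.
End Components.

(** * Radical vectors and affine components *)

Lemma finite_min (R : realType) (T : eqType) (f : T -> R) (L : seq T) (P : T -> Prop) :
  (forall x : T, P x -> x \in L) -> (exists x : T, P x) ->
  exists2 x : T, P x & forall y : T, P y -> f x <= f y.
Proof.
elim: L P => [|z L IH] P PL [x Px]; first by have := PL x Px.
have [[y [Py yz]]|h] := pselect (exists y, P y /\ y != z); last first.
  have e y : P y -> y = z.
    by move=> Py; apply/eqP/negPn/negP => yz; apply: h; exists y.
  by exists x => // y Py; rewrite (e y Py) (e x Px).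
have [|| m [Pm mz] mmin] := IH (fun y => P y /\ y != z).
- by move=> u [Pu /negPf uz]; have := PL u Pu; rewrite inE uz.
- by exists y.
have [[Pz lt]|h] := pselect (P z /\ f z < f m).
  exists z => // u Pu; have [->//|uz] := eqVneq u z.
  by apply: le_trans (ltW lt) _; apply: mmin.
exists m => // u Pu; have [e|uz] := eqVneq u z; last by apply: mmin.
by rewrite leNgt; apply/negP => lt; apply: h; rewrite -e.
Qed.

Section Radical.
Context {R : realType} {S : finType} {W : groupType} {gen : S -> W}.
Context {coxW : coxeter_system gen}.
Local Notation V := (vec R S).
Local Notation gram := (@gram_mx R S W gen).
Local Notation dot := (@form R S W gen).
Local Notation dotE := (@dotE R S W gen coxW).
Local Notation act := (@actv R S W gen coxW).
Local Notation refl := (@refl R S W gen).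
Implicit Types (u v b c : V) (s t : S) (w x y g : W) (I J K : {set S}).
Local Notation root := (@root_vector R S W gen coxW).

Lemma std_act_fix K d g : (forall s, s \in K -> dot d (svec s) = 0) ->
  std_sub gen K g -> act g d = d.
Proof.
move=> dK; move: g; apply: std_ind => [|s g sK _ IH]; first by rewrite act1.
by rewrite actM IH act_gen refl_fix // dK.
Qed.

Section RadicalVector.
Context {J K : {set S}} (KJ : K \in components gen J).
Context {d : V} (dK : supported K d) (dp : pos d) (d0 : d <> 0).
Context (dr : forall s, s \in K -> dot d (svec s) = 0).

Let dpos : forall s, s \in K -> 0 < entry d s.
Proof. by apply: (pos_full_support KJ) => // s sK _; rewrite dr. Qed.

(** For a radical d only the differences of the quotients v_s / d_s remain: the
    form is semidefinite, and its kernel is the line of d. *)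
Lemma radical_form v : supported K v -> dot v v = \sum_s \sum_t 2^-1 *
  (- gram s t * (entry d s * entry d t *
    (entry v s / entry d s - entry v t / entry d t) ^+ 2)).
Proof.
move=> vK; rewrite (form_identity (entry_quotient vK dpos)) big1 ?add0r // => s _.
by case: (boolP (s \in K)) => [/dr ->|/dK ->]; rewrite !mul0r ?mulr0.
Qed.

Lemma radical_ge0 v : supported K v -> 0 <= dot v v.
Proof.
move=> vK; rewrite radical_form //; apply: sumr_ge0 => s _; apply: sumr_ge0 => t _.
exact: (diff_term_ge0 (fun i => entry v i / entry d i)).
Qed.

Lemma radical_line v : supported K v -> (forall s, s \in K -> dot v (svec s) = 0) ->
  exists a : R, v = a *: d.
Proof.
move=> vK vr; have [s0 s0K] := comp_neq0 KJ; pose z i := entry v i / entry d i.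
exists (z s0).
have e : dot v v = 0.
  rewrite dot_sum big1 // => s _; rewrite dotC.
  by case: (boolP (s \in K)) => [/vr ->|/vK ->]; rewrite ?mulr0 ?mul0r.
have F0 i j : 0 <= 2^-1 * (- gram i j * (entry d i * entry d j * (z i - z j) ^+ 2)).
  exact: (diff_term_ge0 z).
have zE : forall s, s \in K -> z s = z s0.
  apply: (comp_ind (R := R) KJ); first by exists s0.
  move=> s t sK tK st g <-.
  move: e; rewrite radical_form // => /eqP.
  rewrite psumr_eq0 => [/allP/(_ s (mem_index_enum s)) /=|i _]; last first.
    by apply: sumr_ge0 => j _; exact: F0.
  rewrite psumr_eq0 => [/allP/(_ t (mem_index_enum t)) /=|j _]; last exact: F0.
  rewrite -/(z s) -/(z t) !mulf_eq0 invr_eq0 pnatr_eq0 oppr_eq0 (negPf g) /=.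
  rewrite (gt_eqF (dpos sK)) (gt_eqF (dpos tK)) /= ?expf_eq0 /= ?orbb subr_eq0.
  by move/eqP.
apply: vec_ext => s; rewrite entryZ; case: (boolP (s \in K)) => sK.
  by rewrite -(zE s sK) /z mulfVK // gt_eqF // dpos.
by rewrite vK // dK // mulr0.
Qed.

Lemma radical_angle b c : root b -> root c -> supported K b -> supported K c ->
  [\/ `|dot b c| < 1, dot b c = 1 | dot b c = -1].
Proof.
move=> rb rc bK cK.
have h1 := radical_ge0 (supportedD bK cK).
have h2 := radical_ge0 (supportedD bK (supportedN cK)).
move: h1 h2; rewrite !dotE (root_dot rb) (root_dot rc) (dotC c b) => h1 h2.
have [->|n1] := eqVneq (dot b c) 1; first by constructor 2.
have [->|n2] := eqVneq (dot b c) (-1); first by constructor 3.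
constructor 1; rewrite ltr_norml !lt_neqAle n1 eq_sym n2 /=; apply/andP; split; lra.
Qed.

(** The elements of W_K that move every vector of V_K along the radical form an
    abelian group of translations. A coset of it is determined by the products
    (g a_s, a_t), which take finitely many values. *)
Lemma radical_virtually_abelian : virtually_abelian (std_sub gen K).
Proof.
pose T : set W := [set x | std_sub gen K x /\
  forall v, supported K v -> exists a : R, act x v - v = a *: d].
have sK : subgroup (std_sub gen K) by apply: std_subgroup.
have fix_d x : std_sub gen K x -> act x d = d by apply: std_act_fix.
have sT : subgroup T.
  split=> [|x y [xK xT] [yK yT]].
    by split=> [|v _]; [apply: subgroup1|exists 0; rewrite act1 subrr scale0r].
  split=> [|v vK]; first exact: sK.2.
  have vK' : supported K (act y^-1%g v) by apply: std_act (subgroupV sK yK) vK.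
  have [a ea] := yT _ vK'; have [b eb] := xT _ vK'.
  exists (b - a); rewrite scalerBl -ea -eb actVK actM.
  by rewrite opprB addrA subrK.
exists T; split=> //; first by move=> x [].
  move=> x y [xK xT] [yK yT];
    apply: (std_faithful (R := R)) (subgroupM sK xK yK) (subgroupM sK yK xK) _.
  move=> s sK'; have [a ea] := xT _ (supported_svec sK');
    have [b eb] := yT _ (supported_svec sK').
  have ex : act x (svec s) = svec s + a *: d by rewrite -ea addrC subrK.
  have ey : act y (svec s) = svec s + b *: d by rewrite -eb addrC subrK.
  by rewrite !actM ex ey !actD !actZ !fix_d // ex ey addrAC.
have [F FP] := @finite_angles R S W gen coxW; pose F' := [:: 1, -1 & F].
have F'P b c : root b -> root c -> supported K b -> supported K c -> dot b c \in F'.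
  move=> rb rc bK cK; rewrite !inE; case: (radical_angle rb rc bK cK) => [h|->|->].
  - by rewrite FP ?orbT.
  - by rewrite eqxx.
  - by rewrite eqxx orbT.
pose code (C : set W) (c : {ffun S * S -> 'I_(size F').+1}) :=
  exists2 g, std_sub gen K g /\ C = lcoset g T &
    forall s t, s \in K -> t \in K -> dot (act g (svec s)) (svec t) = nth 0 F' (c (s, t)).
have rsv g (s : S) : root (act g (svec s)) by apply/root_act/root_svec.
refine (@finite_by_code (set W) _ _ code _ _).
  move=> _ [g gK <-].
  exists [ffun p => inord (index (dot (act g (svec p.1)) (svec p.2)) F')].
  exists g => // s t sK' tK; rewrite ffunE inordK ?ltnS ?index_size // nth_index //.
  apply: F'P; [exact: rsv|exact: root_svec| |exact: supported_svec].
  by apply: std_act => //; apply: supported_svec.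
move=> C D c _ _ [g [gK ->] gc] [h [hK ->] hc].
suff : T (h^-1 * g)%g.
  move=> Thg; apply/seteqP; split=> x /lcosetP Tx; apply/lcosetP.
    have -> : (h^-1 * x = h^-1 * g * (g^-1 * x))%g by rewrite !mulgA mulgK.
    exact: subgroupM.
  have -> : (g^-1 * x = (h^-1 * g)^-1 * (h^-1 * x))%g.
    by rewrite invgM invgK !mulgA mulgK.
  by apply: (subgroupM sT) Tx; apply: (subgroupV sT).
have hgK : std_sub gen K (h^-1 * g)%g by apply: (subgroupM sK) gK; apply: (subgroupV sK).
split=> // v vK.
have /choice [a aE] : forall s, exists a : R, s \in K ->
    act (h^-1 * g)%g (svec s) - svec s = a *: d.
  move=> s; case: (boolP (s \in K)) => sK'; last by exists 0.
  have gv : supported K (act g (svec s)) by apply: std_act => //; apply: supported_svec.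
  have hv : supported K (act h (svec s)) by apply: std_act => //; apply: supported_svec.
  have [|a e] := @radical_line (act g (svec s) - act h (svec s))
    (supportedD gv (supportedN hv)).
    by move=> t tK; rewrite !dotE gc // hc // subrr.
  exists a => _; rewrite -(fix_d _ (subgroupV sK hK)) -actZ -e actB actM.
  by rewrite actK.
exists (\sum_s entry v s * a s).
rewrite scaler_suml {1 2}(vec_expansion v) act_sum -sumrB; apply: eq_bigr => s _.
rewrite actZ -scalerBr; case: (boolP (s \in K)) => sK'; first by rewrite aE // scalerA.
by rewrite vK // mul0r !scale0r.
Qed.

End RadicalVector.

(** Make b0 simple. If b1 then is negative, the simple reflection makes b0
    negative and leaves b1 negative unless b1 is opposite to b0. *)
Lemma same_sign K b0 b1 : root b0 -> root b1 -> supported K b0 -> b1 <> - b0 ->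
  exists g (e : R), [/\ std_sub gen K g, e = 1 \/ e = -1,
    pos (e *: act g b0) & pos (e *: act g b1)].
Proof.
move=> r0 r1 b0K b10; have [h [s [hK sK e0]]] := root_conj_simple r0 b0K.
have hVK : std_sub gen K h^-1%g by apply: (subgroupV (std_subgroup _)).
have rg : root (act h^-1%g b1) by apply: root_act.
have [p|n] := root_sign rg.
  exists h^-1%g, 1; rewrite !scale1r e0 actK; split=> //; first by left.
  exact: pos_svec.
exists (gen s * h^-1)%g, (-1); rewrite !scaleN1r; split; [|by right| |].
- by apply: (subgroupM (std_subgroup _)) (std_gen sK) hVK.
- by rewrite actM e0 actK act_gen refl_svec opprK; apply: pos_svec.
- rewrite actM act_gen -reflvN; apply: refl_pos => //; first exact: rootN.
  move=> e; apply: b10; rewrite -(actVK h b1) -[act h^-1%g b1]opprK e actN.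
  by rewrite e0.
Qed.

(** Up to sign, W_K moves the sum of two parallel roots into the negative of the
    fundamental chamber: once both roots are positive, the reflection in a
    simple root that has positive product with the sum keeps them positive and
    lowers the height, and there are finitely many positive roots of bounded
    height. *)
Lemma antidominant_sum K b0 b1 : root b0 -> root b1 -> supported K b0 -> supported K b1 ->
  dot b0 b1 <= -1 -> b1 <> - b0 ->
  exists g (e : R), let d := e *: act g (b0 + b1) in
    [/\ std_sub gen K g, pos d, d <> 0 & forall s, s \in K -> dot d (svec s) <= 0].
Proof.
move=> r0 r1 b0K b1K d01 b10.
have [g0 [e [g0K e1 p0 p1]]] := same_sign r0 r1 b0K b10.
have ee : e * e = 1 by case: e1 => ->; rewrite ?mulr1 // mulrNN mulr1.
have rE b : root b -> root (e *: b).
  by case: e1 => ->; rewrite ?scale1r // scaleN1r; apply: rootN.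
pose M := height (e *: act g0 b0) + height (e *: act g0 b1).
have [L LP] := @finite_height R S W gen coxW M.
pose P (q : V * V) := exists g, [/\ std_sub gen K g,
  q = (e *: act g b0, e *: act g b1), pos q.1, pos q.2 & height q.1 + height q.2 <= M].
have rg g b : root b -> root (e *: act g b) by move=> rb; apply/rE/root_act.
have PL q : P q -> q \in [seq (b, c) | b <- L, c <- L].
  move=> [g [gK -> /= q1 q2 qM]]; apply: allpairs_f; apply: LP => //; try exact: rg.
    by apply: le_trans qM; rewrite lerDl height_ge0.
  by apply: le_trans qM; rewrite lerDr height_ge0.
have Pex : exists q, P q.
  by exists (e *: act g0 b0, e *: act g0 b1), g0; split=> //=.
have [q [g [gK qE q1 q2 qM]] qmin] := finite_min (fun q : V * V =>
  height q.1 + height q.2) PL Pex.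
move: q1 q2 qM qmin; rewrite qE {q qE} /=.
set x := e *: act g b0; set y := e *: act g b1 => q1 q2 qM qmin.
have rx : root x by apply: rg.
have ry : root y by apply: rg.
have dxy : dot x y <= -1.
  by rewrite /x /y dotZl dotZr dot_act mulrA ee mul1r.
exists g, e; rewrite /= actD scalerDr -/x -/y; split=> //.
- exact: posD.
- move=> /eqP; rewrite addr_eq0 => /eqP xy; apply: (root_asym rx q1).
  by rewrite xy opprK.
- move=> s sK; rewrite leNgt; apply/negP => ds.
  have xs : x <> svec s.
    move=> xs; move: ds; rewrite -xs dotDl (root_dot rx) dotC; lra.
  have ys : y <> svec s.
    move=> ys; move: ds; rewrite -ys dotDl (root_dot ry); lra.
  have Prs : P (refl s x, refl s y).
    exists (gen s * g)%g; split=> /=.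
    - by apply: (subgroupM (std_subgroup _)) (std_gen sK) gK.
    - by rewrite !actM !act_gen /x /y /refl !reflvZ.
    - exact: refl_pos.
    - exact: refl_pos.
    by rewrite !height_refl; apply: le_trans qM; move: ds; rewrite dotDl; lra.
  by have := qmin _ Prs; rewrite /= !height_refl; move: ds; rewrite dotDl; lra.
Qed.

(** Two parallel roots fixed by z would give a z-fixed vector whose stabiliser is
    a parabolic subgroup; if that is all of W_K the vector is radical. *)
Lemma fixed_roots_angle K z b0 b1 :
  K \in components gen K -> std_sub gen K z ->
  (forall P, parabolic gen K P -> P z -> std_sub gen K `<=` P) ->
  ~ virtually_abelian (std_sub gen K) ->
  root b0 -> root b1 -> supported K b0 -> supported K b1 -> act z b0 = b0 ->
    act z b1 = b1 ->
  [\/ `|dot b0 b1| < 1, b1 = b0 | b1 = - b0].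
Proof.
move=> KK zK zP nva.
suff H b c : root b -> root c -> supported K b -> supported K c -> act z b = b ->
    act z c = c -> c <> - b -> ~ dot b c <= -1.
  move=> r0 r1 b0K b1K z0 z1.
  have [e|n1] := pselect (b1 = b0); first by constructor 2.
  have [e|n2] := pselect (b1 = - b0); first by constructor 3.
  constructor 1; rewrite ltNge ler_normr; apply/negP => /orP[h|h].
    apply: (H b0 (- b1)) => //.
    - exact: rootN.
    - exact: supportedN.
    - by rewrite actN z1.
    - by move=> /oppr_inj.
    - by rewrite dotNr lerN2.
  by apply: (H b0 b1) => //; rewrite lerNr.
move=> r0 r1 b0K b1K z0 z1 n d01.
have [g [e /= [gK dp d0 dneg]]] := antidominant_sum r0 r1 b0K b1K d01 n.
set d := e *: _ in dp d0 dneg.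
have sK : subgroup (std_sub gen K) by apply: std_subgroup.
have dK : supported K d by apply/supportedZ/std_act => //; apply: supportedD.
pose y := (g * z * g^-1)%g.
have yK : std_sub gen K y by exact: (subgroupM sK (subgroupM sK gK zK) (subgroupV sK gK)).
have yd : act y d = d by rewrite /d actZ /y !actM actK actD z0 z1.
clearbody d.
have lf : linear_form (fun v => - dot d v).
  by split=> *; rewrite ?dotDr ?dotZr ?opprD ?mulrN.
have yI := stab_dominant (f := fun v => - dot d v) lf _ yK _.
have {yI} : std_sub gen [set s in K | - dot d (svec s) == 0]%SET y.
  apply: yI => [s sK'|v]; first by rewrite oppr_ge0 dneg.
  by rewrite -{1}yd dot_act.
set I := finset.finset _ => yI.
have IK : I \subset K by apply/fintype.subsetP => s; rewrite inE => /andP[].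
have h := zP (conj_set g^-1%g (std_sub gen I)) _ _.
apply: nva; apply: (radical_virtually_abelian KK dK dp d0) => s sK'.
have : std_sub gen I (gen s).
  have : conj_set g^-1%g (std_sub gen I) (g^-1 * gen s * g)%g.
    apply: h.
    - by exists I, g^-1%g; split=> //; apply: (subgroupV sK).
    - by rewrite conj_setP invgK.
    - exact: (subgroupM sK (subgroupM sK (subgroupV sK gK) (std_gen sK')) gK).
  by rewrite conj_setP invgK !mulgA mulgV mul1g mulgK.
by move=> /(std_genE (R := R)); rewrite inE sK' oppr_eq0 => /eqP.
Qed.

End Radical.

(** * Periodic roots *)

Section Periodic.
Context {R : realType} {S : finType} {W : groupType} {gen : S -> W}.
Context {coxW : coxeter_system gen}.
Local Notation V := (vec R S).
Local Notation dot := (@form R S W gen).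
Local Notation act := (@actv R S W gen coxW).
Implicit Types (u v b c : V) (s t : S) (w x y g : W) (I J K : {set S}).
Local Notation root := (@root_vector R S W gen coxW).
Local Notation root_refl := (@root_refl R S W gen coxW).
Local Notation dual_interior := (@dual_interior R S W gen coxW).

Lemma span_dot0 (B : seq V) u v : (forall b, b \in B -> dot u b = 0) ->
  v \in <<B>>%VS -> dot u v = 0.
Proof.
move=> uB vB; rewrite (coord_span (X := in_tuple B) vB).
rewrite (big_morph (dot u) (id1 := 0) (op1 := +%R)) => [|x y|]; last 2 first.
- exact: dotDr.
- exact: dot0r.
by rewrite big1 // => i _; rewrite dotZr uB ?mulr0 // mem_nth.
Qed.

Lemma finite_spanning (X : V -> Prop) : exists B : seq V,
  (forall b, b \in B -> X b) /\ forall c, X c -> c \in <<B>>%VS.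
Proof.
pose Q n := `[< exists2 B : seq V, (forall b, b \in B -> X b) & \dim <<B>>%VS = n >].
have Q0 : exists n, Q n by exists (\dim <<([::] : seq V)>>%VS); apply/asboolP;
  exists [::].
have Qle n : Q n -> (n <= \dim {:V})%N.
  by move=> /asboolP [B _ <-]; apply/dimvS/subvf.
have [n /asboolP [B BX Bn] nmax] := ex_maxnP Q0 Qle.
exists B; split=> // c Xc; have sB : (<<B>> <= <<c :: B>>)%VS.
  by rewrite span_cons addvSr.
have : (<<B>> == <<c :: B>>)%VS.
  rewrite eqEdim sB /= Bn; apply: nmax; apply/asboolP; exists (c :: B) => // b.
  by rewrite inE => /orP[/eqP ->|/BX].
by move=> /eqP ->; rewrite memv_span // mem_head.
Qed.

(** Such a root is determined by its products with a finite spanning family of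
    roots of the set, which take finitely many values. That the products
    determine it uses the angles: if b - c is orthogonal to all roots of the
    set, then (b, c) = 1, which forces b = c. *)
Lemma finite_by_angles (X : V -> Prop) : (forall b, X b -> root b) ->
  (forall b c, X b -> X c -> [\/ `|dot b c| < 1, c = b | c = - b]) ->
  finite_set [set b | X b].
Proof.
move=> Xr Xa; have [B [BX BS]] := finite_spanning X.
have [F FP] := @finite_angles R S W gen coxW; pose F' := [:: 1, -1 & F].
have F'P b c : X b -> X c -> dot b c \in F'.
  move=> Xb Xc; have bb := root_dot (Xr _ Xb); rewrite !inE.
  case: (Xa b c Xb Xc) => [h|->|->].
  - by rewrite FP ?orbT //; apply: Xr.
  - by rewrite bb eqxx.
  - by rewrite dotNr bb eqxx orbT.
pose code (b : V) (c : {ffun 'I_(size B) -> 'I_(size F').+1}) :=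
  forall i : 'I_(size B), dot b (nth 0 B i) = nth 0 F' (c i).
refine (@finite_by_code V _ _ code _ _) => /=.
  move=> b Xb; exists [ffun i => inord (index (dot b (nth 0 B (nat_of_ord i))) F')] => i.
  rewrite ffunE inordK ?ltnS ?index_size // nth_index // F'P //.
  by apply/BX/mem_nth.
move=> b c e Xb Xc be ce.
have z : dot (b - c) c = 0.
  apply: span_dot0 (BS _ Xc) => u /(nthP 0) [i iB <-].
  by rewrite dotDl dotNl (be (Ordinal iB)) (ce (Ordinal iB)) subrr.
move: z; rewrite dotDl dotNl (root_dot (Xr _ Xc)) => /eqP; rewrite subr_eq0 => /eqP z.
case: (Xa b c Xb Xc) => [|//|cb].
  by rewrite z normr1 ltxx.
by move: z; rewrite cb dotNr (root_dot (Xr _ Xb)) => h; exfalso; move: h; lra.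
Qed.

Section FiniteSystem.
Context {L0 : seq V} (L0u : uniq L0) (L0r : forall c, c \in L0 -> root c).
Context (L0s : forall b c, b \in L0 -> c \in L0 -> act (root_refl b) c \in L0).

(** A finite root system has no radical: averaging over its (finite) group of
    automorphisms kills every root, since the reflection in a root exchanges
    it with its opposite, but leaves every radical vector unchanged. *)
Lemma finite_system_radical u : u \in <<L0>>%VS ->
  (forall c, c \in L0 -> dot u c = 0) -> u = 0.
Proof.
move=> uS u0; pose n := size L0; pose e (i : 'I_n) := nth 0 L0 i.
have eL i : e i \in L0 by apply: mem_nth.
have re i : root (e i) by apply: L0r.
have e_inj : injective e.
  by move=> i j /eqP; rewrite nth_uniq // => /eqP/val_inj.
have eP c : c \in L0 -> exists i, e i = c.
  by move=> /(nthP 0) [i iL <-]; exists (Ordinal iL).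
pose Q (f : {ffun 'I_n -> 'I_n}) g :=
  act g u = u /\ forall i, act g (e i) = e (f i).
pose A (f : {ffun 'I_n -> 'I_n}) := `[< exists g, Q f g >].
have /choice [rho rhoE] : forall i, exists f : {ffun 'I_n -> 'I_n}, Q f (root_refl (e i)).
  move=> i; have /choice [f fE] : forall j, exists k, e k = act (root_refl (e i)) (e j).
    by move=> j; apply/eP/L0s.
  exists (finfun f); split=> [|j]; last by rewrite ffunE fE.
  by rewrite act_root_refl // /reflect_along u0 // mulr0 scale0r subr0.
have rhoK i j : rho i (rho i j) = j.
  by apply: e_inj; rewrite -!(rhoE i).2 !act_root_refl // reflvK // root_dot.
pose h i (f : {ffun 'I_n -> 'I_n}) : {ffun 'I_n -> 'I_n} := [ffun j => f (rho i j)].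
have hK i : involutive (h i) by move=> f; apply/ffunP => j; rewrite !ffunE rhoK.
have Ah i f : A f -> A (h i f).
  move=> /asboolP [g [gu gf]]; apply/asboolP; exists (g * root_refl (e i))%g.
  split=> [|j]; first by rewrite actM (rhoE i).1.
  by rewrite actM (rhoE i).2 gf ffunE.
have AhE i f : A (h i f) = A f.
  by apply/idP/idP => [/(Ah i)|]; [rewrite hK|apply: Ah].
have S0 j : \sum_(f | A f) e (f j) = 0.
  have : \sum_(f | A f) e (f j) = - \sum_(f | A f) e (f j).
    rewrite {1}(reindex_inj (inv_inj (hK j))) -sumrN (eq_bigl A) //.
    apply: eq_bigr => f /asboolP [g [_ gf]].
    rewrite ffunE -gf -(rhoE j).2 act_root_refl //.
    by rewrite reflv_self ?root_dot // actN gf.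
  move=> /eqP; rewrite -addr_eq0 -mulr2n -scaler_nat scaler_eq0 pnatr_eq0 /=.
  by move/eqP.
have uE := coord_span (X := in_tuple L0) uS.
set k := fun i : 'I_n => coord (in_tuple L0) i u.
have uE' : u = \sum_i k i *: e i by rewrite {1}uE.
have : \sum_(f | A f) u = 0.
  transitivity (\sum_(f | A f) \sum_i k i *: e (f i)).
    apply: eq_bigr => f /asboolP [g [gu gf]].
    rewrite -{1}gu uE' act_sum; apply: eq_bigr => i _.
    by rewrite actZ gf.
  by rewrite exchange_big big1 // => i _; rewrite -scaler_sumr S0 scaler0.
rewrite sumr_const -scaler_nat => /eqP; rewrite scaler_eq0 pnatr_eq0.
case/orP => [/eqP A0|/eqP //].
have : [ffun i : 'I_n => i] \in A.
  apply/asboolP; exists 1%g; split=> [|i]; first by rewrite act1.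
  by rewrite act1 ffunE.
by rewrite (card0_eq A0).
Qed.

(** The automorphisms of the system that move vectors only within its span form
    a finite group D: one that fixes all roots of the system moves every vector
    by a radical vector of the span, that is, not at all. A D-invariant
    functional vanishes on the system, as each root is mapped to its opposite. *)
Lemma finite_system_dual_interior K : (forall c, c \in L0 -> supported K c) ->
  exists f, dual_interior K f /\ forall c, c \in L0 -> f c = 0.
Proof.
move=> L0K.
pose D : set W := [set g | (forall c, (act g c \in L0) = (c \in L0)) /\
   forall v, act g v - v \in <<L0>>%VS].
have sD : subgroup D.
  split=> [|x y [xL xv] [yL yv]].
    by split=> [c|v]; rewrite act1 ?subrr ?mem0v.
  split=> [c|v]; first by rewrite actM xL -yL actVK.
  have -> : act (x * y^-1)%g v - v = (act x (act y^-1%g v) - act y^-1%g v)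
        - (act y (act y^-1%g v) - act y^-1%g v).
    by rewrite actVK actM opprB addrA subrK.
  by rewrite memvB.
have Drw c : c \in L0 -> D (root_refl c).
  move=> cL; have rc := L0r cL; split=> [b|v].
    apply/idP/idP => [/(L0s cL)|]; last exact: L0s.
    by rewrite !act_root_refl // reflvK // root_dot.
  by rewrite act_root_refl // /reflect_along addrAC subrr add0r memvN memvZ // memv_span.
have fD : finite_set D.
  pose code (g : W) (f : {ffun 'I_(size L0) -> 'I_(size L0).+1}) :=
    forall i : 'I_(size L0), act g (nth 0 L0 i) = nth 0 L0 (f i).
  refine (@finite_by_code W _ _ code _ _).
    move=> g [gL _].
    exists [ffun i => inord (index (act g (nth 0 L0 (nat_of_ord i))) L0)] => i.
    by rewrite ffunE inordK ?ltnS ?index_size // nth_index // gL mem_nth.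
  move=> g g' f Dg Dg' gf gf'; apply: (mulgI g'^-1%g); rewrite mulVg.
  have [_ xv] : D (g'^-1 * g)%g by apply: (subgroupM sD) _ Dg; apply: (subgroupV sD).
  have xc c : c \in L0 -> act (g'^-1 * g)%g c = c.
    move=> /(nthP 0) [i iL <-].
    by rewrite actM (gf (Ordinal iL)) -(gf' (Ordinal iL)) actK.
  apply: (act_faithful (R := R)) => v; rewrite act1; apply/eqP; rewrite -subr_eq0.
  apply/eqP/finite_system_radical => // c cL.
  by rewrite dotDl dotNl -{1}(xc c cL) dot_act subrr.
have [f [fi fD']] := @finite_group_dual_interior R S W gen coxW K D sD fD.
exists f; split=> // c cL; have := fD' _ (Drw c cL) c.
have rc := L0r cL.
rewrite act_root_refl // reflv_self ?root_dot // linear_formN; last by case: fi.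
by move=> h; lra.
Qed.

End FiniteSystem.

Lemma dual_interior_act K f x : std_sub gen K x -> dual_interior K f ->
  dual_interior K (fun v => f (act x v)).
Proof.
move=> xK [lf [L fL]]; split; first exact: linear_form_act.
have [M MP] := @inversions_finite R S W gen coxW x^-1%g.
exists (M ++ map (act x^-1%g) L) => b rb p bK fb; rewrite mem_cat.
have rx : root (act x b) by apply: root_act.
case: (root_sign rx) => [q|n]; last by rewrite MP // invgK.
by rewrite -(actK x b) map_f ?orbT // fL //; apply: std_act.
Qed.

Lemma dual_interior_zeros K f : dual_interior K f -> exists L : seq V, uniq L /\
  forall c, c \in L <-> [/\ root c, supported K c & f c = 0].
Proof.
move=> [lf [L fL]].
have /finite_seqP [M ME] : finite_set [set c | [/\ root c, supported K c & f c = 0]].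
  apply/finite_setE; exists (L ++ map -%R L) => c [rc cK fc]; rewrite mem_cat.
  case: (root_sign rc) => p; first by rewrite fL // fc.
  rewrite -[c]opprK map_f ?orbT // fL //; [exact: rootN|exact: supportedN|].
  by rewrite linear_formN // fc oppr0.
exists (undup M); split=> [|c]; first exact: undup_uniq.
rewrite mem_undup; split=> h.
  by have : [set` M] c by []; rewrite -ME.
by have : [set c | [/\ root c, supported K c & f c = 0]] c by []; rewrite ME.
Qed.

Lemma small_multiple (T : eqType) (L : seq T) (f f' : T -> R) :
  exists2 e : R, 0 < e & forall c : T, c \in L -> f c != 0 -> e * `|f' c| < `|f c|.
Proof.
elim: L => [|z L [e e0 eL]]; first by exists 1.
have [fz|fz] := eqVneq (f z) 0.
  exists e => // c; rewrite inE => /orP[/eqP ->|]; first by rewrite fz eqxx.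
  exact: eL.
pose e' := `|f z| / (`|f' z| + 1).
have d0 : 0 < `|f' z| + 1 by rewrite ltr_wpDl.
exists (Num.min e e'); first by rewrite lt_min e0 divr_gt0 ?normr_gt0.
move=> c; rewrite inE => /orP[/eqP -> _|cL fc].
  apply: (@le_lt_trans _ _ (e' * `|f' z|)).
    by rewrite ler_wpM2r // ge_min lexx orbT.
  by rewrite /e' mulrAC ltr_pdivrMr // ltr_pM2l ?normr_gt0 // ltrDl.
apply: le_lt_trans (eL c cL fc); rewrite ler_wpM2r // ge_min lexx //.
Qed.

(** A small perturbation in the direction of f' keeps a functional in the
    interior and cuts its zero set down to the zeros that f' shares. *)
Lemma dual_interior_perturb K f f' : dual_interior K f -> dual_interior K f' ->
  exists e : R, let f2 := fun v => f v + e * f' v in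
    dual_interior K f2 /\ forall c, root c -> supported K c -> f2 c = 0 ->
      f c = 0 /\ f' c = 0.
Proof.
move=> [lf [L fL]] [lf' [L' fL']].
have [e e0 eP] := small_multiple (L ++ L') f f'.
exists e => f2.
have lf2 : linear_form f2.
  split=> [u v|a v]; rewrite /f2 ?lf.1 ?lf.2 ?lf'.1 ?lf'.2; ring.
have f2L c : root c -> pos c -> supported K c -> f2 c <= 0 -> c \in L ++ L'.
  move=> rc p cK; rewrite mem_cat => h.
  have [f0|f0] := leP (f c) 0; first by rewrite fL.
  have [f'0|f'0] := leP (f' c) 0; first by rewrite fL' ?orbT.
  by have : 0 < f2 c; [rewrite addr_gt0 // mulr_gt0|rewrite ltNge h].
have zero c : root c -> pos c -> supported K c -> f2 c = 0 -> f c = 0 /\ f' c = 0.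
  move=> rc p cK h; have cL : c \in L ++ L' by apply: f2L; rewrite ?h.
  have fc : f c = 0.
    apply/eqP/negPn/negP => fc; have := eP c cL fc.
    have -> : f c = - (e * f' c) by apply/eqP; rewrite -addr_eq0; apply/eqP.
    by rewrite normrN normrM (gtr0_norm e0) ltxx.
  split=> //; move: h; rewrite /f2 fc add0r => /eqP.
  by rewrite mulf_eq0 (gt_eqF e0) => /eqP.
split=> [|c rc cK h]; first by split=> //; exists (L ++ L').
case: (root_sign rc) => p; first exact: zero.
have [||||h1 h2] := zero (- c); rewrite ?linear_formN ?h ?oppr0 //.
- exact: rootN.
- exact: supportedN.
move: h1 h2; rewrite !linear_formN // => /eqP h1 /eqP h2.
by move: h1 h2; rewrite !oppr_eq0 => /eqP -> /eqP ->.
Qed.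

(** The periodic roots form a finite root system, normalised by x, on which some
    functional of the interior vanishes. One with the fewest zeros among the
    roots of W_K has the same zeros as its translates by x, so its stabiliser,
    a finite parabolic subgroup, is normalised by x. *)
Lemma periodic_parabolic K x n b :
  K \in components gen K -> std_sub gen K x ->
  (forall n P, (0 < n)%N -> parabolic gen K P -> P (x ^+ n)%g -> std_sub gen K `<=` P) ->
  ~ virtually_abelian (std_sub gen K) ->
  root b -> supported K b -> (0 < n)%N -> act (x ^+ n)%g b = b ->
  exists P, [/\ parabolic gen K P, finite_set P, conj_set x P = P & P (root_refl b)].
Proof.
move=> KK xK xP nva rb bK n0 xb.
pose X c := [/\ root c, supported K c & exists2 m, (0 < m)%N & act (x ^+ m)%g c = c].
have sK : subgroup (std_sub gen K) by apply: std_subgroup.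
have actXX m k c : act (x ^+ m)%g c = c -> act (x ^+ (m * k))%g c = c.
  move=> e; rewrite expgnA; elim: k => [|k IH]; first by rewrite act1.
  by rewrite expgS actM IH.
have common b0 b1 : X b0 -> X b1 -> exists m,
    [/\ (0 < m)%N, act (x ^+ m)%g b0 = b0 & act (x ^+ m)%g b1 = b1].
  move=> [_ _ [m0 m0p e0]] [_ _ [m1 m1p e1]]; exists (m0 * m1)%N.
  by rewrite muln_gt0 m0p m1p; split=> //; [|rewrite mulnC]; apply: actXX.
have Xa b0 b1 : X b0 -> X b1 -> [\/ `|dot b0 b1| < 1, b1 = b0 | b1 = - b0].
  move=> X0 X1; have [m [m0 e0 e1]] := common _ _ X0 X1.
  have [r0 K0 _] := X0; have [r1 K1 _] := X1.
  apply: (fixed_roots_angle KK _ _ nva r0 r1 K0 K1 e0 e1).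
    exact: (@subgroupX _ _ _ m sK xK).
  by move=> P; apply: xP.
have Xrw b0 b1 : X b0 -> X b1 -> X (act (root_refl b0) b1).
  move=> X0 X1; have [m [m0 e0 e1]] := common _ _ X0 X1.
  have [r0 K0 _] := X0; have [r1 K1 _] := X1.
  split; first exact: root_act.
    by apply: std_act => //; apply/root_refl_std.
  exists m => //; rewrite !act_root_refl //.
  by rewrite -[b1](actK (x ^+ m)%g) -reflv_act e0 actK e1.
have Xx c : X c -> X (act x c).
  move=> [rc cK [m m0 e]]; split; [exact: root_act|exact: std_act|].
  by exists m => //; rewrite -actM -expgSr expgS actM e.
have XxV c : X c -> X (act x^-1%g c).
  move=> [rc cK [m m0 e]]; split; [exact: root_act|exact: std_act (subgroupV sK xK) cK|].
  exists m => //; apply: (act_inj (w := x)); rewrite actVK.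
  by rewrite -!actM -expgS expgSr mulgK e.
have /finite_seqP [L00 L00E] : finite_set [set c | X c].
  by apply: finite_by_angles Xa => c [].
pose L0 := undup L00.
have L0P c : c \in L0 <-> X c.
  rewrite mem_undup; split=> h; first by have : [set` L00] c by []; rewrite -L00E.
  by have : [set c | X c] c by []; rewrite L00E.
have [f0 [f0i f0z]] : exists f, dual_interior K f /\ forall c, c \in L0 -> f c = 0.
  apply: finite_system_dual_interior.
  - exact: undup_uniq.
  - by move=> c /L0P [].
  - by move=> b0 b1 /L0P X0 /L0P X1; apply/L0P/Xrw.
  - by move=> c /L0P [].
pose good f := dual_interior K f /\ forall c, X c -> f c = 0.
have goodx f : good f -> good (fun v => f (act x v)).
  by move=> [fi fz]; split=> [|c /Xx/fz//]; apply: dual_interior_act.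
have goodxV f : good f -> good (fun v => f (act x^-1%g v)).
  by move=> [fi fz]; split=> [|c /XxV/fz//];
    apply: dual_interior_act (subgroupV sK xK) fi.
pose Zf (f : V -> R) c := [/\ root c, supported K c & f c = 0].
pose Q k := `[< exists f (L : seq V), [/\ good f, uniq L, size L = k &
    forall c, c \in L <-> Zf f c] >].
have Qex : exists k, Q k.
  have [L [uL LP]] := dual_interior_zeros f0i; exists (size L); apply/asboolP.
  by exists f0, L; split=> //; split=> // c /L0P /f0z.
have [k /asboolP [f [L [fg uL sL LP]]] kmin] := ex_minnP Qex.
have Zmin f' : good f' -> forall c, Zf f c -> f' c = 0.
  move=> fg' c /LP cL; have [e /= [f2i f2z]] := dual_interior_perturb fg.1 fg'.1.
  have : (k <= size [seq c <- L | f' c == 0%R])%N.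
    apply: kmin; apply/asboolP;
      exists (fun v => f v + e * f' v), [seq c <- L | f' c == 0%R].
    split=> //; [split=> // a Xa'|exact: filter_uniq|].
      by rewrite (fg.2 a Xa') (fg'.2 a Xa') mulr0 addr0.
    move=> a; rewrite mem_filter;
      split=> [/andP[/eqP f'a /LP [ra aK fa]]|[ra aK /(f2z a ra aK) [fa f'a]]].
      by split=> //; rewrite fa f'a mulr0 addr0.
    by rewrite f'a eqxx; apply/LP.
  rewrite -sL size_filter => h.
  have : all (fun c => f' c == 0%R) L by rewrite all_count eqn_leq count_size h.
  by move=> /allP/(_ c cL)/eqP.
have [g [I [gK IK WI fI st]]] := dual_interior_stab fg.1.
pose P := conj_set g (std_sub gen I).
have PK y : P y -> std_sub gen K y.
  move=> /conj_setP /(std_mono IK) h.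
  have -> : y = (g * (g^-1 * y * g) * g^-1)%g by rewrite !mulgA mulgV mul1g mulgK.
  exact: (subgroupM sK (subgroupM sK gK h) (subgroupV sK gK)).
have Zg s : s \in I -> Zf f (act g (svec s)).
  move=> sI; split; [exact/root_act/root_svec| |exact: fI].
  by apply: std_act => //; apply/supported_svec/(fintype.subsetP IK).
have Pinv f' y v : good f' -> P y -> f' (act y v) = f' v.
  move=> fg' Py; apply: zero_conj_inv Py; first by case: fg'.1.
  by move=> s sI; apply: Zmin => //; apply: Zg.
exists P; split.
- by exists I, g.
- exact: finite_image.
- apply/seteqP; split=> y.
    rewrite conj_setP => Py; have yK : std_sub gen K y.
      have -> : y = (x * (x^-1 * y * x) * x^-1)%g by rewrite !mulgA mulgV mul1g mulgK.
      exact: (subgroupM sK (subgroupM sK xK (PK _ Py)) (subgroupV sK xK)).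
    apply/(st y yK) => v.
    have := Pinv _ _ (act x^-1%g v) (goodx _ fg) Py; rewrite actVK => <-.
    by rewrite -!actM !mulgA mulgV mul1g mulgK.
  move=> Py; apply/conj_setP/st.
    exact: (subgroupM sK (subgroupM sK (subgroupV sK xK) (PK _ Py)) xK).
  move=> v; have := Pinv _ _ (act x v) (goodxV _ fg) Py; rewrite actK => <-.
  by rewrite !actM.
- have bX : X b by split=> //; exists n.
  apply/st; first by apply/root_refl_std.
  by move=> v; apply: linear_form_root_refl => //; [case: fg.1|apply: fg.2].
Qed.

End Periodic.

(** * Supports, inversions and parabolic closures *)

Section Parabolics.
Context {R : realType} {S : finType} {W : groupType} {gen : S -> W}.
Context {coxW : coxeter_system gen}.
Local Notation V := (vec R S).
Local Notation act := (@actv R S W gen coxW).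
Local Notation l := (length gen).
Implicit Types (u v b c : V) (s t : S) (w x y g : W) (I J K : {set S}).
Local Notation root := (@root_vector R S W gen coxW).
Local Notation root_refl := (@root_refl R S W gen coxW).

Lemma supp_min I w : std_sub gen I w -> supp gen w \subset I.
Proof. by move=> wI; apply: finset.bigcap_inf; apply/asboolP. Qed.

Lemma supp_std w : std_sub gen (supp gen w) w.
Proof.
apply/(stdP (R := R)) => v t; rewrite entryD entryN => tS.
have [I [wI tI]] : exists I, std_sub gen I w /\ t \notin I.
  apply: contrapT => h; move/negP: tS; apply; apply/finset.bigcapP => I /asboolP wI.
  by apply/negPn/negP => tI; apply: h; exists I.
by rewrite (std_entry _ wI tI) subrr.
Qed.

(** A minimal gallery from 1 to x y through x does not recross the walls that
    it crosses on the way to x. *)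
Lemma inversion_mono x y b : l (x * y)%g = (l x + l y)%N ->
  root b -> pos b -> pos (- act x^-1%g b) -> pos (- act (x * y)^-1%g b).
Proof.
move=> + rb p n; move: y; apply: length_ind => [|y s lys IH] lxy.
  by rewrite mulg1.
have ly : l (y * gen s)%g = (l y).+1.
  by rewrite (@length_gen_ltS _ _ _ _ _ s) genKr.
have le : (l (x * y * gen s)%g <= (l (x * y)%g).+1)%N by apply: lengthMgen_le.
have lxy' : l (x * y)%g = (l x + l y)%N.
  apply/eqP; rewrite eqn_leq lengthM /= -ltnS -addnS -ly -lxy mulgA //.
have nb := IH lxy'.
have lt : (l (x * y)%g < l (x * y * gen s)%g)%N.
  by rewrite -mulgA lxy ly lxy' addnS.
rewrite mulgA invgM genV actM act_gen -reflvN.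
apply: refl_pos => //; first by apply/rootN/root_act.
move=> e; have := pos_act lt : pos (act (x * y)%g (svec s)); rewrite -e actN actVK.
exact: root_asym.
Qed.

(** Appending the letter s to a word of w multiplies w on the left by the
    reflection in the new inversion w a_s. *)
Lemma gen_by_inversions (A : set W) : subgroup A -> forall w,
  (forall b, root b -> pos b -> pos (- act w^-1%g b) -> A (root_refl b)) -> A w.
Proof.
move=> sA; apply: length_ind => [_|w s ls IH h]; first exact: subgroup1.
have rs : root (act w (svec s)) by apply/root_act/root_svec.
have -> : (w * gen s = root_refl (act w (svec s)) * w)%g.
  by rewrite root_refl_act ?root_refl_svec ?mulgVK //; apply: root_svec.
apply: (subgroupM sA).
  apply: h => //; first exact: pos_act.
  by rewrite invgM genV actM actK act_gen refl_svec opprK; apply: pos_svec.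
apply: IH => b rb p n; apply: h => //; apply: inversion_mono => //.
have -> : l (gen s) = 1%N.
  apply/eqP; rewrite eqn_leq length_gen /= lt0n; apply/eqP => /length_eq0 e.
  by move: ls; rewrite e mulg1 ltnn.
apply/eqP; rewrite eqn_leq addn1 lengthMgen_le //.
Qed.

Lemma straight_length w n m : straight gen w ->
  l (w ^+ n * w ^+ m)%g = (l (w ^+ n)%g + l (w ^+ m)%g)%N.
Proof. by move=> [_ e]; rewrite -expgnDr !e mulnDl. Qed.

(** The powers of a straight element lie on a geodesic, which crosses every wall
    at most once. *)
Lemma straight_neg w b n : straight gen w -> root b -> pos b ->
  pos (- act w^-1%g b) -> (0 < n)%N -> pos (- act (w ^+ n)^-1%g b).
Proof.
move=> sw rb p nb; case: n => // n _; rewrite expgS; apply: inversion_mono => //.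
by have := straight_length 1 n sw; rewrite expg1.
Qed.

Lemma straight_pos w b n : straight gen w -> root b -> pos b ->
  pos (- act w^-1%g b) -> pos (act (w ^+ n)%g b).
Proof.
move=> sw rb p nb; have rg : root (act (w ^+ n)%g b) by apply: root_act.
case: (root_sign rg) => // ng; exfalso.
have := @inversion_mono (w ^+ n)%g w (- act (w ^+ n)%g b); rewrite actN actK opprK.
move=> /(_ _ (rootN rg) ng p); rewrite invgM actM actN actK => h.
have : pos (- act w^-1%g (- b)).
  by apply: h; have := straight_length n 1 sw; rewrite expg1.
by rewrite actN opprK => /(root_asym (root_act _ rb)); apply.
Qed.

Lemma infinite_negatives g (r : nat -> V) : (forall n, root (r n)) ->
  (forall n, pos (r n)) -> (forall n, pos (- act g^-1%g (r n))) ->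
  exists n m, (n < m)%N /\ r n = r m.
Proof.
move=> rr rp rn; have [L LP] := @inversions_finite R S W gen coxW g.
have rL n : r n \in L by apply: LP.
have : ~~ uniq (map r (iota 0 (size L).+1)).
  apply/negP => u; have : {subset map r (iota 0 (size L).+1) <= L}.
    by move=> ? /mapP [n _ ->].
  by move=> /(uniq_leq_size u); rewrite size_map size_iota ltnn.
move=> /(uniqPn 0) [i [j [ij jn e]]]; exists i, j; split=> //.
rewrite size_map size_iota in jn.
by move: e; rewrite !(nth_map 0%N) ?size_iota // ?nth_iota // (ltn_trans ij).
Qed.

(** It suffices that P = v W_I v^-1 contains the reflections in the inversions b
    of w. If v^-1 b is not in the span of I, all v^-1 w^(kn) b have the same
    sign, as W_I does not change the coordinates outside I. But w^(kn) b is
    positive for n >= 0 and negative for n < 0, so that v^-1 would change the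
    sign of infinitely many roots. *)
Lemma straight_parabolic w k P : straight gen w -> (0 < k)%N ->
  parabolic gen [set: S]%SET P -> P (w ^+ k)%g -> P w.
Proof.
move=> sw k0 [I [v [_ _ ->]]] /conj_setP wk.
set u := (_ * v)%g in wk.
have sI : subgroup (std_sub gen I) by apply: std_subgroup.
apply: gen_by_inversions => [|b rb p nb].
  by apply: conj_subgroup.
apply/conj_setP; rewrite -[X in (_ * X)%g]invgK -root_refl_act //.
apply/root_refl_std; first exact: root_act.
move=> t tI; apply: contrapT => /eqP ct.
have wE n : (w ^+ (k * n) = v * u ^+ n * v^-1)%g.
  rewrite expgnA /u; elim: n => [|n IH]; first by rewrite mulg1 mulgV.
  by rewrite !expgSr IH !mulgA mulgK.
have entryE x : std_sub gen I x ->
  entry (act x (act v^-1%g b)) t = entry (act v^-1%g b) t.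
  by move=> xI; rewrite (std_entry _ xI tI).
have rx x : root (act x b) by apply: root_act.
have kn n : (0 < k * n.+1)%N by rewrite muln_gt0 k0.
have [c0|c0] : 0 < entry (act v^-1%g b) t \/ entry (act v^-1%g b) t < 0.
  by move: ct; rewrite neq_lt => /orP[]; [right|left].
- have [||| n [m [nm e]]] := @infinite_negatives v (fun n =>
  - act (w ^+ (k * n.+1))^-1%g b).
  + by move=> n; apply: rootN.
  + by move=> n; apply: straight_neg.
  + move=> n; rewrite actN opprK -actM wE !invgM invgK !mulgA mulVg mul1g actM.
    have rg : root (act (u ^+ n.+1)^-1%g (act v^-1%g b)) by do 2 apply: root_act.
    case: (root_sign rg) => // /(_ t); rewrite entryN entryE;
      last exact: (subgroupV sI (subgroupX _ sI wk)).
    by rewrite oppr_ge0 leNgt c0.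
  have : act (w ^+ (k * (m - n.+1).+1))^-1%g b = b.
    apply: (act_inj (w := (w ^+ (k * n.+1))^-1%g)); move/oppr_inj: e => ->.
    rewrite -actM -invgM -expgnDr -mulnDr; congr (act (w ^+ (k * _))^-1%g b).
    by rewrite subnSK // addnS subnK // ltnW.
  have := straight_neg sw rb p nb (kn (m - n.+1)%N) => + e'.
  by rewrite e'; apply: root_asym.
have [||| n [m [nm e]]] := @infinite_negatives v (fun n => act (w ^+ (k * n))%g b).
+ by move=> n.
+ by move=> n; apply: straight_pos.
+ move=> n; rewrite -actM wE !mulgA mulVg mul1g actM.
  have rg : root (act (u ^+ n)%g (act v^-1%g b)) by do 2 apply: root_act.
  case: (root_sign rg) => // /(_ t); rewrite entryE; last exact: (subgroupX _ sI wk).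
  by rewrite leNgt c0.
have : act (w ^+ (k * (m - n.+1).+1))^-1%g b = b.
  rewrite subnSK //; apply: (act_inj (w := (w ^+ (k * (m - n)))%g)).
  rewrite actVK; apply: (act_inj (w := (w ^+ (k * n))%g)).
  by rewrite e -actM -expgnDr -mulnDr subnKC // ltnW.
have := straight_neg sw rb p nb (kn (m - n.+1)%N) => + e'.
by rewrite e'; apply: root_asym.
Qed.

Lemma Pc_self K w : Pc gen K w w.
Proof. by move=> P [_]; apply. Qed.

Lemma Pc_min K w P : parabolic gen K P -> P w -> Pc gen K w `<=` P.
Proof. by move=> pP Pw x; apply; split=> // _ ->. Qed.

Lemma Pc_supp w I : Pc gen [set: S]%SET w = std_sub gen I -> I = supp gen w.
Proof.
move=> e; apply/eqP; rewrite finset.eqEsubset; apply/andP; split; last first.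
  by apply: supp_min; rewrite -e; apply: Pc_self.
apply/fintype.subsetP => s sI; apply: (std_genE (R := R)).
have : std_sub gen I (gen s) by apply: std_gen.
rewrite -e; apply: Pc_min; last exact: supp_std.
exists (supp gen w), 1%g; split; first exact: finset.subsetT.
  exact: subgroup1 (std_subgroup _).
by rewrite conj_set1.
Qed.

End Parabolics.

(** * Reflections commuting with a power of w *)

Section Commuting.
Context {R : realType} {S : finType} {W : groupType} {gen : S -> W}.
Context {coxW : coxeter_system gen}.
Local Notation V := (vec R S).
Local Notation gram := (@gram_mx R S W gen).
Local Notation dot := (@form R S W gen).
Local Notation act := (@actv R S W gen coxW).
Implicit Types (u v b c : V) (s t : S) (w x y g : W) (I J K : {set S}).
Local Notation root := (@root_vector R S W gen coxW).

Definition orthogonal I J := forall s t, s \in I -> t \in J -> gram s t = 0.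

Lemma orthogonal_commute I J x y : orthogonal I J ->
  std_sub gen I x -> std_sub gen J y -> commute x y.
Proof.
move=> o xI yJ.
have cg s t : s \in I -> t \in J -> commute (gen s) (gen t).
  move=> sI tJ; have st : s != t.
    by apply/eqP => e; have := o s t sI tJ; rewrite e gram_ss => /eqP; rewrite oner_eq0.
  have /eqP := o s t sI tJ; rewrite gram_eq0 // => /eqP; rewrite expgS expg1 => g.
  by have := mulg1_eq g; rewrite invgM !genV /commute => ->.
move: y yJ; apply: std_ind => [|t y tJ _ IH]; first exact: commute1.
apply: commuteM IH; move: x xI; apply: std_ind => [|s x sI _ IH].
  exact/commute_sym/commute1.
by apply/commute_sym/commuteM; apply/commute_sym => //; apply: cg.
Qed.

Lemma orthogonal_fix I J x v : orthogonal I J ->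
  std_sub gen I x -> supported J v -> act x v = v.
Proof.
move=> o xI vJ; move: x xI; apply: std_ind => [|s x sI _ IH]; first by rewrite act1.
rewrite actM IH act_gen refl_fix // dot_sum big1 // => t _; rewrite dot_svec gramC.
by case: (boolP (t \in J)) => tJ; [rewrite o ?mulr0|rewrite vJ ?mul0r].
Qed.

(** The group generated by I and J preserves the span of each of the two sets,
    and b is the image of a simple root under it. *)
Lemma root_split I J b : orthogonal I J -> root b -> supported (I :|: J) b ->
  supported I b \/ supported J b.
Proof.
move=> o rb bIJ; have [g [s [gIJ sIJ ->]]] := root_conj_simple rb bIJ.
have stable A C v : orthogonal A C -> supported C v ->
    forall x, std_sub gen (A :|: C) x -> supported C (act x v).
  move=> oAC vC; apply: std_ind => [|t x tAC _ IH]; first by rewrite act1.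
  rewrite actM act_gen; move: tAC; rewrite inE => /orP[tA|tC].
    by rewrite -act_gen (orthogonal_fix oAC (std_gen tA)).
  by rewrite -act_gen; apply: std_act => //; apply: std_gen.
move: sIJ; rewrite inE => /orP[sI|sJ]; [left|right].
  apply: (stable J) => //; last by rewrite finset.setUC.
    by move=> t u tJ uI; rewrite gramC o.
  exact: supported_svec.
by apply: (stable I) => //; apply: supported_svec.
Qed.

Lemma comp_orthogonal J K : K \in components gen J -> orthogonal (J :\: K) K.
Proof.
move=> KJ s t; rewrite inE => /andP[sK sJ] tK.
by rewrite gramC; apply: (comp_orth KJ).
Qed.

(** A root orthogonal to J whose support is not contained in J is supported
    on the vertices orthogonal to J: otherwise its restriction to some
    component of J would be dominant and not radical, which makes that
    component spherical. *)
Lemma orthogonal_root_perp J b : essential gen J -> root b ->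
  (forall s, s \in J -> dot b (svec s) = 0) -> ~ supported J b ->
    supported (perp gen J) b.
Proof.
move=> [_ Jess] rb bJ nJ.
wlog p : b rb bJ nJ / pos b.
  move=> H; case: (root_sign rb) => p; first exact: H.
  rewrite -[b]opprK; apply: supportedN; apply: H => //.
  - exact: rootN.
  - by move=> s sJ; rewrite dotNl bJ // oppr0.
  - by move=> /supportedN; rewrite opprK.
have bg s t : s \in J -> t \notin J -> entry b t * gram s t = 0.
  move=> sJ tJ; apply: contrapT => /eqP bg.
  have [K KJ sK] := comp_cover (gen := gen) sJ; apply: (Jess K KJ).
  pose a : V := [ffun j => if j \in K then b j else 0].
  have aE j : entry a j = if j \in K then entry b j else 0 by rewrite /entry ffunE.
  have KsubJ := fintype.subsetP (comp_sub KJ).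
  have ad j : j \in K -> dot a (svec j) = \sum_(i | i \notin J) - (entry b i * gram j i).
    move=> uK; rewrite dotC dot_svecl.
    have : dot b (svec j) = 0 by apply/bJ/KsubJ.
    rewrite dotC dot_svecl (bigID (mem K)) /= => /eqP; rewrite addr_eq0 => /eqP e.
    rewrite (bigID (mem K)) /= [X in _ + X]big1 => [|i /negPf iK]; last first.
      by rewrite aE iK mul0r.
    rewrite addr0 (eq_bigr (fun i => entry b i * gram j i)) => [|i iK]; last first.
      by rewrite aE iK.
    rewrite e -sumrN (bigID (mem J)) /= big1 ?add0r => [|i /andP[iK iJ]]; last first.
      by rewrite (comp_orth KJ) // mulr0 oppr0.
    apply: eq_bigl => i; apply/andP/idP => [[]//|iJ]; split=> //.
    by apply: contra iJ => /KsubJ.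
  have term j i : j \in K -> i \notin J -> 0 <= - (entry b i * gram j i).
    move=> uK iJ; rewrite oppr_ge0 mulr_ge0_le0 ?gram_le0 //.
    by apply: contraNneq iJ => <-; apply: KsubJ.
  apply: (dominant_spherical KJ (a := a)).
  - by move=> u /negPf uK; rewrite aE uK.
  - by move=> u; rewrite aE; case: ifP.
  - by move=> u uK; rewrite ad // sumr_ge0 // => i; apply: term.
  exists s => //; rewrite ad // (bigD1 t) //= ltr_pwDl //.
    by rewrite lt_neqAle term // eq_sym oppr_eq0 bg.
  by apply: sumr_ge0 => i /andP[iJ _]; apply: term.
have bU : supported (J :|: perp gen J) b.
  move=> t; rewrite inE negb_or => /andP[tJ tp]; apply: contrapT => /eqP bt.
  move/negP: tp; apply; rewrite !inE tJ /=; apply/forall_inP => s sJ.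
  have := bg s t sJ tJ => /eqP; rewrite mulf_eq0 (negPf bt) /= => g.
  have st : s != t by apply: contraNneq tJ => <-.
  rewrite gram_eq0 // in g; rewrite eq_sym.
  move/eqP: g; rewrite expgS expg1 => g.
  have := mulg1_eq g; rewrite invgM !genV => ->; exact: eqxx.
have oJ : orthogonal J (perp gen J).
  move=> s t sJ; rewrite !inE => /andP[tJ /forall_inP/(_ s sJ)/eqP e].
  have st : s != t by apply: contraNneq tJ => <-.
  apply/eqP; by rewrite gram_eq0 // expgS expg1 -{1}e !mulgA genKr cox_sqr.
by case: (root_split oJ rb bU).
Qed.

Lemma root_component J b : root b -> supported J b ->
  exists2 K, K \in components gen J & supported K b.
Proof.
move=> rb bJ; have [s bs] : exists s, entry b s != 0.
  apply: contrapT => /forallNP h; have /eqP := root_neq0 rb; apply.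
  by apply: vec_ext => s; rewrite entry0; apply/eqP/negPn/negP => /h.
have sJ : s \in J by apply: contraNT bs => /bJ ->.
have [K KJ sK] := comp_cover (gen := gen) sJ; exists K => //.
have KsubJ := fintype.subsetP (comp_sub KJ).
have [||//|h] := root_split (I := K) (J := J :\: K) _ rb.
- by move=> t u tK uK; rewrite gramC; apply: (comp_orthogonal KJ).
- move=> t; rewrite !inE negb_or negb_and negbK => /andP[tK /orP[h|/bJ //]].
  by rewrite h in tK.
by move: bs; rewrite h ?eqxx // !inE sK.
Qed.

Lemma prod_pull (I : finType) (P : pred I) i (F : I -> W) y : P i ->
  (forall j, P j -> j != i -> commute y (F j)) ->
  (\prod_(j | P j) ((if j == i then y else 1) * F j) = y * \prod_(j | P j) F j)%g.
Proof.
move=> Pi c; have := mem_index_enum i; have := index_enum_uniq I.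
elim: (index_enum I) => //= j r IH /andP[jr ur]; rewrite inE !big_cons.
have [e _|ij] := eqVneq i j.
  subst j; rewrite Pi ?eqxx mulgA; congr (_ * _)%g;
    rewrite big_seq_cond [RHS]big_seq_cond.
  apply: eq_bigr => k /andP[kr _]; case: eqP => [ki|]; last by rewrite mul1g.
  by move: jr; rewrite -ki kr.
move=> /= ir; rewrite IH // ?[j == i]eq_sym ?(negPf ij); case: ifP => // Pj.
by rewrite mul1g !mulgA c // eq_sym.
Qed.

Lemma std_prod J (I : finType) (P : pred I) (F : I -> W) :
  (forall i, P i -> std_sub gen J (F i)) -> std_sub gen J (\prod_(i | P i) F i)%g.
Proof.
move=> h; elim/big_ind: _ => //; first exact: subgroup1 (std_subgroup _).
by move=> x y xJ yJ; apply: (subgroupM (std_subgroup _)) xJ yJ.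
Qed.

Lemma aff_part_sub J K : K \in components gen J -> affine gen K ->
  K \subset aff_part gen J.
Proof.
move=> KJ Ka; apply/fintype.subsetP => s sK; apply/finset.bigcupP; exists K => //.
by rewrite KJ; apply/asboolP.
Qed.

Lemma aff_part_indef J K : K \in indef_components gen J -> aff_part gen J \subset J :\: K.
Proof.
rewrite inE => /andP[KJ /asboolP [_ _ Ka]].
apply/finset.bigcupsP => L /andP[LJ /asboolP La]; apply/fintype.subsetP => s sL.
rewrite inE (fintype.subsetP (comp_sub LJ)) // andbT; apply/negP => sK.
by apply: Ka; rewrite (comp_eq (R := R) KJ LJ sK sL).
Qed.

Lemma indef_disjoint J K L : K \in indef_components gen J ->
  L \in indef_components gen J -> L != K -> L \subset J :\: K.
Proof.
rewrite !inE => /andP[KJ _] /andP[LJ _] LK; apply/fintype.subsetP => s sL.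
rewrite inE (fintype.subsetP (comp_sub LJ)) // andbT; apply: contra LK => sK.
by rewrite (comp_eq (R := R) KJ LJ sK sL).
Qed.

Lemma indef_comp J K : K \in indef_components gen J -> K \in components gen J.
Proof. by rewrite inE => /andP[]. Qed.

Lemma comp_commute J K x y : K \in components gen J -> std_sub gen K x ->
  std_sub gen (J :\: K) y -> commute x y.
Proof.
move=> KJ xK yK; apply/commute_sym; apply: (orthogonal_commute _ yK xK).
exact: comp_orthogonal.
Qed.

Lemma decomposition_exists J w :
  (forall K, K \in components gen J -> affine gen K \/ indefinite gen K) ->
  std_sub gen J w -> exists (f : {set S} -> W) w0, decomposition gen J w w0 f.
Proof.
move=> Jcomp; move: w; apply: std_ind.
  exists (fun=> 1%g), 1%g; split.
  - exact: subgroup1 (std_subgroup _).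
  - by move=> K _; apply: subgroup1 (std_subgroup _).
  - by rewrite big1 ?mulg1.
move=> s w sJ wJ [v [w0 [w0a vK wE]]].
have [K KJ sK] := comp_cover (gen := gen) sJ.
case: (Jcomp K KJ) => Kt.
  exists v, (gen s * w0)%g; split=> //; last by rewrite wE mulgA.
  apply: (subgroupM (std_subgroup _)) _ w0a; apply: std_gen.
  exact: (fintype.subsetP (aff_part_sub KJ Kt)).
have Ki : K \in indef_components gen J by rewrite inE KJ; apply/asboolP.
exists (fun L => (if L == K then gen s else 1) * v L)%g, w0; split=> //.
  move=> L Li; apply: (subgroupM (std_subgroup _)) _ (vK L Li).
  case: eqP => [->|_]; [exact: std_gen|exact: subgroup1 (std_subgroup _)].
have c y : std_sub gen (J :\: K) y -> commute (gen s) y.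
  by apply: comp_commute => //; apply: std_gen.
rewrite wE mulgA c; last exact: std_mono (aff_part_indef Ki) _ w0a.
rewrite -mulgA; congr (_ * _)%g.
rewrite prod_pull // => M Mi MK; apply: c.
exact: std_mono (indef_disjoint Ki Mi MK) _ (vK M Mi).
Qed.

Lemma decomposition_factor J w w0 (v : {set S} -> W) K : decomposition gen J w w0 v ->
  K \in indef_components gen J ->
  exists2 u, std_sub gen (J :\: K) u & w = (v K * u)%g.
Proof.
move=> [w0a vK wE] Ki; have KJ := indef_comp Ki.
exists (w0 * \prod_(L in indef_components gen J) (if L == K then 1 else v L))%g.
  apply: (subgroupM (std_subgroup _)); first exact: std_mono (aff_part_indef Ki) _ w0a.
  apply: std_prod => L Li; case: eqP => [_|/eqP LK];
    first exact: subgroup1 (std_subgroup _).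
  exact: std_mono (indef_disjoint Ki Li LK) _ (vK L Li).
have c y : std_sub gen (J :\: K) y -> commute (v K) y.
  by apply: comp_commute => //; apply: vK.
rewrite mulgA c; last exact: std_mono (aff_part_indef Ki) _ w0a.
rewrite -mulgA wE; congr (_ * _)%g.
rewrite -(@prod_pull _ _ K) => [|//|L Li LK].
  by apply: eq_bigr => L _; case: eqP => [->|_]; rewrite ?mulg1 ?mul1g.
rewrite (negPf LK); apply: c.
exact: std_mono (indef_disjoint Ki Li LK) _ (vK L Li).
Qed.

End Commuting.

Section Support.
Context {R : realType} {S : finType} {W : groupType} {gen : S -> W}.
Context {coxW : coxeter_system gen}.
Local Notation V := (vec R S).
Local Notation act := (@actv R S W gen coxW).
Implicit Types (u v b c : V) (s t : S) (w x y g : W) (I J K : {set S}).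
Local Notation root := (@root_vector R S W gen coxW).
Local Notation root_refl := (@root_refl R S W gen coxW).

(** Enlarging a parabolic subgroup of W_K by the other components of J gives a
    parabolic subgroup of W, which contains a power of w along with that of x;
    hence it contains W_J. *)
Lemma factor_parabolic J K w x (u : W) n P :
  straight gen w -> K \in components gen J ->
  (forall P, parabolic gen [set: S]%SET P -> P w -> std_sub gen J `<=` P) ->
  std_sub gen K x -> std_sub gen (J :\: K) u -> w = (x * u)%g ->
  (0 < n)%N -> parabolic gen K P -> P (x ^+ n)%g -> std_sub gen K `<=` P.
Proof.
move=> sw KJ wJ xK uK wE n0 [I [v [IK vK ->]]] /conj_setP xn.
set I' := I :|: (J :\: K).
have sI' : subgroup (std_sub gen I') by apply: std_subgroup.
have sK : subgroup (std_sub gen K) by apply: std_subgroup.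
have II' : std_sub gen I `<=` std_sub gen I' by apply: (std_mono (finset.subsetUl _ _)).
have PJ : std_sub gen J `<=` conj_set v (std_sub gen I').
  have pP : parabolic gen [set: S]%SET (conj_set v (std_sub gen I')).
    by exists I', v; split; rewrite ?finset.subsetT //; exact: std_setT.
  apply: (wJ _ pP); apply: (straight_parabolic (R := R) sw n0 pP).
  have xu : commute x u by apply: (comp_commute (R := R) KJ).
  apply/conj_setP; rewrite wE expgMn //.
  have vu : commute v (u ^+ n)%g.
    by apply: commuteX; apply: (comp_commute (R := R) KJ).
  rewrite -!mulgA -vu 2!mulgA; apply: (subgroupM sI'); first exact: II'.
  by apply: (@subgroupX _ _ _ n sI'); apply: (std_mono (finset.subsetUr _ _)) uK.
have KI : K \subset I.
  apply/fintype.subsetP => s sK'.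
  have : std_sub gen I' (gen s).
    have := PJ (v * gen s * v^-1)%g; rewrite conj_setP !mulgA mulVg mul1g mulgVK.
    apply; apply: std_mono (comp_sub KJ) _ _.
    exact: (subgroupM sK (subgroupM sK vK (std_gen sK')) (subgroupV sK vK)).
  by move=> /(std_genE (R := R)); rewrite !inE sK' orbF.
move=> y yK; apply/conj_setP; apply: std_mono KI _ _.
exact: (subgroupM sK (subgroupM sK (subgroupV sK vK) yK) vK).
Qed.

Lemma Pmax_largest K x I P : Pmax gen K x = std_sub gen I ->
  parabolic gen K P -> finite_set P -> conj_set x P = P -> P `<=` std_sub gen I.
Proof.
rewrite /Pmax; case: xgetP => [Q -> [_ largest] <- pP fP xP|_ e].
  exact: largest.
by have : std_sub gen I 1%g; [apply: subgroup1 (std_subgroup _)|rewrite -e].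
Qed.

(** If the root b is not in the span of J, its reflection r normalises W_J and b
    is orthogonal to J. Otherwise b lies in the span of a component K; if K is
    indefinite, r lies in a finite parabolic subgroup of W_K normalised by the
    factor of w in W_K, hence in the largest one. *)
Lemma commuting_support w k b : straight gen w -> standard gen w ->
  root b -> (0 < k)%N -> act (w ^+ k)%g b = b ->
  supp gen (root_refl b) \subset
    perp gen (supp gen w) :|: sph_part gen (supp gen w) w :|: aff_part gen (supp gen w).
Proof.
move=> sw [J0 [Pc0 ess stdw]] rb k0 wb.
have J0E := Pc_supp (R := R) Pc0; rewrite {}J0E in Pc0 ess stdw.
set J := supp gen w in Pc0 ess stdw *.
have wJ : std_sub gen J w by apply: supp_std.
have sJ : subgroup (std_sub gen J) by apply: std_subgroup.
have wP P : parabolic gen [set: S]%SET P -> P w -> std_sub gen J `<=` P.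
  by move=> pP Pw; rewrite -Pc0; apply: Pc_min.
have supp_in I : supported I b -> supp gen (root_refl b) \subset I.
  by move=> bI; apply: supp_min; apply/root_refl_std.
have [bJ|nJ] := pselect (supported J b); last first.
  have bp : supported (perp gen J) b.
    apply: orthogonal_root_perp => // s sJ'.
    (* As r commutes with w^k, the parabolic subgroup r W_J r contains w^k. *)
    have : conj_set (root_refl b) (std_sub gen J) (gen s).
      have pP : parabolic gen [set: S]%SET (conj_set (root_refl b) (std_sub gen J)).
        by exists J, (root_refl b); split; rewrite ?finset.subsetT //; exact: std_setT.
      apply: (wP _ pP) (std_gen sJ'); apply: (straight_parabolic (R := R) sw k0 pP).
      apply/conj_setP.
      have e : (w ^+ k * root_refl b * (w ^+ k)^-1 =
        root_refl b)%g by rewrite -root_refl_act // wb.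
      have -> : ((root_refl b)^-1 * w ^+ k * root_refl b = w ^+ k)%g.
        by rewrite -mulgA -[(w ^+ k * root_refl b)%g](mulgVK (w ^+ k)%g) e mulKg.
      exact: (subgroupX _ sJ).
    move=> /conj_setP;
      rewrite -(root_refl_svec (R := R) s) -[X in (_ * X)%g]invgK -root_refl_act;
      last exact: root_svec.
    move=> /root_refl_std h; have {}h := h (root_act _ (root_svec s)).
    have VE : (root_refl b)^-1%g = root_refl b.
      apply: mulg1_eq; apply: (act_faithful (R := R)) => v.
      by rewrite actM !act_root_refl // reflvK ?root_dot // act1.
    rewrite VE act_root_refl // in h.
    apply: contrapT => /eqP d; apply: nJ => t tJ; have := h t tJ.
    have ts : t != s by apply: contraNneq tJ => ->.
    rewrite /reflect_along !entryE entry_svec (negPf ts) add0r => /eqP;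
      rewrite oppr_eq0 mulf_eq0.
    rewrite mulf_eq0 pnatr_eq0 /= dotC (negPf d) /= => /eqP //.
  apply: fintype.subset_trans (supp_in _ bp) _.
  by rewrite -finset.setUA finset.subsetUl.
have [K KJ bK] := root_component rb bJ.
have Kirr : K \in components gen K by apply: (comp_irreducible (R := R) KJ).
have Ksph : ~ spherical gen K by apply: ess.2.
have [Ka|Kna] := pselect (affine gen K).
  apply: fintype.subset_trans (supp_in _ bK) _.
  by apply: fintype.subset_trans (aff_part_sub KJ Ka) _; apply: finset.subsetUr.
have Ki : K \in indef_components gen J.
  by rewrite inE KJ; apply/asboolP; split; [exact: Kirr|exact: Ksph|exact: Kna].
have [_ _ [I IK PI]] := stdw K Ki.
have Jcomp L : L \in components gen J -> affine gen L \/ indefinite gen L.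
  move=> LJ; have [La|Lna] := pselect (affine gen L); [by left|right].
  by split=> //; [exact: (comp_irreducible (R := R) LJ)|exact: ess.2].
set x := indef_factor gen J w K in PI.
have [xK [u uK wE]] : std_sub gen K x /\
    exists2 u, std_sub gen (J :\: K) u & w = (x * u)%g.
  rewrite /x /indef_factor; case: xgetP => [v _ [w0 dec]|].
    split; last exact: (decomposition_factor (R := R) dec Ki).
    by case: dec => _ vK _; apply: vK.
  have [v [w0 dec]] := decomposition_exists (R := R) Jcomp wJ.
  by move=> /(_ v); case; exists w0.
have xu : commute x u by apply: (comp_commute (R := R) KJ).
have xb : act (x ^+ k)%g b = b.
  have ub : act (u ^+ k)%g b = b.
    apply: (orthogonal_fix (comp_orthogonal KJ)) bK.
    exact: (@subgroupX _ _ _ k (std_subgroup _) uK).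
  by rewrite -[RHS]wb wE expgMn // actM ub.
have nva : ~ virtually_abelian (std_sub gen K).
  by move=> va; apply: Kna; split; [exact: Kirr|exact: Ksph|exact: va].
have [P [pP fP xP Pb]] := periodic_parabolic Kirr xK
  (fun n P n0 pP => factor_parabolic sw KJ wP xK uK wE n0 pP) nva rb bK k0 xb.
pose I' := xget finset.set0
  [set I : {set S} | I \subset K /\ Pmax gen K x = std_sub gen I].
have I'P : Pmax gen K x = std_sub gen I'.
  by rewrite /I'; case: xgetP => [I2 _ []//|/(_ I)[]]; split.
have rI' : supp gen (root_refl b) \subset I'.
  by apply: supp_min; apply: (Pmax_largest I'P pP fP xP) Pb.
have I'sph : I' \subset sph_part gen J w.
  by apply/fintype.subsetP => s sI'; apply/finset.bigcupP; exists K.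
apply: fintype.subset_trans rI' (fintype.subset_trans I'sph _).
exact: fintype.subset_trans (finset.subsetUr _ _) (finset.subsetUl _ _).
Qed.

End Support.

(** * Half-spaces and divergence *)

Section HalfSpaces.
Context {R : realType} {S : finType} {W : groupType} {gen : S -> W}.
Context {coxW : coxeter_system gen}.
Local Notation V := (vec R S).
Local Notation act := (@actv R S W gen coxW).
Local Notation l := (length gen).
Implicit Types (u v b c : V) (s t : S) (w x y g : W) (I J K : {set S}).
Local Notation root := (@root_vector R S W gen coxW).
Local Notation root_refl := (@root_refl R S W gen coxW).
Implicit Types (a : set W).

(** The root, as a set of chambers, attached to the root vector b. *)
Definition half_space b : set W := [set y | pos (act y^-1%g b)].

Lemma simple_half_space g s : lcoset g (simple_root gen s) = half_space (act g (svec s)).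
Proof.
apply/seteqP; split=> y; rewrite lcosetP /half_space /simple_root /= -actM.
  rewrite pos_actE -(lengthV (g^-1 * y)%g) -[X in (_ < X)%N -> _]lengthV.
  by rewrite !invgM invgK genV.
rewrite pos_actE -(lengthV (g^-1 * y)%g) -[X in _ -> (_ < X)%N]lengthV.
by rewrite !invgM invgK genV.
Qed.

Lemma half_space_act g b : lcoset g (half_space b) = half_space (act g b).
Proof.
by apply/seteqP; split=> y; rewrite lcosetP /half_space /= invgM invgK actM.
Qed.

Lemma is_rootP a : is_root gen a <-> exists2 b, root b & a = half_space b.
Proof.
split=> [[v [s ->]]|[b [v [s ->]] ->]].
  by exists (act v (svec s)); [exists v, s|rewrite simple_half_space].
by exists v, s; rewrite simple_half_space.
Qed.

Lemma half_spaceC b : root b -> ~` half_space b = half_space (- b).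
Proof.
move=> rb; apply/seteqP; split=> y; rewrite /half_space /= actN.
  by move/(root_npos (root_act _ rb)).
by move/(root_npos (root_act _ rb)).
Qed.

Lemma half_space_inj b c : root b -> root c -> half_space b = half_space c -> b = c.
Proof.
move=> [v [s ->]] rc e; apply: (act_inj (w := v^-1%g)); rewrite actK.
have {}e y : pos (act y^-1%g (svec s)) <-> pos (act y^-1%g (act v^-1%g c)).
  rewrite -actM -invgM -[X in _ <-> X]/(half_space c (v * y)%g) -e /half_space /=.
  by rewrite invgM actM actK.
have rc' : root (act v^-1%g c) by apply: root_act.
have pc : pos (act v^-1%g c).
  by have := e 1%g; rewrite invg1 !act1 => h; apply/h/pos_svec.
apply: contrapT => ne.
have h : pos (act (gen s)^-1%g (act v^-1%g c)).
  by rewrite genV act_gen; apply: refl_pos => // h; apply: ne.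
move/e: h; rewrite genV act_gen refl_svec.
exact: root_asym (root_svec s) (@pos_svec _ _ s).
Qed.

Lemma reflection_half_space b : root b -> reflection gen (half_space b) = root_refl b.
Proof.
move=> rb; have E g s : half_space b = lcoset g (simple_root gen s) ->
    root_refl b = (g * gen s * g^-1)%g.
  rewrite simple_half_space => /half_space_inj -> //; last exact/root_act/root_svec.
  by rewrite root_refl_act ?root_refl_svec //; apply: root_svec.
rewrite /reflection; case: xgetP => [r _ [v [s [h ->]]]|h].
  by rewrite (E v s).
case: rb => v [s e]; case: (h (v * gen s * v^-1)%g).
by exists v, s; rewrite e simple_half_space.
Qed.

(** A root at distance less than M from 1 is an inversion of one of the finitely
    many elements of length less than M. *)
Lemma distance_diverges (r : nat -> V) : (forall n, root (r n)) ->
  (forall n, pos (r n)) ->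
  injective r -> dist1 gen (~` half_space (r n)) @[n --> \oo] --> \oo.
Proof.
move=> rr rp rinj; apply/cvgnyPge => M.
have /finite_setE [E EM] : finite_set [set y | (l y <= M)%N] by apply: finite_ball.
pose Li y := xget [::] [set L : seq V |
  forall b, root b -> pos b -> pos (- act y^-1%g b) -> b \in L].
have LiP y b : root b -> pos b -> pos (- act y^-1%g b) -> b \in Li y.
  rewrite /Li; case: xgetP => [L _|]; first exact.
  by have [L h] := @inversions_finite R S W gen coxW y => /(_ L).
pose L := flatten [seq Li y | y <- E].
have [N NP] : exists N, forall n, (N <= n)%N -> r n \notin L.
  elim: L => [|z L [N NP]]; first by exists 0%N.
  have [[n0 e]|h] := pselect (exists n, r n = z).
    exists (maxn N n0.+1) => n; rewrite geq_max => /andP[Nn n0n].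
    rewrite inE negb_or NP // andbT -e; apply/eqP => /rinj nn.
    by rewrite nn ltnn in n0n.
  exists N => n Nn; rewrite inE negb_or NP // andbT; apply/eqP => e.
  by apply: h; exists n.
exists N => // n /= Nn; rewrite leqNgt; apply/negP => lt.
have [|[y yr ly] _] := @min_natP [set length gen (1^-1 * y)%g | y in ~` half_space (r n)].
  exists (l (1^-1 * root_refl (r n))%g), (root_refl (r n)) => //;
    rewrite half_spaceC // /half_space /=.
  have VE : (root_refl (r n))^-1%g = root_refl (r n).
    apply: mulg1_eq; apply: (act_faithful (R := R)) => v.
    by rewrite actM !act_root_refl // reflvK ?root_dot // act1.
  by rewrite VE actN act_root_refl // reflv_self ?root_dot // opprK.
move/negP: (NP n Nn); apply; apply/flatten_mapP; exists y.
  apply: EM => /=; apply: ltnW; apply: leq_ltn_trans lt.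
  by rewrite /dist1 -ly invg1 mul1g.
apply: LiP => //; move: yr; rewrite half_spaceC // /half_space /= actN //.
Qed.

Lemma not_periodic_inj g b : (forall k, (0 < k)%N -> act (g ^+ k)%g b <> b) ->
  injective (fun n => act (g ^+ n)%g b).
Proof.
move=> np; have h n m : (n < m)%N -> act (g ^+ n)%g b <> act (g ^+ m)%g b.
  move=> nm e; apply: (np (m - n)%N); first by rewrite subn_gt0.
  by apply: (act_inj (w := (g ^+ n)%g)); rewrite -actM -expgnDr subnKC // ltnW.
move=> n m e; have [nm|mn|//] := ltngtP n m; first by case: (h _ _ nm).
by case: (h _ _ mn).
Qed.

Lemma root_distance_diverges w a : straight gen w -> standard gen w -> is_root gen a ->
  (forall n, a (w ^+ n)%g /\ a (w ^- n)%g) ->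
  ~~ (root_supp gen a \subset perp gen (supp gen w) :|: sph_part gen (supp gen w) w
        :|: aff_part gen (supp gen w)) ->
  forall x, x = w \/ x = w^-1%g ->
    dist1 gen (~` lcoset (x ^+ n)%g a) @[n --> \oo] --> \oo.
Proof.
move=> sw stw /is_rootP [b rb ->] aw na x xE.
have np k : (0 < k)%N -> act (w ^+ k)%g b <> b.
  move=> k0 e; move/negP: na; apply; rewrite /root_supp reflection_half_space //.
  exact: commuting_support e.
have npx k : (0 < k)%N -> act (x ^+ k)%g b <> b.
  move=> k0; case: xE => ->; first exact: np.
  by rewrite expVgn => e; apply: (np k k0); rewrite -{1}e actVK.
have px n : pos (act (x ^+ n)%g b).
  have [h1 h2] := aw n; case: xE => ->; first by move: h2; rewrite /half_space /= invgK.
  by rewrite expVgn.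
have -> : (fun n => dist1 gen (~` lcoset (x ^+ n)%g (half_space b))) =
    (fun n => dist1 gen (~` half_space (act (x ^+ n)%g b))).
  by apply: funext => n; rewrite half_space_act.
exact: distance_diverges (fun n => root_act _ rb) px (not_periodic_inj npx).
Qed.

Lemma is_rootC a : is_root gen a -> is_root gen (~` a).
Proof.
by move=> /is_rootP [b rb ->]; apply/is_rootP; exists (- b); rewrite ?half_spaceC //;
  apply: rootN.
Qed.

Lemma is_root_lcoset g a : is_root gen a -> is_root gen (lcoset g a).
Proof.
move=> /is_rootP [b rb ->]; apply/is_rootP.
by exists (act g b); [apply: root_act|rewrite half_space_act].
Qed.

End HalfSpaces.

Lemma lcosetM (G : groupType) (x y : G) A : lcoset (x * y)%g A = lcoset x (lcoset y A).
Proof. by apply/seteqP; split=> z; rewrite !lcosetP invgM mulgA. Qed.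

Lemma lcoset1 (G : groupType) (A : set G) : lcoset 1%g A = A.
Proof. by apply/seteqP; split=> z; rewrite lcosetP invg1 mul1g. Qed.

(** * The action of N on the root groups *)

Section RootGroups.
Context {R : realType} {S : finType} {W : groupType} {gen : S -> W}.
Context {coxW : coxeter_system gen} {G : groupType} {U : set W -> set G}.

Lemma weyl_graph_conj p : weyl_graph gen U p ->
  forall a, is_root gen a -> conj_set p.1 (U a) = U (lcoset p.2 a).
Proof.
move: p; apply: gen_sub_min.
  split=> [a _|x y xP yP a ra] /=; first by rewrite conj_set1 lcoset1.
  have ra' : is_root gen (lcoset y.2^-1%g a) by apply: (is_root_lcoset (R := R)).
  have e : conj_set y.1^-1%g (U a) = U (lcoset y.2^-1%g a).
    have := yP _ ra'; rewrite -lcosetM mulgV lcoset1 => <-.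
    by rewrite -conj_setM mulVg conj_set1.
  by rewrite conj_setM lcosetM e xP.
move=> p [[t tT <-]|[s [u [_ _ [u' [u'' [_ _ _ h]]] e]]]] a ra /=.
  by rewrite lcoset1; apply: tT.
by rewrite h // e.
Qed.

Context {H : topologicalGroupType} {iota : G -> H}.
Context (iotaM : {morph iota : x y / (x * y)%g}).

Lemma iotaX g n : (iota g ^+ n)%g = iota (g ^+ n)%g.
Proof.
elim: n => [|n IH]; last by rewrite !expgS iotaM IH.
by apply: (mulgI (iota 1%g)); rewrite !expg0 -iotaM !mulg1.
Qed.

Lemma iotaV g : (iota g)^-1%g = iota g^-1%g.
Proof.
apply: (mulgI (iota g)); rewrite mulgV -iotaM mulgV.
by have := iotaX g 0; rewrite !expg0.
Qed.

(** Conjugation by m^n maps U_a onto U_(v^n a), and the (FPRS) property applies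
    to the complements of the roots v^n a. *)
Lemma root_group_con m v a : FPRS gen U iota -> weyl_graph gen U (m, v) ->
  is_root gen a -> dist1 gen (~` lcoset (v ^+ n)%g a) @[n --> \oo] --> \oo ->
  iota @` U a `<=` con (iota m).
Proof.
move=> fprs mv ra dv _ [u Uu <-] B; rewrite nbhsE => -[V [oV V1] VB].
have mvX n : weyl_graph gen U (m ^+ n, v ^+ n)%g.
  elim: n => [|n IH]; first exact: subgroup1 (gen_sub_subgroup _).
  by rewrite !expgS; apply: (subgroupM (gen_sub_subgroup _)) mv IH.
have rv n : is_root gen (lcoset (v ^+ n)%g a) by apply: (is_root_lcoset (R := R)).
have [n|N NV] := fprs (fun n => ~` lcoset (v ^+ n)%g a) _ dv V oV V1.
  exact: (is_rootC (R := R)).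
exists N => // n Nn; apply: VB; apply: (NV n Nn); rewrite setCK.
exists (m ^+ n * u * (m ^+ n)^-1)%g.
  by rewrite -(weyl_graph_conj (mvX n) ra); exists u.
by rewrite iotaX iotaV !iotaM.
Qed.

End RootGroups.

(** * Contraction of the root groups *)

Section ConcreteReals.
Import Rstruct.
(** The geometric representation needs some field of real numbers. *)
Definition real_numbers : realType := Rdefinitions.R.
End ConcreteReals.

Local Close Scope ring_scope.
Local Open Scope group_scope.
Unset Implicit Arguments.

Theorem proposition5p11
  (S : finType) (W : groupType) (gen : S -> W) (coxW : coxeter_system gen)
  (G : groupType) (U : set W -> set G) (rgdU : rgd_system gen U)
  (finU : forall a, is_root gen a -> finite_set (U a))
  (H : topologicalGroupType) (iota : G -> H)
  (act : H -> chamber gen U -> chamber gen U)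
  (complH : completion iota act)
  (stabH : forall x : chamber gen U,
     compact [set h | act h x = x] /\ open [set h | act h x = x])
  (tilde : W -> G) (tildeP : forall v, weyl_graph gen U (tilde v, v))
  (fprsH : FPRS gen U iota)
  (w : W) (straight_w : straight gen w) (standard_w : standard gen w)
  (J : {set S}) (defJ : J = supp gen w)
  (alpha : set W) (root_alpha : is_root gen alpha)
  (alpha_w : forall n : nat, alpha (w ^+ n) /\ alpha (w ^- n))
  (supp_alpha : ~~ (root_supp gen alpha
     \subset perp gen J :|: sph_part gen J w :|: aff_part gen J)) :
  let tw := iota (tilde w) in
  iota @` U alpha `<=` con tw `&` con tw^-1 /\
  con tw `&` con tw^-1 `<=` nub tw.
Proof.
move=> tw; split; last by move=> h [hc hc']; split; apply: subset_closure.
have iotaM := compl_morph complH.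
have divergence x : x = w \/ x = w^-1 ->
    dist1 gen (~` lcoset (x ^+ n) alpha) @[n --> \oo] --> \oo.
  by apply: (root_distance_diverges (R := real_numbers)) => //; rewrite -defJ.
move=> h hU; split.
  apply: (root_group_con (R := real_numbers)) (tildeP w) root_alpha _ _ hU => //.
  by apply: divergence; left.
rewrite /tw iotaV //.
have twV : weyl_graph gen U ((tilde w)^-1, w^-1).
  exact: (subgroupV (gen_sub_subgroup _) (tildeP w)).
apply: (root_group_con (R := real_numbers)) twV root_alpha _ _ hU => //.
by apply: divergence; right.
Qed.
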